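(* Let $(a_n)_{n\ge 1}$ be a sequence of complex numbers with $\lim_{n\to\infty} n^{1/2}|a_n| = 0$, and let $(\varepsilon_n)_{n\ge 1}$ be chosen independently and uniformly at random from $\{\pm 1\}$. Then almost surely the set of points $z\in\mathbb{C}$ with $|z|=1$ such that $\sum_{n=1}^{\infty}\varepsilon_n a_n z^{n}$ converges has Hausdorff dimension $1$.
   Context: Convergence of the series means convergence of its sequence of partial sums. The sequence $(a_n)$ is deterministic. *)

(* Defs.v *)
From HB Require Import structures.
From mathcomp Require Export all_boot all_order all_algebra.
From mathcomp Require Export finmap.
From mathcomp Require Export all_classical all_reals all_analysis.
From mathcomp Require Export complex.
Export numFieldNormedType.Exports.

Set Implicit Arguments.
Unset Strict Implicit.
Unset Printing Implicit Defensive.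

Import Order.TTheory GRing.Theory Num.Theory.

Local Open Scope classical_set_scope.
Local Open Scope ring_scope.

Section Hausdorff.
Context {R : realType} {V : normedZmodType R}.
Implicit Types (A U : set V) (s delta : R).

Definition diam U : \bar R :=
  ereal_sup [set `|p.1 - p.2|%:E | p in U `*` U].

(* The test matters for [s = 0] only: [poweR x 0 = 1] for every [x], whereas the
   empty set must contribute 0, so that sequences [U] represent finite covers. *)
Definition diam_pow s U : \bar R :=
  if `[< U = set0 >] then 0%E else poweR (diam U) s.

Definition hausdorff_content s delta A : \bar R :=
  ereal_inf [set (\sum_(0 <= k <oo) diam_pow s (U k))%E | U in
    [set U : nat -> set V | A `<=` \bigcup_k U k /\
       forall k, (diam (U k) <= delta%:E)%E]].

(* The content is nonincreasing in [delta], so the supremum over [delta > 0] is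
   the limit as [delta] tends to 0. *)
Definition hausdorff_measure s A : \bar R :=
  ereal_sup [set hausdorff_content s delta A | delta in [set x : R | 0 < x]].

Definition hausdorff_dim A : \bar R :=
  ereal_inf [set s%:E | s in [set s : R | 0 <= s /\ hausdorff_measure s A = 0%E]].

End Hausdorff.

Section Independence.
Context {d d' : measure_display} {T : measurableType d} {T' : measurableType d'}.
Context {R : realType} {I : choiceType}.

Definition mutually_independent (P : probability T R) (D : set I)
    (X : I -> {RV P >-> T'}) : Prop :=
  forall (J : {fset I}) (B : I -> set T'),
    [set` J] `<=` D ->
    (forall i, i \in J -> measurable (B i)) ->
    P (\bigcap_(i in [set` J]) (X i @^-1` B i)) =
    (\prod_(i <- J) P (X i @^-1` B i))%E.

End Independence.

Section RandomSigns.
Context {d : measure_display} {T : measurableType d} {R : realType}.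

Definition random_sign (P : probability T R) (X : {RV P >-> R}) : Prop :=
  P (X @^-1` [set 1]) = (2^-1)%:E /\ P (X @^-1` [set -1]) = (2^-1)%:E.

End RandomSigns.

Section PowerSeries.
Context {R : realType}.
Local Open Scope complex_scope.

Definition psum (c : nat -> R[i]) (z : R[i]) (N : nat) : R[i] :=
  \sum_(1 <= n < N.+1) c n * z ^+ n.

(* [R[i]] carries the topology of its modulus.  The points are collected in
   [Rcomplex R], the copy of [R[i]] whose modulus takes its values in [R]. *)
Definition circle_convergence_set (c : nat -> R[i]) : set (Rcomplex R) :=
  [set z | ComplexField.Normc.normc z = 1 /\ cvgn (psum c z : nat -> R[i]^o)].

End PowerSeries.

(* Main.v *)
Require Import Defs.
From mathcomp Require Import ring lra zify.
Import Order.TTheory GRing.Theory Num.Theory.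
Local Open Scope classical_set_scope.
Local Open Scope ring_scope.
Set Implicit Arguments.
Unset Strict Implicit.
Unset Printing Implicit Defensive.

(** A random measure on the circle is built that lives on points of convergence and
    has bounded energy of any prescribed exponent below 1.

    The indices are cut into stages [h ^ (b * i) <= n < h ^ (b * i.+1)].  Since
    [n * |a n| ^ 2] tends to 0, so does the variance of a stage, and there are
    radii [delta i = 2 ^ (- e i)] that tend to 0, are halved from time to time
    only, and stay far above the standard deviation of the stage [i].  A maximal
    run of stages with the same radius is an epoch.  A point of the circle is
    confined as long as, within each epoch, its partial sums stay in the disc of
    radius [delta i] around the partial sum with which the epoch began.  The radii
    are summable over the epochs, so that the series converges at a point that is
    confined forever ([confined], [confined_angle_cvg]).

    From a confined position a stage is survived with probability at least
    [1 / 11], whatever the number of its terms: by second and fourth moments, a sum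
    of random signs with isotropic covariance has a fair chance to point back to
    the centre ([small_ball], [survival_lb]).  The covariance is isotropic if the
    sum of the [(a n * z ^+ n) ^+ 2] is small, and orthogonality on a fine grid of
    points shows that this fails at few of them ([isotropic_weight_sum]).  A smooth
    indicator of survival, divided by the conditional probability of survival, is
    the factor by which a [density] is multiplied in each stage: the density is a
    martingale, and it is at most [11 ^+ k] after [k] stages, a small power of the
    size of the indices.

    The mass of a set of points of the grid is then also a martingale.  Its
    increments are small: the Poincare inequality bounds their variance by the
    influences of the single signs, the sign of index [n] acts to first order
    through the [n]-th Fourier mode of the gradient, and Bessel's inequality sums
    the squares of these modes ([influence_bound], [mass_step]).  Hence the mass of
    an arc stays comparable, in mean square, to the length of the arc as soon as
    the stages reach the scale of the arc, and the energy of exponent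
    [1 - 2 / (b - 21)] is bounded in mean, uniformly in the number of stages
    ([expect_energy]).  With probability close to 1 the points that are confined
    during [k] stages therefore carry a large mass of bounded energy
    ([spread_prob]).

    With probability close to 1 this happens for infinitely many [k]
    ([liminf_prob]).  The sets of points confined during [k] stages are compact and
    decrease with [k], so that a cover of the points confined forever covers all
    points confined during [k] stages for some [k]; by the bound on the energy, it
    cannot consist of few short arcs ([energy_cover], [content_pos]).  The
    exponent tends to 1 with [b].  That the dimension is at most 1 is seen on
    covers of the circle by equal arcs ([content_circle]). *)

(** * Averages over the signs with indices in an interval *)

Definition signs := nat -> bool.

Definition upd (w : signs) (n : nat) b : signs := fun k => if k == n then b else w k.

Definition flip (w : signs) (n : nat) : signs := upd w n (~~ w n).

Definition agree_off a k (w w' : signs) :=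
  forall n, ~~ (a <= n < a + k)%N -> w n = w' n.

Section Averages.
Context {R : realType}.
Implicit Types (f g : signs -> R) (w : signs).

Definition avg1 n f w : R := (f (upd w n true) + f (upd w n false)) / 2.

(** The conditional expectation of [f] given the signs with indices outside
    [a, a + k).  It is again a function of all signs, so that conditional
    expectations compose without a change of space. *)
Fixpoint avg a k f : signs -> R :=
  if k is k'.+1 then avg1 a (avg a.+1 k' f) else f.

Definition adapted (lo hi : nat) {X : Type} (f : signs -> X) :=
  forall w w', (forall n, (lo <= n < hi)%N -> w n = w' n) -> f w = f w'.

Lemma flip_at w n : flip w n n = ~~ w n.
Proof. by rewrite /flip /upd eqxx. Qed.

Lemma flip_off w n k : k != n -> flip w n k = w k.
Proof. by rewrite /flip /upd => /negbTE ->. Qed.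

Lemma agree_offS_upd a k w w' b :
  agree_off a.+1 k (upd w a b) w' -> agree_off a k.+1 w w'.
Proof.
move=> h n hn; rewrite -(h n); last by apply: contra hn; lia.
by rewrite /upd; case: eqP => // na; move: hn; rewrite na; lia.
Qed.

Lemma avg_le a k f g w :
  (forall w', agree_off a k w w' -> f w' <= g w') -> avg a k f w <= avg a k g w.
Proof.
elim: k a w => [|k IH] a w h /=; first exact: h.
rewrite /avg1 ler_pM2r ?invr_gt0 //; apply: lerD; apply: IH => w' hw';
  by apply: h; apply: agree_offS_upd hw'.
Qed.

Lemma avg_eq a k f g w :
  (forall w', agree_off a k w w' -> f w' = g w') -> avg a k f w = avg a k g w.
Proof.
by move=> h; apply/eqP; rewrite eq_le !avg_le // => w' /h ->.
Qed.

Lemma avg_cst a k c w : avg a k (fun=> c) w = c.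
Proof.
elim: k a w => [|k IH] a w //=; rewrite /avg1 !IH; lra.
Qed.

Lemma avg_cst_at a k f c w :
  (forall w', agree_off a k w w' -> f w' = c) -> avg a k f w = c.
Proof. by move=> h; rewrite -[RHS](avg_cst a k c w); apply: avg_eq. Qed.

Lemma avg_le_cst a k f c w :
  (forall w', agree_off a k w w' -> f w' <= c) -> avg a k f w <= c.
Proof. by move=> h; rewrite -(avg_cst a k c w); apply: avg_le. Qed.

Lemma avgD a k f g w :
  avg a k (fun w => f w + g w) w = avg a k f w + avg a k g w.
Proof.
elim: k a w => [|k IH] a w //=; rewrite /avg1 !IH; ring.
Qed.

Lemma avgZ a k c f w : avg a k (fun w => c * f w) w = c * avg a k f w.
Proof.
elim: k a w => [|k IH] a w //=; rewrite /avg1 !IH; ring.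
Qed.

Lemma avg_pull a k f g c w :
  (forall w', agree_off a k w w' -> g w' = c) ->
  avg a k (fun w => g w * f w) w = c * avg a k f w.
Proof. by move=> h; rewrite -avgZ; apply: avg_eq => w' /h ->. Qed.

Lemma avg_sum (I : Type) (r : seq I) (P : pred I) a k (F : I -> signs -> R) w :
  avg a k (fun w => \sum_(i <- r | P i) F i w) w =
  \sum_(i <- r | P i) avg a k (F i) w.
Proof.
elim: r => [|i r IH].
  by rewrite big_nil; apply: avg_cst_at => w' _; rewrite big_nil.
rewrite big_cons; case: ifP => hP.
  rewrite -IH -avgD; apply: avg_eq => w' _; by rewrite big_cons hP.
by rewrite -IH; apply: avg_eq => w' _; rewrite big_cons hP.
Qed.

Lemma avg_split a k l f w :
  avg a (k + l)%N f w = avg a k (avg (a + k)%N l f) w.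
Proof.
elim: k a w => [|k IH] a w; first by rewrite add0n /= addn0.
rewrite addSn /=.
by rewrite /avg1 !IH addSnnS.
Qed.

Lemma avg_adapted lo hi a k f w :
  adapted lo hi f -> (hi <= a)%N -> avg a k f w = f w.
Proof.
move=> h ha; apply: avg_cst_at => w' hw'; apply/esym/h => n hn.
by apply: hw'; lia.
Qed.

Lemma avg_adapted_tail lo a k f : (lo <= a)%N ->
  adapted lo (a + k) f -> adapted lo a (avg a k f).
Proof.
elim: k a => [|k IH] a la hf; first by rewrite addn0 in hf.
have {}IH : adapted lo a.+1 (avg a.+1 k f).
  by apply: IH; rewrite ?addSnnS // ltnW.
move=> w w' hw /=; rewrite /avg1; congr ((_ + _) / _); apply: IH => n hn;
  by rewrite /upd; case: eqP => // na; apply: hw; lia.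
Qed.

Definition negate a k w : signs :=
  fun n => if (a <= n < a + k)%N then ~~ w n else w n.

Lemma avg_flip a k f n w : ~~ (a <= n < a + k)%N ->
  avg a k (fun w => f (flip w n)) w = avg a k f (flip w n).
Proof.
elim: k a w => [|k IH] a w // hn /=.
have na : n != a by apply: contra hn => /eqP ->; lia.
have comm b : upd (flip w n) a b = flip (upd w a b) n.
  apply/funext => m; rewrite /flip /upd (negbTE na).
  case: (eqVneq m a) => // ->; by rewrite eq_sym (negbTE na).
by rewrite /avg1 !IH ?comm //; apply: contra hn; lia.
Qed.

(** The sign flips are measure preserving: this gives the symmetry of the sums. *)
Lemma avg_negate a k f w : avg a k (fun w => f (negate a k w)) w = avg a k f w.
Proof.
elim: k a f w => [|k IH] a f w /=.
  by congr f; apply/funext => n; rewrite /negate; case: ifP => //; lia.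
have neg1 w' : negate a k.+1 w' = flip (negate a.+1 k w') a.
  apply/funext => n; rewrite /negate /flip /upd.
  case: (eqVneq n a) => [->|na]; first by rewrite leqnn ltnn /= ifT //; lia.
  by congr (if _ then _ else _); lia.
have -> : (fun w => f (negate a k.+1 w)) =
    (fun w => (fun w => f (flip w a)) (negate a.+1 k w)).
  by apply/funext => w'; rewrite neg1.
rewrite /avg1 !(IH _ (fun w => f (flip w a))) !avg_flip; try lia.
have fl b : flip (upd w a b) a = upd w a (~~ b).
  by apply/funext => n; rewrite /flip /upd eqxx; case: eqP.
by rewrite !fl addrC.
Qed.

(** The second moment is split at the first sign: the two halves are bounded by
    induction, and the squared difference of their means is at most the
    influence of that sign, by Jensen's inequality. *)
Lemma poincare a k f w :
  avg a k (fun w => f w ^+ 2) w <=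
  avg a k f w ^+ 2 +
  \sum_(a <= n < (a + k)%N) avg a k (fun w => ((f w - f (flip w n)) / 2) ^+ 2) w.
Proof.
have jensen a' k' g w' : avg a' k' g w' ^+ 2 <= avg a' k' (fun w => g w ^+ 2) w'.
  elim: k' a' w' => [|k' IH] a' w' //=.
  apply: (@le_trans _ _ ((avg a'.+1 k' g (upd w' a' true) ^+ 2 +
    avg a'.+1 k' g (upd w' a' false) ^+ 2) / 2)); last first.
    by rewrite /avg1 ler_pM2r ?invr_gt0 //; apply: lerD.
  rewrite /avg1; set x := avg _ _ _ _; set y := avg _ _ _ _.
  by rewrite -subr_ge0 (_ : _ - _ = ((x - y) / 2) ^+ 2) ?sqr_ge0 //; field.
elim: k a f w => [|k IH] a f w; first by rewrite addn0 big_geq ?addr0.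
rewrite big_ltn ?addnS ?ltnS ?leq_addr //= /avg1 -addSn.
set x := avg a.+1 k f (upd w a true); set y := avg a.+1 k f (upd w a false).
have h1 := IH a.+1 f (upd w a true).
have h2 := IH a.+1 f (upd w a false).
have h3 : ((x - y) / 2) ^+ 2 <=
    (avg a.+1 k (fun w => ((f w - f (flip w a)) / 2) ^+ 2) (upd w a true) +
     avg a.+1 k (fun w => ((f w - f (flip w a)) / 2) ^+ 2) (upd w a false)) / 2.
  have e b : ((x - y) / 2) ^+ 2 <=
     avg a.+1 k (fun w => ((f w - f (flip w a)) / 2) ^+ 2) (upd w a b).
    have -> : (x - y) / 2 =
      (-1) ^+ (~~ b) * avg a.+1 k (fun w => (f w - f (flip w a)) / 2) (upd w a b).
      have -> : avg a.+1 k (fun w => (f w - f (flip w a)) / 2) (upd w a b) =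
         2^-1 * (avg a.+1 k f (upd w a b) +
           (-1) * avg a.+1 k (fun w => f (flip w a)) (upd w a b)).
        by rewrite -avgZ -avgD -avgZ; apply: avg_eq => w' _; ring.
      rewrite avg_flip; last lia.
      have -> : flip (upd w a b) a = upd w a (~~ b).
        by apply/funext => n; rewrite /flip /upd eqxx; case: eqP.
      by rewrite /x /y; case: b => /=; field.
    by rewrite exprMn sqrr_sign mul1r; apply: jensen.
  by have := e true; have := e false; lra.
have -> : \sum_(a.+1 <= n < (a.+1 + k)%N)
     (avg a.+1 k (fun w => ((f w - f (flip w n)) / 2) ^+ 2) (upd w a true) +
      avg a.+1 k (fun w => ((f w - f (flip w n)) / 2) ^+ 2) (upd w a false)) / 2
  = (\sum_(a.+1 <= n < (a.+1 + k)%N)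
     avg a.+1 k (fun w => ((f w - f (flip w n)) / 2) ^+ 2) (upd w a true) +
    \sum_(a.+1 <= n < (a.+1 + k)%N)
     avg a.+1 k (fun w => ((f w - f (flip w n)) / 2) ^+ 2) (upd w a false)) / 2.
  by rewrite -big_split /= mulr_suml.
have h4 : (x ^+ 2 + y ^+ 2) / 2 = ((x + y) / 2) ^+ 2 + ((x - y) / 2) ^+ 2 by field.
by rewrite -/x -/y in h1 h2; lra.
Qed.

End Averages.

(** * Sums of random signs *)

Section RandomSums.
Context {R : realType}.
Local Open Scope complex_scope.
Implicit Types (s t x y z : R[i]) (w : signs) (X : nat -> R[i]).

Definition sqn z : R := complex.Re z ^+ 2 + complex.Im z ^+ 2.
Definition dotp s t : R :=
  complex.Re s * complex.Re t + complex.Im s * complex.Im t.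

Lemma sqn_ge0 z : 0 <= sqn z.
Proof. by rewrite addr_ge0 ?sqr_ge0. Qed.

Lemma sqnD s t : sqn (s + t) = sqn s + 2 * dotp s t + sqn t.
Proof. by case: s t => [a b] [c d]; rewrite /sqn /dotp /=; ring. Qed.

Lemma sqnN s : sqn (- s) = sqn s.
Proof. by case: s => [a b]; rewrite /sqn /=; ring. Qed.

Lemma sqnM s t : sqn (s * t) = sqn s * sqn t.
Proof. by case: s t => [a b] [c d]; rewrite /sqn /=; ring. Qed.

Lemma sqnX s n : sqn (s ^+ n) = sqn s ^+ n.
Proof.
elim: n => [|n IH]; last by rewrite !exprS sqnM IH.
by rewrite !expr0 /sqn /= expr1n expr0n addr0.
Qed.

Lemma sqnC (r : R) : sqn r%:C = r ^+ 2.
Proof. by rewrite /sqn /= expr0n addr0. Qed.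

Lemma sqn0 : sqn 0 = 0.
Proof. by rewrite /sqn /= expr0n addr0. Qed.

Lemma dotp_sqr s t : dotp s t ^+ 2 <= sqn s * sqn t.
Proof.
rewrite -subr_ge0 /dotp /sqn.
case: s t => [a b] [c d] /=.
by rewrite (_ : _ - _ = (a * d - b * c) ^+ 2) ?sqr_ge0 //; ring.
Qed.

Lemma normcE2 z : ComplexField.Normc.normc z ^+ 2 = sqn z.
Proof. by case: z => a b; rewrite /= sqr_sqrtr // addr_ge0 ?sqr_ge0. Qed.

Definition sg (b : bool) : R := if b then 1 else -1.

Lemma sg_sqr b : sg b ^+ 2 = 1.
Proof. by case: b; rewrite /sg ?sqrrN expr1n. Qed.

Lemma sgN b : sg (~~ b) = - sg b.
Proof. by case: b; rewrite /sg //= opprK. Qed.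

Definition wsum X w a n : R[i] := \sum_(a <= m < n) (sg (w m))%:C * X m.

Lemma wsum_geq X w a n : (n <= a)%N -> wsum X w a n = 0.
Proof. by move=> h; rewrite /wsum big_geq. Qed.

Lemma wsum_ltn X w a n : (a < n)%N ->
  wsum X w a n = (sg (w a))%:C * X a + wsum X w a.+1 n.
Proof. by move=> h; rewrite /wsum big_ltn. Qed.

Lemma wsum_cat X w a b c : (a <= b <= c)%N ->
  wsum X w a c = wsum X w a b + wsum X w b c.
Proof. by move=> /andP[ab bc]; rewrite /wsum (big_cat_nat ab bc). Qed.

Lemma wsum_ext X w w' a n : (forall m, (a <= m < n)%N -> w m = w' m) ->
  wsum X w a n = wsum X w' a n.
Proof. by move=> h; apply: eq_big_nat => m /h ->. Qed.

Lemma wsum_negate X w a k n : (n <= a + k)%N ->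
  wsum X (negate a k w) a n = - wsum X w a n.
Proof.
move=> h; rewrite /wsum -sumrN; apply: eq_big_nat => m hm.
rewrite /negate ifT; last by lia.
by rewrite sgN rmorphN mulNr.
Qed.

Lemma wsum_flip X w a n m :
  wsum X (flip w m) a n = wsum X w a n +
    (if (a <= m < n)%N then (- (2 * sg (w m)))%:C * X m else 0).
Proof.
case: ifP => [hm|hm]; last first.
  by rewrite addr0; apply: wsum_ext => l hl; rewrite flip_off //; lia.
have am : (a <= m <= n)%N by lia.
rewrite (wsum_cat _ _ am) [in RHS](wsum_cat _ _ am).
rewrite !(@wsum_ltn _ _ m) ?flip_at; try lia.
rewrite (@wsum_ext _ (flip w m) w a m); last by move=> l hl; rewrite flip_off //; lia.
rewrite (@wsum_ext _ (flip w m) w m.+1 n); last by move=> l hl; rewrite flip_off //; lia.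
by rewrite sgN !rmorphN rmorphM rmorph_nat; ring.
Qed.

Lemma avg_wsumS a k (F : R[i] -> signs -> R) X w s :
  avg a k.+1 (fun w => F (s + wsum X w a (a + k.+1)%N) w) w =
  (avg a.+1 k (fun w => F (s + X a + wsum X w a.+1 (a.+1 + k)%N) w) (upd w a true) +
   avg a.+1 k (fun w => F (s - X a + wsum X w a.+1 (a.+1 + k)%N) w) (upd w a false)) / 2.
Proof.
rewrite /= /avg1; congr ((_ + _) / _); apply: avg_eq => w' hw';
  rewrite wsum_ltn ?addnS ?ltnS ?leq_addr // -(hw' a) ?ltnn // /upd eqxx /sg -?addSn.
  by rewrite mul1r addrA.
by rewrite rmorphN mulN1r addrA.
Qed.

Definition var X a k : R := \sum_(a <= n < (a + k)%N) sqn (X n).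

Lemma varS X a k : var X a k.+1 = sqn (X a) + var X a.+1 k.
Proof. by rewrite /var big_ltn ?addnS ?ltnS ?leq_addr // -addSn. Qed.

Lemma var_ge0 X a k : 0 <= var X a k.
Proof. by apply: sumr_ge0 => n _; apply: sqn_ge0. Qed.

Lemma avg_sqn X a k w s :
  avg a k (fun w => sqn (s + wsum X w a (a + k)%N)) w = sqn s + var X a k.
Proof.
elim: k a w s => [|k IH] a w s.
  by rewrite /= wsum_geq ?addn0 // /var big_geq ?addn0 // !addr0.
rewrite (@avg_wsumS _ _ (fun z _ => sqn z)) !IH varS !sqnD sqnN.
have -> : dotp s (- X a) = - dotp s (X a).
  by case: s (X a) => [? ?] [? ?]; rewrite /dotp /=; ring.
by field.
Qed.

(** The constant 3 is that of a real Gaussian; the polynomial in [sqn s] is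
    the one reproduced by averaging over one more sign. *)
Lemma avg_sqn2 X a k w s :
  avg a k (fun w => sqn (s + wsum X w a (a + k)%N) ^+ 2) w <=
  sqn s ^+ 2 + 6 * sqn s * var X a k + 3 * var X a k ^+ 2.
Proof.
elim: k a w s => [|k IH] a w s.
  by rewrite /= wsum_geq ?addn0 // /var big_geq ?addn0 // !addr0; lra.
rewrite (@avg_wsumS _ _ (fun z _ => sqn z ^+ 2)) varS.
have := IH a.+1 (upd w a true) (s + X a).
have := IH a.+1 (upd w a false) (s - X a).
move: (avg _ _ _ _) (avg _ _ _ _) => A B.
rewrite !sqnD sqnN.
have -> : dotp s (- X a) = - dotp s (X a).
  by case: s (X a) => [? ?] [? ?]; rewrite /dotp /=; ring.
have := dotp_sqr s (X a).
have := sqn_ge0 s; have := sqn_ge0 (X a); have := var_ge0 X a.+1 k.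
move: (sqn s) (sqn (X a)) (dotp s (X a)) (var X a.+1 k) => p q d v; nra.
Qed.

Definition exceeds X (L : R) a k s w : bool :=
  has (fun n => L <= sqn (s + wsum X w a (a + n)%N)) (iota 0 k.+1).

Lemma exceedsS X L a k s w : exceeds X L a k.+1 s w =
  (L <= sqn s) || exceeds X L a.+1 k (s + (sg (w a))%:C * X a) w.
Proof.
rewrite /exceeds -[iota 0 k.+2]/(0%N :: iota (1 + 0)%N k.+1) iotaDl.
rewrite -cat1s has_cat has_map {1}/has orbF.
rewrite wsum_geq ?addn0 // addr0; congr (_ || _).
apply: eq_has => n /=; rewrite add1n wsum_ltn ?addnS ?ltnS ?leq_addr //.
by rewrite addrA addSn.
Qed.

(** Doob's maximal inequality for the submartingale [sqn ^+ 2]. *)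
Lemma doob X L a k s w : 0 <= L ->
  L ^+ 2 * avg a k (fun w => (exceeds X L a k s w)%:R) w <=
  avg a k (fun w => sqn (s + wsum X w a (a + k)%N) ^+ 2) w.
Proof.
move=> L0; have sub a' k' s' w' : sqn s' ^+ 2 <=
    avg a' k' (fun w => sqn (s' + wsum X w a' (a' + k')%N) ^+ 2) w'.
  elim: k' a' s' w' => [|k' IH] a' s' w'; first by rewrite /= wsum_geq ?addn0 ?addr0.
  rewrite (@avg_wsumS _ _ (fun z _ => sqn z ^+ 2)).
  have := IH a'.+1 (s' + X a') (upd w' a' true).
  have := IH a'.+1 (s' - X a') (upd w' a' false).
  move: (avg _ _ _ _) (avg _ _ _ _) => A B.
  rewrite !sqnD sqnN.
  have -> : dotp s' (- X a') = - dotp s' (X a').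
    by case: s' (X a') => [? ?] [? ?]; rewrite /dotp /=; ring.
  have := sqn_ge0 s'; have := sqn_ge0 (X a').
  move: (sqn s') (sqn (X a')) (dotp s' (X a')) => p q d; nra.
elim: k a s w => [|k IH] a s w.
  rewrite /= /exceeds /= orbF wsum_geq ?addn0 // addr0.
  case: (boolP (L <= sqn s)) => [h|_]; rewrite ?mulr1 ?mulr0 ?sqr_ge0 //.
  by rewrite lerXn2r // nnegrE // sqn_ge0.
case: (leP L (sqn s)) => hL.
  apply: le_trans (sub _ _ _ _); rewrite (avg_cst_at (c := 1)).
    by rewrite mulr1 lerXn2r // nnegrE ?sqn_ge0.
  by move=> w' _; rewrite exceedsS hL.
have e b : avg a.+1 k (fun w => (exceeds X L a k.+1 s w)%:R) (upd w a b) =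
    avg a.+1 k (fun w => (exceeds X L a.+1 k (s + (sg b)%:C * X a) w)%:R)
      (upd w a b) :> R.
  apply: avg_eq => w' hw'; rewrite exceedsS leNgt hL /=.
  by rewrite -(hw' a) ?ltnn // /upd eqxx.
rewrite (@avg_wsumS _ _ (fun z _ => sqn z ^+ 2)) /= /avg1 !e mulrA.
rewrite ler_pM2r ?invr_gt0 // mulrDr; apply: lerD.
  by rewrite /sg rmorph1 mul1r; apply: IH.
by rewrite /sg rmorphN rmorph1 mulN1r; apply: IH.
Qed.

Lemma exceeds_prob X L a k w : 0 <= L ->
  L ^+ 2 * avg a k (fun w => (exceeds X L a k 0 w)%:R) w <= 3 * var X a k ^+ 2.
Proof.
move=> L0; apply: (le_trans (doob _ _ _ _ _ L0)).
by apply: (le_trans (avg_sqn2 _ _ _ _ _)); rewrite sqn0; lra.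
Qed.

Lemma exceedsPn X L a k w n : ~~ exceeds X L a k 0 w -> (a <= n <= a + k)%N ->
  sqn (wsum X w a n) < L.
Proof.
move=> /hasPn h hn; rewrite ltNge.
have := h (n - a)%N; rewrite mem_iota add0r subnKC; last lia.
by apply; lia.
Qed.
End RandomSums.

(** * Small ball estimates *)

Section SmallBall.
Context {R : realType}.
Local Open Scope complex_scope.
Implicit Types (s t x y z : R[i]) (w : signs) (X : nat -> R[i]).

(** By Doob's inequality a partial sum is large with probability at most
    [3 * var X a k ^+ 2 / L ^+ 2], hence at most one half. *)
Lemma small_ball_quiet X (L : R) a k w (f : signs -> R) :
  0 < L -> 6 * var X a k ^+ 2 <= L ^+ 2 ->
  (forall w', agree_off a k w w' -> 0 <= f w') ->
  (forall w', agree_off a k w w' -> ~~ exceeds X L a k 0 w' -> 1 <= f w') ->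
  1 / 2 <= avg a k f w.
Proof.
move=> L0 VL f0 f1; have := exceeds_prob X a k w (ltW L0).
set p := avg _ _ _ _ => hp.
have p2 : p <= 1 / 2.
  rewrite -(ler_pM2l (exprn_gt0 2 L0)); lra.
apply: (@le_trans _ _ (1 + (-1) * p)); first lra.
rewrite -{1}(avg_cst a k 1 w) -avgZ -avgD; apply: avg_le => w' hw'.
case: (boolP (exceeds _ _ _ _ _ _)) => h /=; first by rewrite mulr1 addrN f0.
by rewrite mulr0 addr0 f1.
Qed.

Lemma sqn_conj s : sqn (s^*)%C = sqn s.
Proof. by case: s => p q; rewrite /sqn /= sqrrN. Qed.

Lemma dotpN s t : dotp s (- t) = - dotp s t.
Proof. by case: s t => [? ?] [? ?]; rewrite /dotp /=; ring. Qed.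

Lemma Re_sum (I : Type) (r : seq I) (P : pred I) (F : I -> R[i]) :
  complex.Re (\sum_(i <- r | P i) F i) = \sum_(i <- r | P i) complex.Re (F i).
Proof. by rewrite (raddf_sum (@complex.Re R : Rcomplex R -> R)). Qed.

Lemma Im_sum (I : Type) (r : seq I) (P : pred I) (F : I -> R[i]) :
  complex.Im (\sum_(i <- r | P i) F i) = \sum_(i <- r | P i) complex.Im (F i).
Proof. by rewrite (raddf_sum (@complex.Im R : Rcomplex R -> R)). Qed.

(** Isotropy of the covariance: the off-diagonal part is governed by the sum of
    the squares [X n ^+ 2]. *)
Lemma dotp_var X a k s :
  sqn (\sum_(a <= n < (a + k)%N) X n ^+ 2) <= (var X a k / 4) ^+ 2 ->
  sqn s * var X a k / 4 <= \sum_(a <= n < (a + k)%N) dotp s (X n) ^+ 2.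
Proof.
move=> hG; set G := \sum_(a <= n < _) _ in hG.
have dE x : dotp s x ^+ 2 = sqn s * sqn x / 2 + complex.Re ((s^*)%C ^+ 2 * x ^+ 2) / 2.
  by case: s x => [p q] [u v]; rewrite !expr2 /dotp /sqn /=; field.
rewrite (eq_bigr _ (fun n _ => dE (X n))) big_split /= -!mulr_suml -mulr_sumr.
rewrite -/(var X a k) -Re_sum -mulr_sumr -/G.
set c := (s^*)%C ^+ 2 * G.
have hc : complex.Re c ^+ 2 <= (sqn s * var X a k / 4) ^+ 2.
  apply: (@le_trans _ _ (sqn c)); first by rewrite /sqn lerDl sqr_ge0.
  rewrite /c sqnM sqnX sqn_conj.
  by rewrite -mulrA exprMn ler_wpM2l // sqr_ge0.
have h0 : 0 <= sqn s * var X a k / 4.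
  by rewrite divr_ge0 // mulr_ge0 ?sqn_ge0 ?var_ge0.
move: hc h0; move: (complex.Re c) (sqn s * var X a k) => r p hc h0.
have : - (p / 4) <= r.
  by rewrite lerNl; have := ler_norm (- r); rewrite normrN; move: hc;
    rewrite -[r ^+ 2]real_normK ?num_real // ler_sqr ?nnegrE //; lra.
lra.
Qed.

Lemma wsum_dotp X w a n s :
  wsum (fun m => (dotp s (X m))%:C) w a n = (dotp s (wsum X w a n))%:C.
Proof.
rewrite /wsum /dotp Re_sum Im_sum !mulr_sumr -big_split rmorph_sum /=.
apply: eq_bigr => m _; case: (X m) => p q /=; rewrite -rmorphM; congr (_%:C).
by ring.
Qed.

(** A second and fourth moment argument: the polynomial
    [(Z ^+ 2 - v / 4) * (8 * v - Z ^+ 2)], where [Z = dotp s T] and [v] is its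
    variance, is at most [(31 / 8 * v) ^+ 2] and positive only if
    [v / 4 < Z ^+ 2], while its mean is at least [13 / 4 * v ^+ 2]. *)
Lemma dotp_large X a k w s (v := \sum_(a <= n < (a + k)%N) dotp s (X n) ^+ 2) :
  0 < v ->
  1 / 5 <= avg a k
    (fun w => (v / 4 <= dotp s (wsum X w a (a + k)%N) ^+ 2)%R%:R : R) w.
Proof.
move=> v0; pose Y := fun m => (dotp s (X m))%:C.
have vY : var Y a k = v by apply: eq_bigr => m _; rewrite sqnC.
have m2 := avg_sqn Y a k w 0; have m4 := avg_sqn2 Y a k w 0.
rewrite sqn0 vY in m2 m4.
set p := avg _ _ _ _.
have : (33 / 4 * v) * avg a k (fun w => sqn (0 + wsum Y w a (a + k)%N)) w
    + (-1) * avg a k (fun w => sqn (0 + wsum Y w a (a + k)%N) ^+ 2) w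
    <= 2 * v ^+ 2 + (31 / 8 * v) ^+ 2 * p.
  rewrite -{1}(avg_cst a k (2 * v ^+ 2) w) -!avgZ -!avgD; apply: avg_le => w' _.
  rewrite add0r wsum_dotp sqnC.
  move: (dotp s _ ^+ 2) => z; case: (leP (v / 4) z) => /= hz; last by nra.
  have := sqr_ge0 (z - 33 / 8 * v); nra.
rewrite m2 => h; have {}h : 13 / 4 * v ^+ 2 <= 16 * v ^+ 2 * p; nra.
Qed.

(** From a point [s] far from the origin compared with the standard deviation,
    an isotropic sum of random signs is likely enough to lead to a point that is
    no further away; otherwise it does not lead far.  The radius
    [136 = 128 + 8] bounds the end point when [s] is within [128] standard
    deviations. *)
Lemma small_ball X a k w s (f : signs -> R) (V := var X a k) :
  0 < V ->
  sqn (\sum_(a <= n < (a + k)%N) X n ^+ 2) <= (V / 4) ^+ 2 ->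
  (forall w', agree_off a k w w' -> 0 <= f w') ->
  (forall w', agree_off a k w w' -> ~~ exceeds X (64 * V) a k 0 w' ->
     sqn (s + wsum X w' a (a + k)%N) <= Num.max (sqn s) (136 ^+ 2 * V) ->
     1 <= f w') ->
  1 / 11 <= avg a k f w.
Proof.
move=> V0 hG f0 f1.
have V64 : 0 <= 64 * V by lra.
have := exceeds_prob X a k w V64; set pe := avg _ _ _ _; rewrite -/V => hpe.
have pe1 : pe <= 1 / 1000 by nra.
have nE w' : ~~ exceeds X (64 * V) a k 0 w' ->
    sqn (wsum X w' a (a + k)%N) < 64 * V.
  by move/exceedsPn; apply; rewrite leqnn leq_addr.
case: (ltP (sqn s) (128 ^+ 2 * V)) => hs.
  apply: (@le_trans _ _ (1 + (-1) * pe)); first lra.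
  rewrite -{1}(avg_cst a k 1 w) -avgZ -avgD; apply: avg_le => w' hw'.
  case: (boolP (exceeds _ _ _ _ _ _)) => h /=; first by rewrite mulr1 addrN f0.
  rewrite mulr0 addr0 f1 // le_max; apply/orP; right.
  have := nE _ h; have := dotp_sqr s (wsum X w' a (a + k)%N); rewrite sqnD.
  have := sqn_ge0 s; have := sqn_ge0 (wsum X w' a (a + k)%N).
  move: (sqn s) (sqn (wsum _ _ _ _)) (dotp _ _) hs => p q d hs q0 p0 hd hq.
  have : d <= 1024 * V.
    by rewrite leNgt; apply/negP => hlt; nra.
  nra.
have := dotp_var s hG; set v := \sum_(_ <= _ < _) _; rewrite -/V => hv.
have v0 : 0 < v by apply: lt_le_trans hv; nra.
have := dotp_large (X := X) (s := s) (a := a) (k := k) w v0; rewrite -/v.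
set pz := avg _ _ _ _ => hz.
pose half (b : bool) w' : R := ((v / 4 <= dotp s (wsum X w' a (a + k)%N) ^+ 2) &&
  ~~ exceeds X (64 * V) a k 0 w' &&
  (0 <= (-1) ^+ b * dotp s (wsum X w' a (a + k)%N)))%R%:R.
have sym : avg a k (half true) w = avg a k (half false) w.
  rewrite -(avg_negate a k (half true)); apply: avg_eq => w' _; rewrite /half.
  have -> : exceeds X (64 * V) a k 0 (negate a k w') = exceeds X (64 * V) a k 0 w'.
    apply: eq_in_has => n; rewrite mem_iota => hn.
    have nk : (a + n <= a + k)%N by rewrite leq_add2l -ltnS; case/andP: hn.
    by rewrite (add0r (wsum _ _ _ _)) (add0r (wsum _ _ _ _)) wsum_negate // sqnN.
  by rewrite wsum_negate // dotpN sqrrN /= expr1 expr0 mulN1r opprK mul1r.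
have : pz <= avg a k (half true) w + avg a k (half false) w + pe.
  rewrite -!avgD; apply: avg_le => w' _; rewrite /half.
  case: (boolP (exceeds _ _ _ _ _ _)) => h; case: (v / 4 <= _); rewrite /= ?addr0 ?add0r //.
  rewrite expr1 expr0 mulN1r mul1r oppr_ge0.
  case: (leP (dotp s (wsum X w' a (a + k)%N)) 0) => hd; first by rewrite lerDl ler0n.
  by rewrite (ltW hd) lerDr.
rewrite -sym => hp.
apply: (@le_trans _ _ (avg a k (half true) w)); first by lra.
apply: avg_le => w' hw'; rewrite /half.
case: (boolP (exceeds _ _ _ _ _ _)) => h; rewrite ?andbF /=; first exact: f0.
case: (boolP (v / 4 <= _)) => h1 /=; last exact: f0.
case: (boolP (0 <= _)) => h2 /=; last exact: f0.
apply: f1 => //; rewrite le_max; apply/orP; left.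
rewrite sqnD; have hq := nE _ h.
move: h1 h2 hq; rewrite expr1 mulN1r oppr_ge0.
move: (dotp _ _) (sqn (wsum _ _ _ _)) => d q h1 h2 hq.
have hd : (32 * V) ^+ 2 <= d ^+ 2.
  by apply: le_trans h1; apply: (@le_trans _ _ (sqn s * V / 16)); [nra|lra].
have : d <= - (32 * V) by nra.
lra.
Qed.
End SmallBall.

(** * The circle and its finite Fourier transform *)

Section Fourier.
Context {R : realType}.
Local Open Scope complex_scope.

Definition expi (x : R) : R[i] := cos x +i* sin x.

Lemma expiD x y : expi (x + y) = expi x * expi y.
Proof. by rewrite /expi cosD sinD; simpc; congr (_ +i* _); ring. Qed.

Lemma expi0 : expi 0 = 1.
Proof. by rewrite /expi cos0 sin0. Qed.

Lemma expiX x n : expi x ^+ n = expi (n%:R * x).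
Proof.
elim: n => [|n IH]; first by rewrite mul0r expi0.
by rewrite exprS IH -expiD -natr1; congr expi; ring.
Qed.

Lemma expiN x : expi (- x) = (expi x)^*%C.
Proof. by rewrite /expi cosN sinN. Qed.

Lemma sqn_expi x : sqn (expi x) = 1.
Proof. exact: cos2Dsin2. Qed.

Lemma sqn_chord x y : sqn (expi x - expi y) = (2 * sin ((x - y) / 2)) ^+ 2.
Proof.
have -> : sqn (expi x - expi y) = 2 - 2 * cos (x - y).
  rewrite cosB /sqn /=; have := cos2Dsin2 x; have := cos2Dsin2 y.
  move: (cos x) (sin x) (cos y) (sin y) => a b c d h1 h2.
  lra.
have {1}-> : x - y = ((x - y) / 2) *+ 2 by rewrite -mulr_natr; field.
rewrite cos_mulr2n exprMn sin2cos2. ring.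
Qed.

Definition circ (th : R) : R[i] := expi (2 * pi * th).

Definition grid (M q : nat) : R[i] := circ (q%:R / M%:R).

Lemma sqn_gridX M q n : sqn (grid M q ^+ n) = 1.
Proof. by rewrite sqnX sqn_expi expr1n. Qed.

Lemma sqnCE (z : R[i]) : (sqn z)%:C = z * z^*%C.
Proof.
by case: z => a b; rewrite /sqn /=; simpc; congr (_ +i* _); ring.
Qed.

Lemma grid_orthogonal M k l : (k < M)%N -> (l < M)%N -> k != l ->
  \sum_(0 <= q < M) grid M q ^+ k * (grid M q ^+ l)^*%C = 0.
Proof.
move=> kM lM kl.
have M0 : (M%:R : R) != 0 by rewrite pnatr_eq0; lia.
pose u : R := 2 * pi * ((k%:R - l%:R) / M%:R).
have gE q : grid M q ^+ k * (grid M q ^+ l)^*%C = expi u ^+ q.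
  rewrite /grid /circ !expiX -expiN -expiD /u; congr expi; by field.
rewrite (eq_bigr _ (fun q _ => gE q)).
have u1 : expi u ^+ M = 1.
  rewrite expiX /u.
  have nE (n : nat) : expi (2 * pi * n%:R) = 1.
    rewrite /expi -[X in cos X]add0r -[X in sin X]add0r.
    have -> : 2 * pi * n%:R = (pi *+ 2) *+ n :> R by rewrite -[RHS]mulr_natr; ring.
    rewrite (periodicn (@cosD2pi R)) (periodicn (@sinD2pi R)).
    by rewrite cos0 sin0.
  have [lk|kl'] := leqP l k.
    have -> : M%:R * (2 * pi * ((k%:R - l%:R) / M%:R)) = 2 * pi * (k - l)%:R :> R.
      by rewrite natrB //; field.
    exact: nE.
  have -> : M%:R * (2 * pi * ((k%:R - l%:R) / M%:R)) = - (2 * pi * (l - k)%:R) :> R.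
    by rewrite natrB ?(ltnW kl') //; field.
  by rewrite expiN nE; simpc.
have un1 : expi u != 1.
  apply/eqP => eu.
  have := sqn_chord u 0; rewrite eu expi0 subrr sqn0 => /esym/eqP.
  rewrite sqrf_eq0 mulf_eq0 pnatr_eq0 /= => /eqP.
  rewrite subr0 /u => hs.
  pose rr : R := `|k%:R - l%:R| / M%:R.
  pose v : R := pi * rr.
  have : sin v = 0.
    rewrite /v /rr; case: (ltP (k%:R - l%:R : R) 0) => h.
      rewrite (ltr0_norm h).
      by rewrite -[X in sin X]opprK sinN -[RHS]oppr0 -hs; congr (- sin _); field.
    by rewrite (ger0_norm h) -hs; congr sin; field.
  have v01 : (0 < rr) && (rr < 1).
    have M0' : 0 < M%:R :> R by rewrite ltr0n; lia.
    have k0 := ler0n R k; have l0 := ler0n R l.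
    have := ltr_nat R k M; have := ltr_nat R l M; rewrite kM lM => h1 h2.
    rewrite /rr; apply/andP; split; first by rewrite divr_gt0 ?normr_gt0 ?subr_eq0 ?eqr_nat.
    by rewrite ltr_pdivrMr // mul1r ltr_norml; apply/andP; split; lra.
  apply/eqP; rewrite gt_eqF // sin_gt0_pi //.
  have := pi_gt0 R; move: v01 => /andP[h1 h2] h3.
  by rewrite mulr_gt0 //= -[ltRHS]mulr1 ltr_pM2l.
rewrite big_mkord; have := subrX1 (expi u) M; rewrite u1 subrr => /esym/eqP.
by rewrite mulf_eq0 subr_eq0 (negbTE un1) /= => /eqP.
Qed.

Lemma parseval M L (d : nat -> nat) (y : nat -> R[i]) :
  (forall n, (n < L)%N -> (d n < M)%N) ->
  (forall n m, (n < L)%N -> (m < L)%N -> d n = d m -> n = m) ->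
  \sum_(0 <= q < M) sqn (\sum_(0 <= n < L) y n * grid M q ^+ d n) =
  M%:R * \sum_(0 <= n < L) sqn (y n).
Proof.
move=> dM dI; apply: (@complexI R).
rewrite rmorph_sum /= rmorphM rmorph_nat rmorph_sum /=.
under eq_bigr => q _ do rewrite sqnCE rmorph_sum mulr_suml /=.
rewrite exchange_big mulr_sumr /=; apply: eq_big_nat => n /andP[_ nL].
under eq_bigr => q _ do rewrite mulr_sumr.
rewrite exchange_big /= (bigD1_seq n) ?iota_uniq ?mem_index_iota //=.
rewrite [X in _ + X]big1_seq; last first.
  move=> m /andP[mn]; rewrite mem_index_iota => /andP[_ mL].
  transitivity (y n * (y m)^*%C *
      \sum_(0 <= q < M) grid M q ^+ d n * (grid M q ^+ d m)^*%C).
    by rewrite mulr_sumr; apply: eq_bigr => q _; rewrite rmorphM /=; ring.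
  rewrite grid_orthogonal ?mulr0 ?dM //.
  by apply: contra mn => /eqP /dI ->.
rewrite addr0 sqnCE.
transitivity (\sum_(0 <= q < M) y n * (y n)^*%C).
  apply: eq_bigr => q _; rewrite rmorphM /= mulrACA.
  by rewrite -[X in _ * X]sqnCE sqn_gridX mulr1.
by rewrite sumr_const_nat subn0 mulr_natl.
Qed.

(** Parseval's identity with points and frequencies exchanged: consecutive
    frequencies are distinct modulo [M]. *)
Lemma bessel M a L (b : nat -> R[i]) : (L <= M)%N ->
  \sum_(a <= n < (a + L)%N) sqn (\sum_(0 <= q < M) b q * grid M q ^+ n) <=
  M%:R * \sum_(0 <= q < M) sqn (b q).
Proof.
move=> LM.
have := @parseval M M id (fun q => b q * grid M q ^+ a) (fun _ => id) (fun _ _ _ _ => id).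
have -> : \sum_(0 <= q < M) sqn (b q * grid M q ^+ a) =
    \sum_(0 <= q < M) sqn (b q).
  by apply: eq_bigr => q _; rewrite sqnM sqn_gridX mulr1.
move=> <-; rewrite [X in _ <= X](big_cat_nat (n := L)) //=.
rewrite -[leLHS]addr0 lerD //; last by apply: sumr_ge0 => *; exact: sqn_ge0.
rewrite le_eqVlt; apply/orP; left; apply/eqP.
rewrite -{1}[a]add0n big_addn addnC addnK; apply: eq_bigr => r _; congr sqn.
apply: eq_bigr => q _; rewrite -mulrA; congr (_ * _).
have -> : grid M r ^+ q = grid M q ^+ r.
  by rewrite /grid /circ !expiX; congr expi; ring.
by rewrite -exprD addnC.
Qed.

(** By orthogonality, few points of the grid see a large value of the
    off-diagonal covariance. *)
Lemma sum_grid_sqr M a k (y : nat -> R[i]) : (2 * (a + k) <= M)%N ->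
  \sum_(0 <= q < M) sqn (\sum_(a <= n < (a + k)%N) (y n * grid M q ^+ n) ^+ 2) =
  M%:R * \sum_(a <= n < (a + k)%N) sqn (y n) ^+ 2.
Proof.
move=> kM; pose y' n := if (a <= n)%N then y n ^+ 2 else 0.
have sumE (F : nat -> R[i] -> R[i]) : (forall n, F n 0 = 0) ->
    \sum_(0 <= n < (a + k)%N) F n (y' n) = \sum_(a <= n < (a + k)%N) F n (y n ^+ 2).
  move=> F0; rewrite (big_cat_nat (n := a)) ?leq_addr //= big1_seq ?add0r.
    by apply: eq_big_nat => n /andP[h _]; rewrite /y' h.
  by move=> n /andP[_]; rewrite mem_index_iota => /andP[_ h]; rewrite /y' leqNgt h.
have d1 n : (n < a + k)%N -> (2 * n < M)%N by lia.
have d2 n m : (n < a + k)%N -> (m < a + k)%N -> (2 * n = 2 * m)%N -> n = m by lia.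
have := parseval y' d1 d2.
have -> : \sum_(0 <= n < (a + k)%N) sqn (y' n) = \sum_(a <= n < (a + k)%N) sqn (y n) ^+ 2.
  apply: (@complexI R); rewrite !rmorph_sum /= (sumE (fun _ z => (sqn z)%:C)).
    by apply: eq_bigr => n _; rewrite sqnX.
  by move=> _; rewrite sqn0.
move=> <-; apply: eq_bigr => q _.
rewrite (sumE (fun n z => z * grid M q ^+ (2 * n))) => [|n]; last by rewrite mul0r.
by congr sqn; apply: eq_bigr => n _; rewrite exprMn mulnC exprM.
Qed.
End Fourier.

(** * Smooth cutoffs and the variance of weighted sums over the grid *)

Section Smooth.
Context {R : realType}.
Local Open Scope complex_scope.
Implicit Types (s t h z : R[i]) (w : signs).

Local Notation nm := (@ComplexField.Normc.normc R).

Lemma nm_ge0 z : 0 <= nm z.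
Proof. by case: z => a b; apply: sqrtr_ge0. Qed.

Lemma nmE z : nm z = Num.sqrt (sqn z).
Proof. by case: z. Qed.

Lemma nmD s t : nm (s + t) <= nm s + nm t.
Proof. exact: (le_normcD (s : Rcomplex R) t). Qed.

Lemma nmN s : nm (- s) = nm s.
Proof. by rewrite !nmE sqnN. Qed.

Lemma nm0 : nm 0 = 0.
Proof. by rewrite nmE sqn0 sqrtr0. Qed.

Lemma nmZ (r : R) z : nm (r%:C * z) = `|r| * nm z.
Proof. by rewrite !nmE sqnM sqnC sqrtrM ?sqr_ge0 // sqrtr_sqr. Qed.

Lemma dotp_nm s t : `|dotp s t| <= nm s * nm t.
Proof.
rewrite -sqrtr_sqr !nmE -sqrtrM ?sqn_ge0 // ler_sqrt ?dotp_sqr //.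
by rewrite mulr_ge0 ?sqn_ge0.
Qed.

Lemma nm_sqn z : sqn z = nm z ^+ 2.
Proof. by rewrite normcE2. Qed.

Lemma nm_le z (r : R) : 0 <= r -> sqn z <= r ^+ 2 -> nm z <= r.
Proof.
by move=> r0 h; rewrite -(ler_pXn2r (n := 2)) ?nnegrE ?nm_ge0 // normcE2.
Qed.

(** One constant bounds the slope of [F] and, squared, its deviation from its
    linearization, so that it is additive for products: see [smoothM]. *)
Definition C11 (l : R) (F : R[i] -> R) :=
  (forall t, 0 <= F t <= 1) /\
  forall t, exists2 g, nm g <= l & forall h, nm h <= 1 ->
    `|F (t + h) - F t| <= l * nm h /\
    `|F (t + h) - F t - dotp g h| <= l ^+ 2 * sqn h.

Definition pos2 (y : R) : R := Num.max y 0 ^+ 2.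

Let pos2_scalar (y y' p r k d : R) : 0 <= p -> 0 <= r -> 0 <= k <= 1 ->
  `|d| <= p * k -> `|d + k ^+ 2| <= r * k -> y <= 1 ->
  (0 <= y -> p <= 1) -> (0 <= y' -> r <= 1) -> y' = y - 2 * d - k ^+ 2 ->
  `|pos2 y' - pos2 y + 4 * Num.max y 0 * d| <= 11 * k ^+ 2.
Proof.
move=> p0 r0 /andP[k0 k1]; rewrite !ler_norml => /andP[a1 a2] /andP[b1 b2] y1 hp hr e.
rewrite /pos2; case: (leP y 0) => hy; case: (leP y' 0) => hy'.
- by rewrite expr0n /=; apply/andP; split; nra.
- have {}hr := hr (ltW hy').
  have hy3 : y' <= 3 * k by nra.
  by rewrite expr0n /= mulr0 mul0r; apply/andP; split; nra.
- have {}hp := hp (ltW hy).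
  have d3 : - (y' - y) <= 3 * k by rewrite e; nra.
  have dE : 4 * y * d = - (2 * y * (y' - y)) - 2 * y * k ^+ 2 by rewrite e; ring.
  have yk : 0 <= y * k ^+ 2 <= k ^+ 2.
    by apply/andP; split; have := sqr_ge0 k; nra.
  move: yk => /andP[yk1 yk2].
  by rewrite expr0n /= dE; apply/andP; split; nra.
- have {}hp := hp (ltW hy).
  have d3 : `|y' - y| <= 3 * k by rewrite e ler_norml; apply/andP; split; nra.
  have dE : y' ^+ 2 - y ^+ 2 + 4 * y * d = (y' - y) ^+ 2 - 2 * (y * k ^+ 2) by rewrite e; ring.
  have yk : 0 <= y * k ^+ 2 <= k ^+ 2.
    by apply/andP; split; have := sqr_ge0 k; nra.
  move: yk d3; rewrite ler_norml => /andP[yk1 yk2] /andP[d3 d4].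
  by rewrite dE; apply/andP; split; nra.
Qed.

Lemma dotpZl (r : R) s t : dotp (r%:C * s) t = r * dotp s t.
Proof. by case: s t => [? ?] [? ?]; rewrite /dotp /=; ring. Qed.

Lemma dotpDl s t z : dotp (s + t) z = dotp s z + dotp t z.
Proof. by case: s t z => [? ?] [? ?] [? ?]; rewrite /dotp /=; ring. Qed.

Lemma dotpss s : dotp s s = sqn s.
Proof. by rewrite /dotp /sqn !expr2. Qed.

(** Where [pos2 (c - sqn t)] does not vanish, [nm t <= 1]: this is why the bounds
    do not depend on [t]. *)
Lemma pos2_C11 (c : R) t : c <= 1 ->
  exists2 g, nm g <= 4 & forall h, nm h <= 1 ->
    `|pos2 (c - sqn (t + h)) - pos2 (c - sqn t)| <= 15 * nm h /\
    `|pos2 (c - sqn (t + h)) - pos2 (c - sqn t) - dotp g h| <= 11 * sqn h.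
Proof.
move=> c1; set yp := Num.max (c - sqn t) 0.
have yp0 : 0 <= yp by rewrite le_max lexx orbT.
have t0 := sqn_ge0 t; have nt0 := nm_ge0 t.
have yp1 : yp <= 1 by rewrite ge_max ler01 andbT; lra.
have small z : 0 <= c - sqn z -> nm z <= 1.
  by move=> hz; apply: nm_le => //; rewrite expr1n; lra.
have ypt : yp * nm t <= 1.
  rewrite /yp; case: (leP (c - sqn t) 0) => hy; first by rewrite mul0r.
  have := small t (ltW hy); have : c - sqn t <= 1 by lra.
  by move: (c - sqn t) hy (nm t) nt0 => y hy p; nra.
have hg : nm ((- (4 * yp))%:C * t) <= 4.
  rewrite nmZ normrN ger0_norm; [by rewrite -mulrA; lra|by lra].
exists ((- (4 * yp))%:C * t) => // h h1.
have h0 := nm_ge0 h.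
have main : `|pos2 (c - sqn (t + h)) - pos2 (c - sqn t) - dotp ((- (4 * yp))%:C * t) h|
    <= 11 * sqn h.
  rewrite dotpZl mulNr opprK (nm_sqn h).
  apply: (pos2_scalar (p := nm t) (r := nm (t + h))) => //.
  - exact: nm_ge0.
  - by rewrite h0.
  - exact: dotp_nm.
  - by rewrite -nm_sqn -dotpss -dotpDl; apply: dotp_nm.
  - lra.
  - exact: small.
  - exact: small.
  - by rewrite sqnD (nm_sqn h); ring.
split=> //.
have hd := dotp_nm ((- (4 * yp))%:C * t) h.
move: main hd; rewrite (nm_sqn h); set D := _ - pos2 _; set e := dotp _ _.
have : nm ((- (4 * yp))%:C * t) * nm h <= 4 * nm h by rewrite ler_wpM2r.
have : nm h ^+ 2 <= nm h by rewrite expr2 -[leRHS]mulr1 ler_wpM2l.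
rewrite !ler_norml => h2 h3 /andP[a1 a2] h4.
have := ler_norm e; have := ler_norm (- e); rewrite normrN => b1 b2.
by apply/andP; split; lra.
Qed.

(** A second difference of [pos2], normalized to decrease from 1 to 0 as [sqn t]
    increases from [B] to [A], with a Lipschitz gradient. *)
Definition cutoff (A B : R) (t : R[i]) : R :=
  2 / (A - B) ^+ 2 *
  (pos2 (A - sqn t) - 2 * pos2 ((A + B) / 2 - sqn t) + pos2 (B - sqn t)).

Let cutoff_cases (A B t : R) : B < A ->
  [/\ 0 <= pos2 (A - t) - 2 * pos2 ((A + B) / 2 - t) + pos2 (B - t)
    <= (A - B) ^+ 2 / 2,
    t <= B -> pos2 (A - t) - 2 * pos2 ((A + B) / 2 - t) + pos2 (B - t) = (A - B) ^+ 2 / 2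
  & A <= t -> pos2 (A - t) - 2 * pos2 ((A + B) / 2 - t) + pos2 (B - t) = 0].
Proof.
move=> BA; rewrite /pos2.
case: (leP (A - t) 0) => h1; case: (leP ((A + B) / 2 - t) 0) => h2;
  case: (leP (B - t) 0) => h3; rewrite ?expr0n /=; try lra.
- by split=> [|?|?]; rewrite ?mulr0 ?subr0 ?addr0 //; [apply/andP; split; nra|nra].
- by split=> [|?|?]; [apply/andP; split; nra|nra|nra].
- by split=> [|?|?]; [apply/andP; split; nra|nra|nra].
- by split=> [|?|?]; [apply/andP; split; nra|nra|nra].
Qed.

Lemma cutoff_eq1 A B t : B < A -> sqn t <= B -> cutoff A B t = 1.
Proof.
move=> BA h; have [_ e _] := cutoff_cases (sqn t) BA; rewrite /cutoff e //.
have : A - B != 0 by rewrite subr_eq0 gt_eqF.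
by move=> ?; field.
Qed.

Lemma cutoff_eq0 A B t : B < A -> A <= sqn t -> cutoff A B t = 0.
Proof.
by move=> BA h; have [_ _ e] := cutoff_cases (sqn t) BA; rewrite /cutoff e // mulr0.
Qed.

Lemma cutoff_01 A B t : B < A -> 0 <= cutoff A B t <= 1.
Proof.
move=> BA; have [/andP[e1 e2] _ _] := cutoff_cases (sqn t) BA; rewrite /cutoff.
have h : 0 < (A - B) ^+ 2 by rewrite exprn_gt0 // subr_gt0.
rewrite mulr_ge0 //=; last by rewrite divr_ge0 // ltW.
by rewrite mulrAC ler_pdivrMr //; lra.
Qed.

(** The constant 120 is [2 * (1 + 2 + 1) * 15]: three copies of [pos2_C11] with
    the weights of the second difference. *)
Lemma cutoff_C11 A B l : 0 <= B -> B < A -> A <= 1 ->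
  120 / (A - B) ^+ 2 <= l -> C11 l (cutoff A B).
Proof.
move=> B0 BA A1 hl; split=> [t|t]; first exact: cutoff_01.
have AB0 : 0 < A - B by rewrite subr_gt0.
have AB1 : A - B <= 1 by lra.
have h2 : 0 < (A - B) ^+ 2 by rewrite exprn_gt0.
set C := 2 / (A - B) ^+ 2.
have C2 : 2 <= C by rewrite /C ler_pdivlMr // ler_piMr // expr_le1 // ltW.
have hlC : 60 * C <= l by rewrite /C; move: hl; lra.
have [g1 hg1 H1] := pos2_C11 (c := A) t A1.
have [|g2 hg2 H2] := pos2_C11 (c := (A + B) / 2) t; first lra.
have [|g3 hg3 H3] := pos2_C11 (c := B) t; first lra.
exists (C%:C * (g1 + (- 2)%:C * g2 + g3)).
  rewrite nmZ ger0_norm; last lra.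
  have := nmD (g1 + (- 2)%:C * g2) g3; have := nmD g1 ((- 2)%:C * g2).
  rewrite nmZ normrN ger0_norm //.
  move: (nm (_ + _)) (nm (_ + _)) (nm g1) (nm g2) (nm g3) hg1 hg2 hg3 => *; nra.
move=> h nh; have [{H1}a1 b1] := H1 h nh; have [{H2}a2 b2] := H2 h nh.
have [{H3}a3 b3] := H3 h nh.
rewrite dotpZl !dotpDl dotpZl /cutoff -/C.
have h0 := nm_ge0 h; have q0 := sqn_ge0 h.
move: a1 a2 a3 b1 b2 b3.
move: (pos2 (A - sqn (t + h))) (pos2 (A - sqn t)) (pos2 ((A + B) / 2 - sqn (t + h)))
  (pos2 ((A + B) / 2 - sqn t)) (pos2 (B - sqn (t + h))) (pos2 (B - sqn t)).
move=> u1 v1 u2 v2 u3 v3; rewrite !ler_norml.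
move=> /andP[a1 a1'] /andP[a2 a2'] /andP[a3 a3'] /andP[b1 b1'] /andP[b2 b2'] /andP[b3 b3'].
have l1 : 1 <= l by lra.
have lq : 60 * C * sqn h <= l ^+ 2 * sqn h.
  by rewrite ler_wpM2r // (le_trans hlC) // expr2 ler_peMl //; lra.
have ln : 60 * C * nm h <= l * nm h by rewrite ler_wpM2r.
have mid (x y : R) : - y <= x <= y -> - (C * y) <= C * x <= C * y.
  by move=> /andP[? ?]; apply/andP; split; rewrite -?mulrN ler_wpM2l //; lra.
split.
- have /mid : - (60 * nm h) <= (u1 - v1) - 2 * (u2 - v2) + (u3 - v3) <= 60 * nm h.
    by apply/andP; split; lra.
  by move=> /andP[? ?]; apply/andP; split; lra.
- have /mid : - (60 * sqn h) <= (u1 - v1 - dotp g1 h) - 2 * (u2 - v2 - dotp g2 h) +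
     (u3 - v3 - dotp g3 h) <= 60 * sqn h.
    by apply/andP; split; lra.
  by move=> /andP[? ?]; apply/andP; split; lra.
Qed.

End Smooth.

Section Variance.
Context {R : realType}.
Local Open Scope complex_scope.
Implicit Types (s t h z : R[i]) (w : signs) (x : nat -> R[i]) (pc : nat -> nat).

Local Notation nm := (@ComplexField.Normc.normc R).

(** [F] is a function of signs that responds to the flip of the sign of [x n]
    as a [C11] function responds to a change of its argument; the gradient
    depends on [n] only through the piece [pc n] that contains it. *)
Definition smooth (l : R) x a k pc (F : signs -> R) :=
  (forall w, 0 <= F w <= 1) /\
  forall w, exists2 g : nat -> R[i], (forall j, nm (g j) <= l) &
    forall n, (a <= n < a + k)%N -> let h := (- (2 * sg (w n)))%:C * x n in
    `|F (flip w n) - F w| <= l * nm h /\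
    `|F (flip w n) - F w - dotp (g (pc n)) h| <= l ^+ 2 * sqn h.

(** A flip of the sign of [x n] moves the argument if [n < e] and does not
    otherwise; if [e] is the end of a piece, the piece of [n] tells which. *)
Lemma smooth_C11 l x a k pc e (c : nat -> bool) (s : signs -> R[i]) Phi : 0 <= l ->
  C11 l Phi ->
  (forall n, (a <= n < a + k)%N -> 4 * sqn (x n) <= 1) ->
  (forall n, (a <= n < a + k)%N -> (n < e)%N = c (pc n)) ->
  (forall w n, (a <= n < a + k)%N -> s (flip w n) = s w) ->
  smooth l x a k pc (fun w => Phi (s w + wsum x w a e)).
Proof.
move=> l0 [P01 Pd] x1 ec sf; split=> [w|w]; first exact: P01.
have [g gl hg] := Pd (s w + wsum x w a e).
exists (fun j => if c j then g else 0) => [j|n nak h].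
  by case: ifP => // _; rewrite nm0.
have nh : nm h <= 1.
  apply: nm_le => //; rewrite /h sqnM sqnC sqrrN exprMn sg_sqr expr1n.
  by have := x1 _ nak; lra.
rewrite sf // wsum_flip -ec //; have -> /= : (a <= n)%N by lia.
case: ifP => ne; first by rewrite addrA; apply: hg.
rewrite addr0 subrr add0r normrN.
have -> : dotp 0 h = 0 by rewrite /dotp /= !mul0r addr0.
by rewrite !normr0 mulr_ge0 ?nm_ge0 // mulr_ge0 ?sqn_ge0 // sqr_ge0.
Qed.

Lemma smoothM l1 l2 x a k pc F G : 0 <= l1 -> 0 <= l2 ->
  smooth l1 x a k pc F -> smooth l2 x a k pc G ->
  smooth (l1 + l2) x a k pc (fun w => F w * G w).
Proof.
move=> l10 l20 [F01 hF] [G01 hG]; split=> w.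
  by have /andP[? ?] := F01 w; have /andP[? ?] := G01 w; apply/andP; split; nra.
have [g1 gl1 h1] := hF w; have [g2 gl2 h2] := hG w.
have /andP[fa fb] := F01 w; have /andP[ga gb] := G01 w.
exists (fun j => (G w)%:C * g1 j + (F w)%:C * g2 j) => [j|n nak h].
  apply: (le_trans (nmD _ _)); rewrite !nmZ !ger0_norm //.
  by apply: lerD; [apply: le_trans (gl1 j)|apply: le_trans (gl2 j)];
    rewrite ler_piMl ?nm_ge0.
have [a1 b1] := h1 n nak; have [a2 b2] := h2 n nak.
move: a1 a2 b1 b2; rewrite /= -/h dotpDl !dotpZl (nm_sqn h).
have /andP[fa' fb'] := F01 (flip w n); have /andP[ga' gb'] := G01 (flip w n).
have := nm_ge0 h.
move: (nm h) (dotp (g1 _) h) (dotp (g2 _) h) (F w) (G w) (F (flip w n)) (G (flip w n)) fa fb ga gb fa' fb' ga' gb'.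
move=> r d1 d2 f g f' g' fa fb ga gb fa' fb' ga' gb' r0 a1 a2 b1 b2.
split.
  have -> : f' * g' - f * g = g' * (f' - f) + f * (g' - g) by ring.
  apply: (le_trans (ler_normD _ _)); rewrite !normrM (ger0_norm ga') (ger0_norm fa) mulrDl.
  by apply: lerD; [apply: le_trans a1|apply: le_trans a2]; rewrite ler_piMl.
have -> : f' * g' - f * g - (g * d1 + f * d2) =
  g * (f' - f - d1) + f * (g' - g - d2) + (f' - f) * (g' - g) by ring.
have c1 : `|g * (f' - f - d1)| <= l1 ^+ 2 * r ^+ 2.
  by rewrite normrM (ger0_norm ga); apply: le_trans b1; rewrite ler_piMl.
have c2 : `|f * (g' - g - d2)| <= l2 ^+ 2 * r ^+ 2.
  by rewrite normrM (ger0_norm fa); apply: le_trans b2; rewrite ler_piMl.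
have c3 : `|(f' - f) * (g' - g)| <= l1 * r * (l2 * r) by rewrite normrM ler_pM.
have c4 : 0 <= l1 * r * (l2 * r) by rewrite !mulr_ge0.
have -> : (l1 + l2) ^+ 2 * r ^+ 2 =
  l1 ^+ 2 * r ^+ 2 + l2 ^+ 2 * r ^+ 2 + 2 * (l1 * r * (l2 * r)) by ring.
have tri (u v t : R) : `|u + v + t| <= `|u| + `|v| + `|t|.
  by rewrite (le_trans (ler_normD _ _)) // lerD2r ler_normD.
apply: (le_trans (tri _ _ _)); lra.
Qed.

Lemma smooth1 x a k pc : smooth 0 x a k pc (fun=> 1).
Proof.
split=> w; first by rewrite ler01 lexx.
exists (fun=> 0) => [j|n _ h]; first by rewrite nm0.
have -> : dotp 0 h = 0 by rewrite /dotp /= !mul0r addr0.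
by rewrite !subrr normr0 expr0n !mul0r.
Qed.

Lemma smooth_prod l x a k pc J (F : nat -> signs -> R) : 0 <= l ->
  (forall j, (j < J)%N -> smooth l x a k pc (F j)) ->
  smooth (l *+ J) x a k pc (fun w => \prod_(0 <= j < J) F j w).
Proof.
move=> l0; elim: J => [|J IH] hF.
  have -> : (fun w => \prod_(0 <= j < 0) F j w) = fun=> 1.
    by apply/funext => w; rewrite big_geq.
  exact: smooth1.
have -> : (fun w => \prod_(0 <= j < J.+1) F j w) =
    fun w => (\prod_(0 <= j < J) F j w) * F J w.
  by apply/funext => w; rewrite big_nat_recr.
rewrite mulrSr; apply: smoothM => //; first by rewrite mulrn_wge0.
- by apply: IH => j jJ; apply: hF; apply: ltnW.
- exact: hF.
Qed.

Lemma smooth_le l l' x a k pc F : 0 <= l -> l <= l' ->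
  smooth l x a k pc F -> smooth l' x a k pc F.
Proof.
move=> l0 ll [F01 hF]; split=> // w; have [g gl hg] := hF w.
exists g => [j|n nak]; first exact: le_trans (gl j) ll.
have [h1 h2] := hg n nak; split.
  by apply: (le_trans h1); rewrite ler_wpM2r ?nm_ge0.
by apply: (le_trans h2); rewrite ler_wpM2r ?sqn_ge0 // lerXn2r // nnegrE // (le_trans l0).
Qed.

Lemma sqr_sum_nat (M : nat) (c : nat -> R) :
  (\sum_(0 <= q < M) c q) ^+ 2 <= M%:R * \sum_(0 <= q < M) c q ^+ 2.
Proof.
elim: M => [|M IH]; first by rewrite !big_geq // expr0n mul0r.
rewrite !big_nat_recr //= -natr1.
have S0 : 0 <= \sum_(0 <= q < M) c q ^+ 2 by apply: sumr_ge0 => q _; apply: sqr_ge0.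
move: IH S0; move: (\sum_(0 <= q < M) c q) (\sum_(0 <= q < M) c q ^+ 2) (c M) (ler0n R M).
case: M => [|M]; first by move=> u v d _; rewrite mul0r => *; have : u = 0; nra.
have : 1 <= M.+1%:R :> R by rewrite ler1n.
move: (M.+1%:R : R) => m m1 u v d m0 h v0.
have : 0 <= m * ((m + 1) * (v + d ^+ 2) - (u + d) ^+ 2).
  have -> : m * ((m + 1) * (v + d ^+ 2) - (u + d) ^+ 2) =
    (m + 1) * (m * v - u ^+ 2) + (u - m * d) ^+ 2 by ring.
  by rewrite addr_ge0 ?sqr_ge0 // mulr_ge0 ?subr_ge0 // addr_ge0.
by rewrite pmulr_rge0 ?subr_ge0 // (lt_le_trans ltr01).
Qed.

(** Weights over the grid see the sign of index [n] through its Fourier mode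
    only, so that Bessel's inequality bounds the sum of the influences. *)
Lemma influence_bound M a k pc J l beta (y : nat -> R[i]) (c : nat -> R)
    (F : nat -> signs -> R) w (f := fun w => \sum_(0 <= q < M) c q * F q w) :
  0 <= l -> 0 <= beta -> (k <= M)%N -> (forall n, (a <= n < a + k)%N -> (pc n < J)%N) ->
  (forall n, (a <= n < a + k)%N -> sqn (y n) <= beta) ->
  (forall q, (q < M)%N -> smooth l (fun n => y n * grid M q ^+ n) a k pc (F q)) ->
  \sum_(a <= n < (a + k)%N) ((f w - f (flip w n)) / 2) ^+ 2 <=
  (2 * beta * J%:R * l ^+ 2 + 8 * k%:R * beta ^+ 2 * l ^+ 4) *
    (M%:R * \sum_(0 <= q < M) c q ^+ 2).
Proof.
move=> l0 b0 kM pcJ yb Fs.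
set S2 := \sum_(0 <= q < M) c q ^+ 2.
have S20 : 0 <= S2 by apply: sumr_ge0 => q _; apply: sqr_ge0.
have M0 : 0 <= M%:R :> R by [].
have [g gP] : exists g : nat -> nat -> R[i], forall q, (q < M)%N ->
    (forall j, nm (g q j) <= l) /\
    forall n, (a <= n < a + k)%N ->
      `|F q (flip w n) - F q w -
        dotp (g q (pc n)) ((- (2 * sg (w n)))%:C * (y n * grid M q ^+ n))| <=
      l ^+ 2 * (4 * beta).
  have : forall q, exists g : nat -> R[i], (q < M)%N ->
    (forall j, nm (g j) <= l) /\
    forall n, (a <= n < a + k)%N ->
      `|F q (flip w n) - F q w -
        dotp (g (pc n)) ((- (2 * sg (w n)))%:C * (y n * grid M q ^+ n))| <=
      l ^+ 2 * (4 * beta).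
    move=> q; case: (ltnP q M) => qM; last by exists (fun=> 0).
    have [_ /(_ w)[g gl hg]] := Fs q qM; exists g => _; split => // n nak.
    have [_ h] := hg n nak; apply: (le_trans h).
    rewrite ler_wpM2l ?sqr_ge0 // sqnM sqnC sqrrN exprMn sg_sqr mulr1.
    rewrite sqnM sqn_gridX mulr1 -natrX; have := yb n nak; lra.
  by move=> /choice[g hg]; exists g.
pose W j n := \sum_(0 <= q < M) ((c q)%:C * (g q j)^*%C) * grid M q ^+ n.
have Wle n : (a <= n < a + k)%N ->
    ((f w - f (flip w n)) / 2) ^+ 2 <=
    2 * beta * sqn (W (pc n) n) + 8 * l ^+ 4 * beta ^+ 2 * (M%:R * S2).
  move=> nak.
  pose h q := (- (2 * sg (w n)))%:C * (y n * grid M q ^+ n).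
  have dW : \sum_(0 <= q < M) c q * dotp (g q (pc n)) (h q) =
      complex.Re ((- (2 * sg (w n)))%:C * (y n * W (pc n) n)).
    rewrite /W !mulr_sumr Re_sum; apply: eq_bigr => q _; rewrite /h.
    rewrite -dotpZl; case: (g q (pc n)) => g1 g2.
    case: (y n) (grid M q ^+ n) => [y1 y2] [z1 z2]; rewrite /dotp /=; ring.
  set u := \sum_(0 <= q < M) c q * dotp _ _ in dW.
  pose err q := F q (flip w n) - F q w - dotp (g q (pc n)) (h q).
  have fE : f w - f (flip w n) = - (u + \sum_(0 <= q < M) c q * err q).
    rewrite /f /u -sumrB -big_split /= -sumrN; apply: eq_bigr => q _; rewrite /err; ring.
  have u2 : u ^+ 2 <= 4 * beta * sqn (W (pc n) n).
    rewrite dW; apply: (@le_trans _ _ (sqn ((- (2 * sg (w n)))%:C * (y n * W (pc n) n)))).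
      by rewrite /sqn lerDl sqr_ge0.
    rewrite sqnM sqnC sqrrN exprMn sg_sqr sqnM mulr1 -natrX mulrA ler_wpM2r ?sqn_ge0 //.
    by have := yb n nak; lra.
  set v := \sum_(0 <= q < M) c q * err q in fE.
  have v2 : v ^+ 2 <= (4 * beta * l ^+ 2) ^+ 2 * (M%:R * S2).
    apply: (le_trans (sqr_sum_nat _ _)); rewrite mulrCA ler_wpM2l // /S2 mulr_sumr.
    rewrite !big_nat; apply: ler_sum => q /andP[_ qM].
    rewrite exprMn mulrC ler_wpM2r ?sqr_ge0 //.
    have [_ /(_ n nak)] := gP q qM; rewrite -/(err q) => he.
    rewrite -[err q ^+ 2]real_normK ?num_real //.
    rewrite lerXn2r ?nnegrE //; last by rewrite mulrC; lra.
    by rewrite !mulr_ge0 // sqr_ge0.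
  rewrite fE mulNr sqrrN.
  have : ((u + v) / 2) ^+ 2 <= (u ^+ 2 + v ^+ 2) / 2.
    rewrite -subr_ge0 (_ : _ - _ = ((u - v) / 2) ^+ 2) ?sqr_ge0 //; by field.
  have e4 : (4 * beta * l ^+ 2) ^+ 2 * (M%:R * S2) = 16 * (l ^+ 4 * beta ^+ 2 * (M%:R * S2)) by ring.
  by rewrite e4 in v2 => ?; lra.
apply: (@le_trans _ _ (\sum_(a <= n < (a + k)%N)
   (2 * beta * (\sum_(0 <= j < J) sqn (W j n)) + 8 * l ^+ 4 * beta ^+ 2 * (M%:R * S2)))).
  rewrite !big_nat; apply: ler_sum => n nak; apply: (le_trans (Wle n nak)).
  rewrite lerD2r ler_wpM2l ?mulr_ge0 //.
  rewrite (bigD1_seq (pc n)) ?iota_uniq ?mem_index_iota ?pcJ //=.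
  by rewrite lerDl; apply: sumr_ge0 => j _; apply: sqn_ge0.
rewrite big_split /= -mulr_sumr sumr_const_nat addKn -[X in _ + X <= _]mulr_natl.
rewrite exchange_big /=.
have Wj j : \sum_(a <= n < (a + k)%N) sqn (W j n) <= M%:R * (l ^+ 2 * S2).
  apply: (le_trans (bessel _ _ kM)); rewrite ler_wpM2l // /S2 mulr_sumr.
  rewrite !big_nat; apply: ler_sum => q /andP[_ qM].
  rewrite sqnM sqnC sqn_conj mulrC ler_wpM2r ?sqr_ge0 //.
  have [gl _] := gP q qM; rewrite nm_sqn lerXn2r ?nnegrE ?nm_ge0 //.
have : \sum_(0 <= j < J) \sum_(a <= n < (a + k)%N) sqn (W j n) <= J%:R * (M%:R * (l ^+ 2 * S2)).
  apply: (le_trans (ler_sum _ (fun j _ => Wj j))).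
  by rewrite sumr_const_nat subn0 -[leLHS]mulr_natl.
move=> hs; have := ler_wpM2l (_ : 0 <= 2 * beta) hs; rewrite mulr_ge0 // => /(_ isT).
have -> : (2 * beta * J%:R * l ^+ 2 + 8 * k%:R * beta ^+ 2 * l ^+ 4) * (M%:R * S2) =
   2 * beta * (J%:R * (M%:R * (l ^+ 2 * S2))) + k%:R * (8 * l ^+ 4 * beta ^+ 2 * (M%:R * S2)).
  by ring.
by move=> ?; rewrite lerD2r.
Qed.

(** The fluctuations of a sum over the grid, by [poincare] and [influence_bound]. *)
Lemma variance_bound M a k pc J l beta (y : nat -> R[i]) (c : nat -> R)
    (F : nat -> signs -> R) w (f := fun w => \sum_(0 <= q < M) c q * F q w) :
  0 <= l -> 0 <= beta -> (k <= M)%N -> (forall n, (a <= n < a + k)%N -> (pc n < J)%N) ->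
  (forall n, (a <= n < a + k)%N -> sqn (y n) <= beta) ->
  (forall q, (q < M)%N -> smooth l (fun n => y n * grid M q ^+ n) a k pc (F q)) ->
  avg a k (fun w => f w ^+ 2) w <= avg a k f w ^+ 2 +
  (2 * beta * J%:R * l ^+ 2 + 8 * k%:R * beta ^+ 2 * l ^+ 4) *
    (M%:R * \sum_(0 <= q < M) c q ^+ 2).
Proof.
move=> l0 b0 kM pcJ yb Fs; apply: (le_trans (poincare _ _ _ _)); rewrite lerD2l -avg_sum.
by apply: avg_le_cst => w' _; apply: influence_bound Fs.
Qed.
End Variance.

(** * Random densities that live on the points of confined partial sums *)

Section Stages.
Context {R : realType}.
Local Open Scope complex_scope.
Context (a : nat -> R[i]) (h b J0 : nat) (e : nat -> nat).

Local Notation nm := (@ComplexField.Normc.normc R).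

Definition H : R := h%:R.
(** Stage [i] consists of the indices in [Ns i, Ns i.+1).  It is cut into pieces of
    length [Ns i / h ^ i]: the number of pieces is a small power of [Ns i], and yet
    the variance of a piece, at most [slack i], is so small that no piece is
    likely to contribute more than [delta i]. *)
Definition Ns i : nat := (h ^ (b * i))%N.
Definition len i : nat := (Ns i.+1 - Ns i)%N.
Definition piece i : nat := (h ^ (b.-1 * i))%N.
Definition pieces i : nat := (h ^ i * (h ^ b - 1))%N.
Definition pc i n : nat := ((n - Ns i) %/ piece i)%N.
Definition pend i l : nat := (Ns i + l.+1 * piece i)%N.
Definition delta i : R := 2^-1 ^+ e i.
Definition slack i : R := H^-1 ^+ i.
Definition terms (z : R[i]) n : R[i] := a n * z ^+ n.
Definition stage_sum i z w : R[i] := wsum (terms z) w (Ns i) (Ns i.+1).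
Definition stage_var i : R := \sum_(Ns i <= n < Ns i.+1) sqn (a n).

(** The displacement of the partial sum since the current epoch began. *)
Fixpoint state z k w : R[i] :=
  if k is k'.+1 then
    if e (J0 + k'.+1)%N == e (J0 + k')%N then state z k' w + stage_sum (J0 + k') z w
    else 0
  else 0.

(** The allowed radius grows from [delta - slack] to [delta - slack / h] during a
    stage: this leaves room for a smooth cutoff, and for stages whose variance is
    too small to be isotropic. *)
Definition confine z k w : R :=
  let i := (J0 + k)%N in
  cutoff ((delta i - slack i.+1) ^+ 2) ((delta i - slack i / 2) ^+ 2)
    (state z k w + stage_sum i z w) *
  \prod_(0 <= l < pieces i)
     cutoff (delta i ^+ 2) ((delta i / 2) ^+ 2)
       (wsum (terms z) w (Ns i) (pend i l)).

Definition survival z k w : R :=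
  avg (Ns (J0 + k)) (len (J0 + k)) (confine z k) w.

(** Given the past, [confine] divided by [survival] has mean 1: the density is a
    martingale at the points where [survival] does not vanish. *)
Fixpoint density z k w : R :=
  if k is k'.+1 then density z k' w * (confine z k' w / survival z k' w) else 1.

(** [slack i ^+ 2 / 40] is at most the quarter of the variance that [dotp_var]
    allows, unless the variance is below [slack i ^+ 2 / 10]. *)
Definition isotropic i z : Prop :=
  sqn (\sum_(Ns i <= n < Ns i.+1) terms z n ^+ 2) <= (slack i ^+ 2 / 40) ^+ 2.

(* A single lower bound on [h] absorbs the numerical constants. *)
Context (h256 : (255 < h)%N).
Context (b22 : (22 < b)%N).
Context (J1 : (0 < J0)%N).
Context (e_mono : forall i j, (i <= j)%N -> (e i <= e j)%N).
Context (e_le : forall i, (e i <= i)%N).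
(* [272 = 2 * 136]: half of the radius contains the disc of [small_ball]. *)
Context (var_small : forall i, (J0 <= i)%N -> 272 ^+ 2 * stage_var i <= delta i ^+ 2).
Context (a_small : forall i n, (J0 <= i)%N -> (Ns i <= n)%N -> sqn (a n) * (Ns i)%:R <= 1).

Let b1 : (1 < b)%N. Proof. exact: leq_trans b22. Qed.

Lemma H256 : 256 <= H.
Proof. by rewrite /H (ler_nat R 256). Qed.

Lemma h_gt0 : (0 < h)%N. Proof. exact: leq_ltn_trans h256. Qed.

Lemma Ns_gt0 i : (0 < Ns i)%N. Proof. by rewrite expn_gt0 h_gt0. Qed.

Lemma Ns_mono i j : (i <= j)%N -> (Ns i <= Ns j)%N.
Proof. by move=> ij; rewrite leq_exp2l ?leq_mul2l ?ij ?orbT //; apply: leq_trans h256. Qed.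

Lemma Ns_len i : (Ns i + len i = Ns i.+1)%N.
Proof. by rewrite subnKC // Ns_mono. Qed.

Lemma piece_gt0 i : (0 < piece i)%N. Proof. by rewrite expn_gt0 h_gt0. Qed.

Lemma NsE i : Ns i = (piece i * h ^ i)%N.
Proof. by rewrite -expnD; congr expn; case: b b1 => // b' _ /=; lia. Qed.

Lemma NsS i : Ns i.+1 = (Ns i * h ^ b)%N.
Proof. by rewrite /Ns mulnS addnC expnD. Qed.

Lemma lenE i : len i = (pieces i * piece i)%N.
Proof. by rewrite /len NsS -{2}[Ns i]muln1 -mulnBr NsE /pieces; ring. Qed.

Lemma pieces_gt0 i : (0 < pieces i)%N.
Proof.
rewrite muln_gt0 expn_gt0 h_gt0 /= subn_gt0.
by rewrite -{1}(expn0 h) ltn_exp2l ?(ltnW b1) //; apply: leq_trans h256.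
Qed.

Lemma pend_last i : pend i (pieces i).-1 = Ns i.+1.
Proof. by rewrite /pend (prednK (pieces_gt0 i)) -(lenE i) Ns_len. Qed.

Lemma pend_le i l : (l < pieces i)%N -> (Ns i <= pend i l <= Ns i + len i)%N.
Proof.
by move=> lp; rewrite leq_addr /= /pend leq_add2l lenE leq_mul2r lp orbT.
Qed.

Lemma ltn_pend i n l : (Ns i <= n)%N -> (n < pend i l)%N = (pc i n <= l)%N.
Proof.
move=> nN; rewrite /pc /pend -[in RHS]ltnS ltn_divLR ?piece_gt0 //.
by rewrite -{1}(subnKC nN) ltn_add2l.
Qed.

Lemma pc_lt i n : (Ns i <= n < Ns i + len i)%N -> (pc i n < pieces i)%N.
Proof. by move=> /andP[n1 n2]; rewrite /pc ltn_divLR ?piece_gt0 // -lenE; lia. Qed.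

Lemma slack_gt0 i : 0 < slack i.
Proof. by rewrite exprn_gt0 // invr_gt0; have := H256; lra. Qed.

Lemma delta_gt0 i : 0 < delta i.
Proof. by rewrite exprn_gt0 // invr_gt0. Qed.

Lemma delta_le1 i : delta i <= 1.
Proof. by rewrite exprn_ile1 // ?invr_ge0 // invf_le1 // ler1n. Qed.

Lemma slack_delta i : slack i <= delta i.
Proof.
apply: (@le_trans _ _ (2^-1 ^+ i)).
  rewrite lerXn2r ?nnegrE ?invr_ge0 ?ler0n // lef_pV2 ?posrE ?ltr0n ?h_gt0 //.
  by have := H256; rewrite /H; lra.
by apply: ler_wiXn2l; rewrite ?invr_ge0 ?invf_le1 ?ler1n.
Qed.

Lemma slackS i : slack i.+1 <= slack i / 256.
Proof.
rewrite /slack exprS mulrC ler_wpM2l ?(ltW (slack_gt0 i)) //.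
by have H2 := H256; rewrite lef_pV2 // posrE; lra.
Qed.

Lemma delta_mono i j : (i <= j)%N -> delta j <= delta i.
Proof.
by move=> ij; apply: ler_wiXn2l; rewrite ?invr_ge0 ?invf_le1 ?ler1n ?e_mono.
Qed.

Lemma radii i : [/\ 0 <= (delta i - slack i / 2) ^+ 2,
  (delta i - slack i / 2) ^+ 2 < (delta i - slack i.+1) ^+ 2,
  (delta i - slack i.+1) ^+ 2 <= 1 &
  slack i ^+ 2 / 4 <= (delta i - slack i.+1) ^+ 2 - (delta i - slack i / 2) ^+ 2].
Proof.
have d0 := delta_gt0 i; have d1 := delta_le1 i; have u0 := slack_gt0 i.
have ud := slack_delta i; have u1 := slackS i; have u1' := slack_gt0 i.+1.
split; first exact: sqr_ge0.
all: move: (delta i) (slack i) (slack i.+1) d0 d1 u0 ud u1 u1' => d u v *; nra.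
Qed.

Lemma radii2 i : [/\ 0 <= (delta i / 2) ^+ 2, (delta i / 2) ^+ 2 < delta i ^+ 2,
  delta i ^+ 2 <= 1 & slack i ^+ 2 / 4 <= delta i ^+ 2 - (delta i / 2) ^+ 2].
Proof.
have d0 := delta_gt0 i; have d1 := delta_le1 i; have u0 := slack_gt0 i.
have ud := slack_delta i.
split; first exact: sqr_ge0.
all: move: (delta i) (slack i) d0 d1 u0 ud => d u *; nra.
Qed.

Lemma confine_01 z k w : 0 <= confine z k w <= 1.
Proof.
have [r0 r1 _ _] := radii (J0 + k); have [s0 s1 _ _] := radii2 (J0 + k).
have /andP[c0 c1] := cutoff_01 (state z k w + stage_sum (J0 + k) z w) r1.
rewrite /confine; set P := \prod_(_ <= _ < _) _.
have /andP[P0 P1] : 0 <= P <= 1.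
  apply: (big_ind (fun x => 0 <= x <= 1)) => [|x y /andP[? ?] /andP[? ?]|l _].
  - by rewrite ler01 lexx.
  - by apply/andP; split; nra.
  - exact: cutoff_01.
by apply/andP; split; nra.
Qed.

Lemma confine_neq0 z k w : confine z k w != 0 ->
  sqn (state z k w + stage_sum (J0 + k) z w) < (delta (J0 + k) - slack (J0 + k).+1) ^+ 2 /\
  forall l, (l < pieces (J0 + k))%N ->
    sqn (wsum (terms z) w (Ns (J0 + k)) (pend (J0 + k) l)) < delta (J0 + k) ^+ 2.
Proof.
have [r0 r1 _ _] := radii (J0 + k); have [s0 s1 _ _] := radii2 (J0 + k).
rewrite /confine mulf_eq0 negb_or => /andP[c1]; rewrite prodf_seq_neq0 => /allP c2.
split=> [|l lp]; first by rewrite ltNge; apply: contra c1 => /(cutoff_eq0 r1) ->.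
have := c2 l; rewrite mem_index_iota lp => /(_ isT) /= {}c2.
by rewrite ltNge; apply: contra c2 => /(cutoff_eq0 s1) ->.
Qed.

Lemma confine_eq1 z k w :
  sqn (state z k w + stage_sum (J0 + k) z w) <= (delta (J0 + k) - slack (J0 + k) / 2) ^+ 2 ->
  (forall l, (l < pieces (J0 + k))%N ->
    sqn (wsum (terms z) w (Ns (J0 + k)) (pend (J0 + k) l)) <= (delta (J0 + k) / 2) ^+ 2) ->
  confine z k w = 1.
Proof.
have [r0 r1 _ _] := radii (J0 + k); have [s0 s1 _ _] := radii2 (J0 + k).
move=> h1 h2; rewrite /confine cutoff_eq1 // mul1r big_nat big1 // => l /andP[_ lp].
by rewrite cutoff_eq1 // h2.
Qed.

Lemma state_adapted z k : adapted (Ns J0) (Ns (J0 + k)) (state z k).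
Proof.
elim: k => [|k IH] w w' hw //=; rewrite addnS in hw.
case: ifP => // _; rewrite (IH w w'); last first.
  move=> n /andP[n1 n2]; apply: hw; rewrite n1 (leq_trans n2) // Ns_mono //.
congr (_ + _); apply: wsum_ext => n /andP[n1 n2]; apply: hw.
by rewrite n2 andbT (leq_trans _ n1) // Ns_mono // leq_addr.
Qed.

Lemma confine_adapted z k : adapted (Ns J0) (Ns (J0 + k).+1) (confine z k).
Proof.
move=> w w' hw; rewrite /confine (@state_adapted z k w w'); last first.
  by move=> n /andP[n1 n2]; apply: hw; rewrite n1 (leq_trans n2) // Ns_mono.
have hw' n : (Ns (J0 + k) <= n < Ns (J0 + k).+1)%N -> w n = w' n.
  by move=> /andP[n1 n2]; apply: hw; rewrite n2 andbT (leq_trans _ n1) // Ns_mono // leq_addr.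
congr (cutoff _ _ (_ + _) * _); first exact: wsum_ext.
rewrite !big_nat; apply: eq_bigr => l /andP[_ lp]; congr cutoff.
apply: wsum_ext => n /andP[n1 n2]; apply: hw'; rewrite n1 (leq_trans n2) //.
by have /andP[_] := pend_le lp; rewrite Ns_len.
Qed.

Lemma survival_adapted z k : adapted (Ns J0) (Ns (J0 + k)) (survival z k).
Proof.
apply: avg_adapted_tail; first by rewrite Ns_mono // leq_addr.
by rewrite Ns_len; apply: confine_adapted.
Qed.

Lemma density_adapted z k : adapted (Ns J0) (Ns (J0 + k)) (density z k).
Proof.
elim: k => [|k IH] w w' hw //=; rewrite addnS in hw.
have hw' n : (Ns J0 <= n < Ns (J0 + k))%N -> w n = w' n.
  by move=> /andP[n1 n2]; apply: hw; rewrite n1 (leq_trans n2) // Ns_mono.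
by rewrite (IH w w') // (confine_adapted z hw) (survival_adapted z hw').
Qed.

Lemma state_off z k w w' : agree_off (Ns (J0 + k)) (len (J0 + k)) w w' ->
  state z k w' = state z k w.
Proof. by move=> hw; apply: state_adapted => n hn; rewrite -hw //; lia. Qed.

Lemma survival_off z k w w' : agree_off (Ns (J0 + k)) (len (J0 + k)) w w' ->
  survival z k w' = survival z k w.
Proof. by move=> hw; apply: survival_adapted => n hn; rewrite -hw //; lia. Qed.

Lemma density_off z k w w' : agree_off (Ns (J0 + k)) (len (J0 + k)) w w' ->
  density z k w' = density z k w.
Proof. by move=> hw; apply: density_adapted => n hn; rewrite -hw //; lia. Qed.

(** Inside an epoch the admissible radius increases from stage to stage, and a new
    epoch starts from displacement 0. *)
Lemma state_bound z k w : density z k w != 0 ->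
  sqn (state z k w) <= (delta (J0 + k) - slack (J0 + k)) ^+ 2.
Proof.
elim: k => [|k IH] /=; first by rewrite sqn0 sqr_ge0.
rewrite mulf_eq0 negb_or => /andP[_]; rewrite mulf_eq0 negb_or => /andP[nz _].
have [c1 _] := confine_neq0 nz.
case: eqP => [ee|_]; last by rewrite sqn0 sqr_ge0.
rewrite addnS in ee *; rewrite (_ : delta (J0 + k).+1 = delta (J0 + k)) ?(ltW c1) //.
by rewrite /delta ee.
Qed.

Lemma var_terms z i : sqn z = 1 -> var (terms z) (Ns i) (len i) = stage_var i.
Proof.
move=> z1; rewrite /var Ns_len; apply: eq_bigr => n _.
by rewrite /terms sqnM sqnX z1 expr1n mulr1.
Qed.

Lemma stage_var_ge0 i : 0 <= stage_var i.
Proof. by apply: sumr_ge0 => n _; apply: sqn_ge0. Qed.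

(** A stage of variance at least [slack i ^+ 2 / 10] is isotropic, and [small_ball]
    applies; a stage of smaller variance is unlikely to use up the slack. *)
Lemma survival_lb z k w : sqn z = 1 -> isotropic (J0 + k) z ->
  sqn (state z k w) <= (delta (J0 + k) - slack (J0 + k)) ^+ 2 ->
  1 / 11 <= survival z k w.
Proof.
move=> z1 iso st; set i := (J0 + k)%N in iso st *.
have vz := var_terms i z1; have v0 := stage_var_ge0 i.
have vs := var_small (leq_addr k J0 : (J0 <= i)%N).
have d0 := delta_gt0 i; have d1 := delta_le1 i; have u0 := slack_gt0 i.
have ud := slack_delta i.
have f0 w' : agree_off (Ns i) (len i) w w' -> 0 <= confine z k w'.
  by move=> _; have /andP[] := confine_01 z k w'.
have nst : nm (state z k w) <= delta i - slack i by apply: nm_le => //; lra.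
case: (leP (slack i ^+ 2 / 10) (stage_var i)) => hv.
  apply: (small_ball (X := terms z) (s := state z k w)) => //.
  - by rewrite vz; apply: lt_le_trans hv; rewrite divr_gt0 // exprn_gt0.
  - rewrite vz Ns_len; apply: (le_trans iso).
    by rewrite lerXn2r ?nnegrE ?divr_ge0 ?sqr_ge0 //; lra.
  - rewrite vz => w' hw' he hs; rewrite confine_eq1 //.
      rewrite (state_off z hw') /stage_sum -/i -Ns_len; apply: (le_trans hs).
      rewrite ge_max; apply/andP; split.
        apply: (le_trans st).
        by rewrite lerXn2r ?nnegrE; lra.
      apply: (@le_trans _ _ ((delta i / 2) ^+ 2)); first lra.
      by rewrite lerXn2r ?nnegrE; lra.
    move=> l lp; apply/ltW/(lt_le_trans (exceedsPn he (pend_le lp))).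
    lra.
apply: (@le_trans _ _ (1 / 2)); first lra.
apply: (small_ball_quiet (X := terms z) (L := slack i ^+ 2 / 4)) => //.
- by rewrite divr_gt0 // exprn_gt0.
- rewrite vz.
  have : stage_var i ^+ 2 <= (slack i ^+ 2 / 10) ^+ 2.
    by rewrite lerXn2r ?nnegrE ?divr_ge0 ?sqr_ge0 // ltW.
  have := sqr_ge0 (slack i ^+ 2); move: (slack i ^+ 2) => U *; lra.
- move=> w' hw' he.
  have small n : (Ns i <= n <= Ns i + len i)%N ->
      nm (wsum (terms z) w' (Ns i) n) <= slack i / 2.
    move=> hn; apply: nm_le; first lra.
    by apply: (le_trans (ltW (exceedsPn he hn))); lra.
  rewrite confine_eq1 // -/i.
    rewrite (state_off z hw') /stage_sum -Ns_len (nm_sqn (_ + _)).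
    have hs := small (Ns i + len i)%N.
    rewrite lerXn2r ?nnegrE ?nm_ge0 //; first by lra.
    apply: (le_trans (nmD _ _)); have := hs; rewrite leqnn leq_addr => /(_ isT).
    lra.
  move=> l lp; rewrite nm_sqn lerXn2r ?nnegrE ?nm_ge0 //; first by lra.
  by apply: (le_trans (small _ (pend_le lp))); lra.
Qed.

(** At good points the conditional probabilities of survival are bounded below. *)
Definition good z k := sqn z = 1 /\ forall j, (j < k)%N -> isotropic (J0 + j) z.

Lemma density_survival z k w : good z k.+1 -> density z k w != 0 ->
  1 / 11 <= survival z k w.
Proof. by move=> [z1 iso] /state_bound st; apply: survival_lb => //; apply: iso. Qed.

Lemma goodS z k : good z k.+1 -> good z k.
Proof. by move=> [z1 iso]; split=> // j jk; apply: iso; apply: ltnW. Qed.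

Lemma density_bounds z k w : good z k -> 0 <= density z k w <= 11 ^+ k.
Proof.
elim: k => [|k IH] gz /=; first by rewrite ler01 lexx.
have /andP[r0 r1] := IH (goodS gz).
have [->|rn0] := eqVneq (density z k w) 0.
  by rewrite !mul0r lexx exprn_ge0.
have p := density_survival gz rn0; have /andP[c0 c1] := confine_01 z k w.
have p0 : 0 < survival z k w by lra.
rewrite mulr_ge0 ?divr_ge0 ?(ltW p0) //= exprSr ler_pM ?divr_ge0 ?(ltW p0) //.
by rewrite ler_pdivrMr //; lra.
Qed.

Lemma density_martingale z k w : good z k.+1 ->
  avg (Ns (J0 + k)) (len (J0 + k)) (density z k.+1) w = density z k w.
Proof.
move=> gz; rewrite /= (@avg_pull _ _ _ _ _ (density z k w)); last by move=> w' /(density_off z).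
have [->|rn0] := eqVneq (density z k w) 0; first by rewrite mul0r.
have -> : avg (Ns (J0 + k)) (len (J0 + k))
    (fun w => confine z k w / survival z k w) w =
    (survival z k w)^-1 * avg (Ns (J0 + k)) (len (J0 + k)) (confine z k) w.
  by rewrite -avgZ; apply: avg_eq => w' /(survival_off z) ->; rewrite mulrC.
have p := density_survival gz rn0.
by rewrite -/(survival z k w) mulVf ?mulr1 // gt_eqF //; lra.
Qed.

(** * The mass of the density and its fluctuations *)

Lemma slackV i : (slack i)^-1 = H ^+ i.
Proof. by rewrite /slack exprVn invrK. Qed.

Lemma H_gt0 : 0 < H.
Proof. by have := H256; lra. Qed.

Lemma HX_ge1 n : 1 <= H ^+ n.
Proof. by apply: exprn_ege1; have := H256; lra. Qed.

Lemma HX_mono m n : (m <= n)%N -> H ^+ m <= H ^+ n.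
Proof. by move=> mn; apply: ler_weXn2l => //; have := H256; lra. Qed.

Lemma NsR i : (Ns i)%:R = H ^+ (b * i) :> R.
Proof. by rewrite natrX. Qed.

Lemma piecesR i : (pieces i)%:R + 1 <= H ^+ (i + b).
Proof.
rewrite natr1 /H -natrX ler_nat /pieces expnD mulnBr muln1.
have h0 := h_gt0.
have h1 : (0 < h ^ i)%N by rewrite expn_gt0 h0.
have h2 : (0 < h ^ b)%N by rewrite expn_gt0 h0.
have : (h ^ i <= h ^ i * h ^ b)%N by rewrite leq_pmulr.
by move: (h ^ i * h ^ b)%N => x; lia.
Qed.

(** The cutoffs vary over radii whose squares differ by [slack ^+ 2 / 4] at least,
    which bounds the constant of each of them by a power of [h ^ i]; there is one
    for the end of each piece and one for the end of the stage. *)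
Lemma smooth_confine z k : sqn z = 1 ->
  smooth (H ^+ (5 * (J0 + k) + b + 2)) (terms z)
    (Ns (J0 + k)) (len (J0 + k)) (pc (J0 + k)) (confine z k).
Proof.
move=> z1; set i := (J0 + k)%N.
pose l0 := H ^+ (4 * i + 2).
have l00 : 0 <= l0 by rewrite exprn_ge0 // ltW // H_gt0.
have u0 := slack_gt0 i.
have cut A B : slack i ^+ 2 / 4 <= A - B -> 120 / (A - B) ^+ 2 <= l0.
  move=> hAB.
  have U0 : 0 < slack i ^+ 2 / 4 by rewrite divr_gt0 // exprn_gt0.
  apply: (@le_trans _ _ (120 / (slack i ^+ 2 / 4) ^+ 2)).
    rewrite ler_wpM2l // lef_pV2 ?posrE ?exprn_gt0 ?(lt_le_trans U0) //.
    by rewrite lerXn2r ?nnegrE ?(ltW U0) // (le_trans (ltW U0)).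
  have -> : 120 / (slack i ^+ 2 / 4) ^+ 2 = 1920 * (slack i)^-1 ^+ 4.
    by field; rewrite gt_eqF.
  rewrite slackV -exprM /l0 exprD mulrC mulnC.
  by rewrite ler_wpM2l ?exprn_ge0 ?(ltW H_gt0) //; have := H256; nra.
have x1 n : (Ns i <= n < Ns i + len i)%N -> 4 * sqn (terms z n) <= 1.
  move=> /andP[n1 _]; rewrite /terms sqnM sqnX z1 expr1n mulr1.
  have := a_small (leq_addr k J0) n1; rewrite NsR.
  have : H ^+ 1 <= H ^+ (b * (J0 + k)).
    by apply: HX_mono; rewrite muln_gt0 (ltnW b1) addn_gt0 J1.
  have := H256; have := sqn_ge0 (a n); rewrite expr1; move: (H ^+ _) => N *; nra.
have sf w n : (Ns i <= n < Ns i + len i)%N -> state z k (flip w n) = state z k w.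
  move=> hn; apply: state_adapted => m hm; rewrite flip_off //.
  by apply/eqP => mn; move: hn hm; rewrite -mn -/i; lia.
have [r0 r1 r2 r3] := radii i; have [s0 s1 s2 s3] := radii2 i.
apply: (@smooth_le _ (l0 + l0 *+ pieces i)).
- by rewrite addr_ge0 // mulrn_wge0.
- rewrite -mulrS -mulr_natr -natr1.
  apply: (@le_trans _ _ (l0 * H ^+ (i + b))); first by rewrite ler_wpM2l ?piecesR.
  by rewrite /l0 -exprD HX_mono //; clear; lia.
apply: smoothM => //; first by rewrite mulrn_wge0.
- apply: (@smooth_C11 _ _ _ _ _ _ _ (fun=> true)) => //.
    by apply: cutoff_C11 => //; apply: cut.
  by move=> n; rewrite Ns_len => /andP[].
- apply: smooth_prod => // l lp.
  have -> : (fun w => cutoff (delta i ^+ 2) ((delta i / 2) ^+ 2) (wsum (terms z) w (Ns i) (pend i l)))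
    = fun w => cutoff (delta i ^+ 2) ((delta i / 2) ^+ 2) (0 + wsum (terms z) w (Ns i) (pend i l)).
    by apply/funext => w; rewrite add0r.
  apply: (@smooth_C11 _ _ _ _ _ _ _ (fun j => j <= l)%N (fun=> 0)) => //.
    by apply: cutoff_C11 => //; apply: cut.
  by move=> n /andP[n1 _]; apply: ltn_pend.
Qed.

Definition mass M (chi : nat -> R) k w : R :=
  \sum_(0 <= q < M) chi q * density (grid M q) k w.

Definition weight M (chi : nat -> R) k :=
  forall q, (q < M)%N -> 0 <= chi q <= 1 /\ (chi q != 0 -> good (grid M q) k).

(** The variance of the mass added by stage [i], relative to the square of the
    size of the grid: [Ns i] to the power [-1 + 21 / b], up to a constant. *)
Definition fluctuation i : R := H ^+ (21 * i + 5 * b + 11) / H ^+ (b * i).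

Lemma weightS M chi k : weight M chi k.+1 -> weight M chi k.
Proof. by move=> wc q qM; have [h1 h2] := wc q qM; split=> // /h2 /goodS. Qed.

Lemma mass_martingale M chi k w : weight M chi k.+1 ->
  avg (Ns (J0 + k)) (len (J0 + k)) (mass M chi k.+1) w = mass M chi k w.
Proof.
move=> wc; rewrite avg_sum; apply: eq_big_nat => q /andP[_ qM].
rewrite avgZ; have [_] := wc q qM; case: eqVneq => [->|_ /(_ isT) gq].
  by rewrite !mul0r.
by rewrite density_martingale.
Qed.

Lemma mass_bounds M chi k w : weight M chi k ->
  0 <= mass M chi k w <= 11 ^+ k * \sum_(0 <= q < M) chi q.
Proof.
move=> wc; have hq q : (q < M)%N -> 0 <= chi q * density (grid M q) k w <= 11 ^+ k * chi q.
  move=> qM; have [/andP[c0 _]] := wc q qM; case: eqVneq => [->|_ /(_ isT) gq].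
    by rewrite mul0r mulr0 lexx.
  have /andP[r0 r1] := density_bounds w gq.
  by rewrite mulr_ge0 //= mulrC ler_wpM2r.
rewrite mulr_sumr /mass !big_nat; apply/andP; split.
  by apply: sumr_ge0 => q /andP[_ qM]; have /andP[] := hq q qM.
by apply: ler_sum => q /andP[_ qM]; have /andP[] := hq q qM.
Qed.

Lemma fluctuation_ub i (J := (pieces i)%:R : R) (l := H ^+ (5 * i + b + 2)) (N := (Ns i)%:R : R) :
  2 * N^-1 * J * l ^+ 2 + 8 * (len i)%:R * N^-1 ^+ 2 * l ^+ 4 <=
  H ^+ (20 * i + 5 * b + 10) / H ^+ (b * i).
Proof.
have H2 := H256; have H0 := H_gt0.
have N0 : 0 < N by rewrite ltr0n Ns_gt0.
rewrite -NsR -/N; have -> : 2 * N^-1 * J * l ^+ 2 + 8 * (len i)%:R * N^-1 ^+ 2 * l ^+ 4 =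
  (2 * J * l ^+ 2 + 8 * ((len i)%:R / N) * l ^+ 4) / N by field; rewrite gt_eqF.
rewrite ler_pM2r ?invr_gt0 //.
have lN : (len i)%:R / N <= H ^+ b.
  rewrite ler_pdivrMr // /N NsR -exprD -natrX ler_nat.
  by rewrite -[(b + _)%N]mulnS -/(Ns i.+1) leq_subr.
have J1' : J <= H ^+ (i + b) by have := piecesR i; rewrite -/J; lra.
have e1 : J * l ^+ 2 <= H ^+ (20 * i + 5 * b + 8).
  apply: (@le_trans _ _ (H ^+ (i + b) * l ^+ 2)); first by rewrite ler_wpM2r ?sqr_ge0.
  by rewrite /l -exprM -exprD HX_mono //; clear; lia.
have e2 : (len i)%:R / N * l ^+ 4 <= H ^+ (20 * i + 5 * b + 8).
  apply: (@le_trans _ _ (H ^+ b * l ^+ 4)).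
    by rewrite ler_wpM2r // exprn_ge0 // exprn_ge0 // ltW.
  by rewrite /l -exprM -exprD HX_mono //; clear; lia.
have -> : (20 * i + 5 * b + 10 = (20 * i + 5 * b + 8) + 2)%N by lia.
rewrite exprD; have := HX_ge1 (20 * i + 5 * b + 8).
move: (H ^+ (20 * i + 5 * b + 8)) e1 e2 => X e1 e2 X1.
have : 100 <= H ^+ 2 by nra.
by move: (H ^+ 2) => Y hY; rewrite -!mulrA in e2 *; nra.
Qed.

(** Given the past, the mass is a fixed linear combination of the smooth functions
    [confine] at the points of the grid: [variance_bound] applies, with the
    coefficients bounded by [11 ^+ k.+1]. *)
Lemma mass_step M chi k w : weight M chi k.+1 -> (len (J0 + k) <= M)%N ->
  avg (Ns (J0 + k)) (len (J0 + k)) (fun w => mass M chi k.+1 w ^+ 2) w <=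
  mass M chi k w ^+ 2 +
    fluctuation (J0 + k) * (M%:R * \sum_(0 <= q < M) chi q).
Proof.
move=> wc lM; set i := (J0 + k)%N.
have H2 := H256; have H0 := H_gt0.
pose c q := chi q * density (grid M q) k w / survival (grid M q) k w.
have mE w' : agree_off (Ns i) (len i) w w' ->
    mass M chi k.+1 w' = \sum_(0 <= q < M) c q * confine (grid M q) k w'.
  move=> hw'; apply: eq_bigr => q _ /=.
  by rewrite (density_off _ hw') (survival_off _ hw') /c; ring.
rewrite -(mass_martingale w wc) -/i.
rewrite (avg_eq (g := fun w => (\sum_(0 <= q < M) c q * confine (grid M q) k w) ^+ 2)); last first.
  by move=> w' /mE ->.
rewrite [in leRHS](avg_eq (g := fun w => \sum_(0 <= q < M) c q * confine (grid M q) k w)); last first.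
  by move=> w' /mE ->.
have N0 : 0 < (Ns i)%:R :> R by rewrite ltr0n Ns_gt0.
have l0 : 0 <= H ^+ (5 * i + b + 2) by rewrite exprn_ge0 // ltW.
have ab n : (Ns i <= n < Ns i + len i)%N -> sqn (a n) <= (Ns i)%:R^-1.
  move=> /andP[n1 _]; rewrite -[leRHS]mul1r ler_pdivlMr //.
  exact: (a_small (leq_addr k J0) n1).
have sm q : (q < M)%N -> smooth (H ^+ (5 * i + b + 2)) (fun n => a n * grid M q ^+ n)
    (Ns i) (len i) (pc i) (confine (grid M q) k).
  by move=> qM; apply: smooth_confine; exact: sqn_expi.
apply: (le_trans (variance_bound c w l0 _ lM (@pc_lt i) ab sm)).
  by rewrite invr_ge0 ltW.
rewrite lerD2l.
have cS : \sum_(0 <= q < M) c q ^+ 2 <= H ^+ i.+1 * \sum_(0 <= q < M) chi q.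
  rewrite mulr_sumr !big_nat; apply: ler_sum => q /andP[_ qM].
  have [/andP[c0 c1]] := wc q qM; rewrite /c; case: eqVneq => [->|_ /(_ isT) gq].
    by rewrite !mul0r expr0n mulr0.
  have /andP[r0 r1] := density_bounds w (goodS gq).
  have [->|rn0] := eqVneq (density (grid M q) k w) 0.
    by rewrite mulr0 mul0r expr0n mulr_ge0 // exprn_ge0 // ltW.
  have p := density_survival gq rn0.
  have p0 : 0 < survival (grid M q) k w by lra.
  have rs : 0 <= density (grid M q) k w / survival (grid M q) k w <= 11 ^+ k.+1.
    rewrite divr_ge0 ?(ltW p0) //= ler_pdivrMr // (le_trans r1) //.
    by rewrite exprSr -mulrA ler_peMr ?exprn_ge0 //; lra.
  rewrite -mulrA exprMn mulrC.
  apply: ler_pM; rewrite ?sqr_ge0 //; last by rewrite expr2 ler_piMl.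
  move: rs => /andP[s0 s1]; apply: (@le_trans _ _ ((11 ^+ k.+1) ^+ 2)).
    by rewrite lerXn2r ?nnegrE // exprn_ge0.
  rewrite -exprM mulnC exprM; apply: (@le_trans _ _ (H ^+ k.+1)).
    by rewrite lerXn2r ?nnegrE ?sqr_ge0 ?(ltW H0) //; lra.
  by apply: HX_mono; rewrite ltnS leq_addl.
have X0 : 0 <= H ^+ (20 * i + 5 * b + 10) / H ^+ (b * i).
  by rewrite divr_ge0 // exprn_ge0 // ltW.
apply: (@le_trans _ _ (H ^+ (20 * i + 5 * b + 10) / H ^+ (b * i) *
    (M%:R * \sum_(0 <= q < M) c q ^+ 2))).
  rewrite ler_wpM2r ?fluctuation_ub // mulr_ge0 //.
  by apply: sumr_ge0 => *; apply: sqr_ge0.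
apply: (@le_trans _ _ (H ^+ (20 * i + 5 * b + 10) / H ^+ (b * i) *
    (M%:R * (H ^+ i.+1 * \sum_(0 <= q < M) chi q)))).
  by rewrite ler_wpM2l // ler_wpM2l.
rewrite le_eqVlt; apply/orP; left; apply/eqP; rewrite /fluctuation.
have -> : (21 * i + 5 * b + 11 = (20 * i + 5 * b + 10) + i.+1)%N by lia.
rewrite (exprD H (20 * i + 5 * b + 10)%N); ring.
Qed.

Definition expect k (f : signs -> R) w : R :=
  avg (Ns J0) (Ns (J0 + k) - Ns J0) f w.

Lemma expectS k f w :
  expect k.+1 f w = expect k (avg (Ns (J0 + k)) (len (J0 + k)) f) w.
Proof.
have h1 : (Ns J0 <= Ns (J0 + k))%N by rewrite Ns_mono // leq_addr.
rewrite /expect addnS -Ns_len -addnBAC // avg_split subnKC //.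
Qed.

Lemma expect_le k f g w : (forall w', f w' <= g w') -> expect k f w <= expect k g w.
Proof. by move=> fg; apply: avg_le => w' _. Qed.

Lemma fluctuation_ge0 i : 0 <= fluctuation i.
Proof. by rewrite divr_ge0 // exprn_ge0 // ltW // H_gt0. Qed.

Lemma fluctuationE i : fluctuation i = H ^+ (5 * b + 11) / H ^+ ((b - 21) * i).
Proof.
have H0 := H_gt0; rewrite /fluctuation -addnA.
have -> : (b * i = 21 * i + (b - 21) * i)%N by rewrite -mulnDl subnKC // ltnW // ltnW.
rewrite !(exprD H (21 * i)); field.
by rewrite !expf_neq0 // gt_eqF.
Qed.

Lemma geometric_sum (r : R) (f : nat -> R) n k : 0 <= r <= 1 / 2 ->
  (forall j, 0 <= f j) -> (forall j, f j.+1 <= r * f j) ->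
  \sum_(n <= j < k) f j <= 2 * f n.
Proof.
move=> /andP[r0 r1] f0 fS; case: (leqP k n) => [kn|nk].
  by rewrite big_geq // mulr_ge0.
have : \sum_(n <= j < k) f j + 2 * f k <= 2 * f n; last first.
  by have := f0 k; lra.
rewrite -(subnKC (ltnW nk)); elim: (k - n)%N => [|m IH].
  by rewrite addn0 big_geq // add0r.
rewrite addnS big_nat_recr ?leq_addr //=; apply: le_trans IH.
have := fS (n + m)%N; have := f0 (n + m)%N; move: (f _) (f _) => x y *; nra.
Qed.

Lemma fluctuation_sum k0 k :
  \sum_(k0 <= j < k) fluctuation (J0 + j) <= 2 * fluctuation (J0 + k0).
Proof.
apply: (@geometric_sum (1 / 2) (fun j => fluctuation (J0 + j))) => [|j|j].
- by apply/andP; split; lra.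
- exact: fluctuation_ge0.
rewrite addnS !fluctuationE mulnS (exprD H (b - 21)) invfM.
have H2 := H256; have H0 := H_gt0.
have h1 : H <= H ^+ (b - 21).
  by rewrite -[leLHS]expr1; apply: HX_mono; move: b22; clear; lia.
rewrite mulrCA ler_pM2r; last by rewrite divr_gt0 // exprn_gt0.
by rewrite -[leRHS]invrK lef_pV2 ?posrE ?invr_gt0; lra.
Qed.

(** Up to time [k0] the trivial bound on the density is used, and after it the
    fluctuations, whose sum is dominated by the first one. *)
Lemma mass_second_moment M chi k0 k w : (k0 <= k)%N -> weight M chi k ->
  (forall j, (j < k)%N -> (len (J0 + j) <= M)%N) ->
  expect k (fun w => mass M chi k w ^+ 2) w <=
  (11 ^+ k0 * \sum_(0 <= q < M) chi q) ^+ 2 +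
    2 * fluctuation (J0 + k0) * (M%:R * \sum_(0 <= q < M) chi q).
Proof.
move=> k0k wc lM; set S := \sum_(_ <= _ < _) _.
have S0 : 0 <= M%:R * S.
  rewrite mulr_ge0 // /S big_nat; apply: sumr_ge0 => q /andP[_ qM].
  by have [/andP[]] := wc q qM.
apply: (@le_trans _ _ ((11 ^+ k0 * S) ^+ 2 +
    (\sum_(k0 <= j < k) fluctuation (J0 + j)) * (M%:R * S))); last first.
  by rewrite lerD2l ler_wpM2r // fluctuation_sum.
move: wc lM; rewrite -(subnKC k0k); elim: (k - k0)%N => [|n IH] wc lM.
  rewrite addn0 in wc *; rewrite big_geq // mul0r addr0; apply: avg_le_cst => w' _.
  by have /andP[m0 m1] := mass_bounds w' wc; rewrite lerXn2r ?nnegrE // (le_trans m0).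
rewrite addnS in wc lM *; rewrite expectS.
apply: (@le_trans _ _ (expect (k0 + n) (fun w => mass M chi (k0 + n) w ^+ 2 +
    fluctuation (J0 + (k0 + n)) * (M%:R * S)) w)).
  by apply: expect_le => w'; apply: mass_step => //; apply: lM.
rewrite /expect avgD avg_cst big_nat_recr ?leq_addr //= mulrDl addrA lerD2r.
by apply: IH => [|j jn]; [apply: weightS|apply: lM; apply: ltnW].
Qed.

Lemma mass_mean M chi k w : weight M chi k ->
  expect k (mass M chi k) w = \sum_(0 <= q < M) chi q.
Proof.
elim: k => [|k IH] wc.
  rewrite /expect addn0 subnn /=; apply: eq_bigr => q _; exact: mulr1.
rewrite expectS -IH; last exact: weightS.
by apply: avg_eq => w' _; apply: mass_martingale.
Qed.

(** * Confinement inside the pieces *)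

(** The cutoffs control the partial sums at the ends of the pieces only. *)
Definition overrun z i w : bool :=
  has (fun l => exceeds (terms z) (delta i ^+ 2) (Ns i + l * piece i)%N (piece i) 0 w)
    (iota 0 (pieces i)).

Lemma exceeds_adapted (X : nat -> R[i]) L n k s : adapted n (n + k) (exceeds X L n k s).
Proof.
move=> w w' hw; apply: eq_in_has => m; rewrite mem_iota => /andP[_ mk].
congr (_ <= sqn (_ + _)); apply: wsum_ext => l hl; apply: hw.
by move: hl mk; clear; lia.
Qed.

Lemma overrun_adapted z i : adapted (Ns i) (Ns i.+1) (overrun z i).
Proof.
move=> w w' hw; apply: eq_in_has => l; rewrite mem_iota => /andP[_ lp].
apply: exceeds_adapted => n /andP[n1 n2]; apply: hw.
rewrite (leq_trans _ n1) ?leq_addr //= (leq_trans n2) // -Ns_len lenE -addnA leq_add2l.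
by rewrite addnC -mulSn leq_mul2r lp orbT.
Qed.

Lemma delta_lb i : 16^-1 ^+ i <= delta i ^+ 4.
Proof.
rewrite /delta -exprM mulnC exprM.
have -> : (2^-1 ^+ 4 : R) = 16^-1 by rewrite exprVn -natrX.
by apply: ler_wiXn2l; rewrite ?invr_ge0 ?invf_le1 ?ler1n.
Qed.

(** A piece has variance at most [slack i], and the fourth moment beats the number
    of pieces, which is of the order of the inverse of [slack i]. *)
Lemma overrun_prob z i w : sqn z = 1 -> (J0 <= i)%N ->
  avg (Ns i) (len i) (fun w => (overrun z i w)%:R) w <= 3 * H ^+ b * 16^-1 ^+ i.
Proof.
move=> z1 Ji; have H2 := H256; have H0 := H_gt0.
have d4 : 0 < delta i ^+ 4 by rewrite exprn_gt0 // delta_gt0.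
have one l w' : (l < pieces i)%N ->
   avg (Ns i) (len i) (fun w => (exceeds (terms z) (delta i ^+ 2)
     (Ns i + l * piece i)%N (piece i) 0 w)%:R) w' <= 3 * (slack i) ^+ 2 / delta i ^+ 4.
  move=> lp; have -> : len i = (l * piece i + (piece i + (pieces i - l.+1) * piece i))%N.
    by rewrite lenE -{1}(subnKC lp) mulnDl mulSn [(_ + l * _)%N]addnC -addnA.
  rewrite avg_split; apply: avg_le_cst => w1 _; rewrite avg_split.
  rewrite (@avg_eq _ _ _ _ (fun w => (exceeds (terms z) (delta i ^+ 2)
     (Ns i + l * piece i)%N (piece i) 0 w)%:R)); last first.
    move=> w2 _; apply: (@avg_adapted _ (Ns i + l * piece i)%N (Ns i + l * piece i + piece i)%N) => //.
    by move=> w3 w4 hw; rewrite (exceeds_adapted _ _ _ hw).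
  rewrite ler_pdivlMr // mulrC (_ : delta i ^+ 4 = (delta i ^+ 2) ^+ 2); last by rewrite -exprM.
  apply: (le_trans (exceeds_prob _ _ _ _ (sqr_ge0 _))).
  rewrite ler_pM2l // lerXn2r ?nnegrE ?var_ge0 ?(ltW (slack_gt0 i)) //.
  apply: (@le_trans _ _ (\sum_(Ns i + l * piece i <= n < (Ns i + l * piece i + piece i)%N) (Ns i)%:R^-1)).
    rewrite /var !big_nat; apply: ler_sum => n /andP[n1 _].
    rewrite /terms sqnM sqnX z1 expr1n mulr1 -[leRHS]mul1r ler_pdivlMr ?ltr0n ?Ns_gt0 //.
    by apply: a_small => //; apply: leq_trans n1; apply: leq_addr.
  rewrite sumr_const_nat addKn -[leLHS]mulr_natl NsE natrM invfM mulrA mulfV ?mul1r.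
    by rewrite natrX -exprVn.
  by rewrite pnatr_eq0 -lt0n piece_gt0.
apply: (@le_trans _ _ (avg (Ns i) (len i) (fun w => \sum_(0 <= l < pieces i)
    (exceeds (terms z) (delta i ^+ 2) (Ns i + l * piece i)%N (piece i) 0 w)%:R) w)).
  apply: avg_le => w' _; rewrite /overrun.
  case: hasP => [[l]|_]; last by apply: sumr_ge0 => *; apply: ler0n.
  rewrite mem_iota => lp el; rewrite (bigD1_seq l) ?iota_uniq ?mem_index_iota //=.
  by rewrite el lerDl; apply: sumr_ge0 => *; apply: ler0n.
rewrite avg_sum; apply: (@le_trans _ _ (\sum_(0 <= l < pieces i) 3 * (slack i) ^+ 2 / delta i ^+ 4)).
  by rewrite !big_nat; apply: ler_sum => l /andP[_ lp]; apply: one.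
rewrite sumr_const_nat subn0 -[leLHS]mulr_natl.
have p1 : (pieces i)%:R <= H ^+ (i + b) by have := piecesR i; lra.
have s0 := slack_gt0 i.
apply: (@le_trans _ _ (H ^+ (i + b) * (3 * slack i ^+ 2 / delta i ^+ 4))).
  by rewrite ler_wpM2r // divr_ge0 ?(ltW d4) // mulr_ge0 // sqr_ge0.
have -> : H ^+ (i + b) * (3 * slack i ^+ 2 / delta i ^+ 4) =
    3 * H ^+ b * (slack i / delta i ^+ 4).
  rewrite exprD -(slackV i); field; by rewrite !gt_eqF // delta_gt0.
rewrite ler_wpM2l ?mulr_ge0 ?exprn_ge0 ?(ltW H0) // ler_pdivrMr //.
apply: (@le_trans _ _ (16^-1 ^+ i * 16^-1 ^+ i)); last first.
  by rewrite ler_wpM2l ?delta_lb // exprn_ge0 // invr_ge0.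
rewrite -exprMn lerXn2r ?nnegrE ?invr_ge0 ?mulr_ge0 ?invr_ge0 ?(ltW H0) //.
rewrite -invfM lef_pV2 ?posrE; lra.
Qed.

(** By the martingale property an event of the past may be weighed with the
    density of its own time. *)
Lemma expect_density z g j k w : (j <= k)%N -> good z k ->
  adapted (Ns J0) (Ns (J0 + j)) g ->
  expect k (fun w => g w * density z k w) w = expect j (fun w => g w * density z j w) w.
Proof.
move=> jk gz gA; move: gz; rewrite -(subnKC jk); elim: (k - j)%N => [|n IH] gz.
  by rewrite addn0.
rewrite addnS in gz *; rewrite expectS -IH; last exact: goodS.
apply: avg_eq => w' _.
rewrite (@avg_pull _ _ _ _ _ (g w')); last first.
  move=> w'' hw; apply: gA => m /andP[m1 m2]; rewrite hw //.
  rewrite negb_and -ltnNge (leq_trans m2) // Ns_mono // addnA leq_addr //.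
by rewrite density_martingale.
Qed.

(** During one stage the density is multiplied by 11 at most, and the factor 33 is
    11 times the 3 of [overrun_prob]. *)
Lemma expect_overrun z j k w : (j < k)%N -> good z k ->
  expect k (fun w => (overrun z (J0 + j) w)%:R * density z k w) w <=
  33 * H ^+ b * 16^-1 ^+ (J0 + j).
Proof.
move=> jk gz.
have gj : good z j.+1 by have [z1 iso] := gz; split=> // i ij; apply: iso; apply: leq_trans jk.
rewrite (expect_density _ jk gz); last first.
  move=> w1 w2 hw; congr (nat_of_bool _)%:R; apply: overrun_adapted => n /andP[n1 n2].
  apply: hw; rewrite addnS n2 andbT; apply: leq_trans n1; exact: Ns_mono (leq_addr _ _).
rewrite expectS.
apply: (@le_trans _ _ (expect j (fun w => 1 * density z j w) w * (33 * H ^+ b * 16^-1 ^+ (J0 + j)))).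
  rewrite /expect mulrC -avgZ; apply: avg_le => w' _.
  apply: (@le_trans _ _ (avg (Ns (J0 + j)) (len (J0 + j))
      (fun w => (11 * density z j w') * (overrun z (J0 + j) w)%:R) w')).
    apply: avg_le => w'' hw''; rewrite -(density_off z hw'') mulrC ler_wpM2r //=.
    have /andP[r0 r1] := density_bounds w'' (goodS gj).
    have [->|rn0] := eqVneq (density z j w'') 0; first by rewrite mul0r mulr0.
    have p := density_survival gj rn0; have /andP[c0 c1] := confine_01 z j w''.
    have p0 : 0 < survival z j w'' by lra.
    by rewrite mulrC ler_wpM2r // ler_pdivrMr //; lra.
  rewrite avgZ; have := overrun_prob w' gz.1 (leq_addr j J0).
  have /andP[r0 _] := density_bounds w' (goodS gj).
  move: (avg _ _ _ _) (density z j w') r0 => x d r0 hx.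
  apply: (@le_trans _ _ (11 * d * (3 * H ^+ b * 16^-1 ^+ (J0 + j)))).
    by rewrite ler_wpM2l // mulr_ge0.
  rewrite le_eqVlt; apply/orP; left; apply/eqP; ring.
rewrite (@expect_density z (fun=> 1) 0 j) //; last exact: goodS.
by rewrite /expect addn0 subnn /= mulr1 mul1r.
Qed.

Definition clean z k w : bool :=
  all (fun j => ~~ overrun z (J0 + j) w) (iota 0 k).

Lemma density_neq0 z j k w : (j <= k)%N -> density z k w != 0 -> density z j w != 0.
Proof.
move=> jk; rewrite -(subnKC jk); elim: (k - j)%N => [|n IH]; first by rewrite addn0.
by rewrite addnS /= mulf_eq0 negb_or => /andP[/IH].
Qed.

Lemma confined_state z j k w : (j < k)%N -> density z k w != 0 ->
  nm (state z j w) <= delta (J0 + j) /\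
  nm (state z j w + stage_sum (J0 + j) z w) <= delta (J0 + j).
Proof.
move=> jk dk; have d0 := delta_gt0 (J0 + j); have u0 := slack_gt0 (J0 + j).
have ud := slack_delta (J0 + j); have u1 := slack_gt0 (J0 + j).+1.
have uS := slackS (J0 + j).
split; (apply: nm_le; first exact: ltW).
  apply: (le_trans (state_bound (density_neq0 (ltnW jk) dk))).
  by rewrite lerXn2r ?nnegrE; lra.
have := density_neq0 jk dk; rewrite /= mulf_eq0 negb_or => /andP[_].
rewrite mulf_eq0 negb_or => /andP[nz _]; have [c1 _] := confine_neq0 nz.
apply: (le_trans (ltW c1)); rewrite lerXn2r ?nnegrE; lra.
Qed.

(** Each index is reached by a run of whole pieces and a part of one piece. *)
Lemma confined_stage z j k w n : (j < k)%N -> density z k w != 0 -> clean z k w ->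
  (Ns (J0 + j) <= n <= Ns (J0 + j).+1)%N ->
  nm (wsum (terms z) w (Ns (J0 + j)) n) <= 2 * delta (J0 + j).
Proof.
move=> jk dk /allP cl; set i := (J0 + j)%N => /andP[n1 n2].
have d0 := delta_gt0 i.
have := density_neq0 jk dk; rewrite /= mulf_eq0 negb_or => /andP[_].
rewrite mulf_eq0 negb_or => /andP[nz _]; have [_ c2] := confine_neq0 nz.
have c3 l : (l < pieces i)%N -> nm (wsum (terms z) w (Ns i) (pend i l)) <= delta i.
  by move=> lp; apply: nm_le; [exact: ltW|exact/ltW/c2].
move: n2; rewrite leq_eqVlt => /orP[/eqP ->|n2].
  have := c3 (pieces i).-1; rewrite pend_last prednK ?pieces_gt0 // => /(_ (leqnn _)).
  lra.
have lp : (pc i n < pieces i)%N by apply: pc_lt; rewrite n1 Ns_len.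
set l := pc i n in lp.
have ln : (Ns i + l * piece i <= n <= Ns i + l * piece i + piece i)%N.
  have := divn_eq (n - Ns i) (piece i); have := ltn_mod (n - Ns i) (piece i).
  rewrite piece_gt0 -/(pc i n) -/l; move: n1.
  move: ((n - Ns i) %% piece i)%N (l * piece i)%N => r x; clear; lia.
have st : nm (wsum (terms z) w (Ns i) (Ns i + l * piece i)) <= delta i.
  case: l lp {ln} => [|l] lp; last exact: c3 (ltnW lp).
  by rewrite mul0n addn0 wsum_geq // nm0 ltW.
have := cl j; rewrite mem_iota => /(_ jk); rewrite -/i => /hasPn /(_ l).
rewrite mem_iota => /(_ lp) nex.
have pr : nm (wsum (terms z) w (Ns i + l * piece i) n) <= delta i.
  by apply: nm_le; [exact: ltW|exact/ltW/(exceedsPn nex)].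
rewrite (@wsum_cat _ _ _ _ (Ns i + l * piece i)%N).
  by apply: (le_trans (nmD _ _)); lra.
by rewrite leq_addr; case/andP: ln.
Qed.

(** The centres of successive epochs are close since the radii decrease at least
    geometrically from one epoch to the next. *)
Lemma confined z j k w n : (j < k)%N -> density z k w != 0 -> clean z k w ->
  (Ns (J0 + j) <= n <= Ns (J0 + k))%N ->
  nm (wsum (terms z) w (Ns (J0 + j)) n) <= 6 * delta (J0 + j).
Proof.
move=> jk dk cl.
pose centre j := wsum (terms z) w (Ns J0) (Ns (J0 + j)) - state z j w.
have cS j' : (j' < k)%N ->
    nm (centre j'.+1 - centre j') <= 2 * delta (J0 + j') - 2 * delta (J0 + j'.+1).
  move=> j'k; have [h1 h2] := confined_state j'k dk.
  have cat : wsum (terms z) w (Ns J0) (Ns (J0 + j'.+1)) =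
      wsum (terms z) w (Ns J0) (Ns (J0 + j')) + stage_sum (J0 + j') z w.
    by rewrite addnS; apply: wsum_cat; rewrite !Ns_mono ?leq_addr.
  rewrite /centre cat /=; case: eqP => [ee|/eqP ee].
    rewrite /delta ee; set d := _ - _; have -> : d = 0 by rewrite /d; ring.
    by rewrite nm0 subrr.
  have -> : wsum (terms z) w (Ns J0) (Ns (J0 + j')) + stage_sum (J0 + j') z w - 0 -
     (wsum (terms z) w (Ns J0) (Ns (J0 + j')) - state z j' w) =
     state z j' w + stage_sum (J0 + j') z w by ring.
  apply: (le_trans h2).
  have : delta (J0 + j'.+1) <= 2^-1 * delta (J0 + j').
    rewrite /delta -exprS; apply: ler_wiXn2l; rewrite ?invr_ge0 ?invf_le1 ?ler1n //.
    by rewrite ltn_neqAle eq_sym ee e_mono // leq_add2l.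
  lra.
have cc j' : (j <= j' <= k)%N ->
    nm (centre j' - centre j) <= 2 * delta (J0 + j) - 2 * delta (J0 + j').
  move=> /andP[jj']; rewrite -(subnKC jj'); elim: (j' - j)%N => [|m IH] mk.
    by rewrite addn0 !subrr nm0.
  rewrite addnS in mk *; rewrite -(subrKA (centre (j + m)%N)).
  apply: (le_trans (nmD _ _)); have := cS _ mk; have := IH (ltnW mk); lra.
move=> /andP[n1 n2].
have [j' /andP[jj' j'k] /andP[n3 n4]] : exists2 j', (j <= j' < k)%N &
    (Ns (J0 + j') <= n <= Ns (J0 + j').+1)%N.
  have [m mk] : exists2 m, (m <= k)%N & (Ns (J0 + m) <= n)%N /\
      forall m', (m' <= k)%N -> (Ns (J0 + m') <= n)%N -> (m' <= m)%N.
    have ex : exists m, (m <= k)%N && (Ns (J0 + m) <= n)%N by exists j; rewrite (ltnW jk).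
    have ub m : (m <= k)%N && (Ns (J0 + m) <= n)%N -> (m <= k)%N by case/andP.
    case: (ex_maxnP ex ub) => m /andP[mk mn] mmax; exists m => //; split=> // m' h1 h2.
    by apply: mmax; rewrite h1.
  move=> [mn mmax]; have jm := mmax j (ltnW jk) n1.
  move: mk; rewrite leq_eqVlt => /orP[/eqP mk|mk].
    exists k.-1; first by move: jk; clear; lia.
    rewrite -addnS prednK ?(leq_ltn_trans _ jk) // n2 andbT.
    by apply: leq_trans mn; rewrite Ns_mono // mk leq_add2l leq_pred.
  exists m; first by rewrite jm.
  rewrite mn -addnS ltnW // ltnNge; apply/negP => /(mmax _ mk).
  by rewrite ltnn.
have [h1 _] := confined_state j'k dk.
have [h3 _] := confined_state jk dk.
have h2 := confined_stage j'k dk cl (introT andP (conj n3 n4)).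
have h4 : (j <= j' <= k)%N by rewrite jj' ltnW.
have {}h4 := cc _ h4.
have d1 := delta_mono (_ : J0 + j <= J0 + j')%N; rewrite leq_add2l in d1.
have {}d1 := d1 jj'; have d2 := delta_gt0 (J0 + j').
have -> : wsum (terms z) w (Ns (J0 + j)) n =
    (centre j' - centre j) + (state z j' w + (- state z j w +
      wsum (terms z) w (Ns (J0 + j')) n)).
  rewrite (@wsum_cat _ _ _ _ (Ns (J0 + j')) n); last by rewrite n3 Ns_mono ?leq_add2l.
  rewrite /centre (@wsum_cat _ _ _ (Ns J0) (Ns (J0 + j)) (Ns (J0 + j'))).
    ring.
  by rewrite !Ns_mono ?leq_add2l ?leq_addr.
apply: (le_trans (nmD _ _)); have := nmD (state z j' w) (- state z j w + wsum (terms z) w (Ns (J0 + j')) n).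
have := nmD (- state z j w) (wsum (terms z) w (Ns (J0 + j')) n).
by rewrite nmN; lra.
Qed.

(** * Energy *)

(** The points of the grid whose angles lie in the [l]-th interval of length
    [s / M]. *)
Definition restrict (chi : nat -> R) (s l q : nat) : R := chi q * ((q %/ s == l)%N)%:R.

(** Energy of exponent [1 - 2 / (b - 21)] at the scales [h ^ (- (b - 21) * i)] of
    the first [k] stages. *)
Definition energy M (f : (nat -> R) -> R) (chi : nat -> R) k : R :=
  \sum_(0 <= j < k) H ^+ ((b - 23) * (J0 + j)) *
    \sum_(0 <= l < (h ^ ((b - 21) * (J0 + j)))%N)
      f (restrict chi (M %/ h ^ ((b - 21) * (J0 + j)))%N l) ^+ 2.

Lemma restrict_weight M chi k s l : weight M chi k -> weight M (restrict chi s l) k.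
Proof.
move=> wc q qM; have [/andP[c0 c1] gq] := wc q qM; rewrite /restrict.
case: eqP => _; last by rewrite mulr0 lexx ler01 eqxx.
by rewrite mulr1 c0 c1.
Qed.

Lemma restrict_sum M (chi : nat -> R) s p : (s * p = M)%N -> (0 < s)%N ->
  \sum_(0 <= l < p) \sum_(0 <= q < M) restrict chi s l q = \sum_(0 <= q < M) chi q.
Proof.
move=> sp s0; rewrite exchange_big /=; apply: eq_big_nat => q /andP[_ qM].
rewrite (bigD1_seq (q %/ s)%N) ?iota_uniq ?mem_index_iota //=; last first.
  by rewrite ltn_divLR // mulnC sp.
rewrite /restrict eqxx mulr1 big1 ?addr0 // => l /negbTE; rewrite eq_sym => ->.
by rewrite mulr0.
Qed.

Lemma restrict_le M (chi : nat -> R) s p l : (s * p = M)%N -> (0 < s)%N -> (l < p)%N ->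
  (forall q, (q < M)%N -> chi q <= 1) -> \sum_(0 <= q < M) restrict chi s l q <= s%:R.
Proof.
move=> sp s0 lp c1.
have h1 : (l * s + s <= M)%N by rewrite addnC -mulSn -sp mulnC leq_mul2l lp orbT.
apply: (@le_trans _ _ (\sum_(0 <= q < M) ((q %/ s == l)%N)%:R)).
  rewrite !big_nat; apply: ler_sum => q /andP[_ qM].
  by rewrite /restrict ler_piMl // c1.
rewrite (big_cat_nat (n := (l * s)%N)) //=; last by apply: leq_trans h1; apply: leq_addr.
rewrite (big_cat_nat (n := (l * s + s)%N) (m := (l * s)%N)) ?leq_addr //=.
rewrite [X in X + _]big_nat [X in X + _]big1 ?add0r; last first.
  by move=> q /andP[_ ql]; rewrite ltn_eqF // ltn_divLR.
rewrite [X in _ + X]big_nat [X in _ + X]big1 ?addr0; last first.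
  by move=> q /andP[ql _]; rewrite gtn_eqF // leq_divRL // mulSn addnC.
apply: (@le_trans _ _ (\sum_(l * s <= q < (l * s + s)%N) 1)).
  by apply: ler_sum => q _; rewrite -[leRHS]/(true%:R) ler_nat leq_b1.
by rewrite sumr_const_nat addKn.
Qed.

(** The mass of a cell of length [h ^ (- (b - 21) * i)] has a squared mean and a
    variance that are both bounded by the square of the number of its points, up to
    constants and a factor [121 ^ j] that the difference between the exponents [b - 23] and
    [b - 21] absorbs. *)
Lemma expect_energy M chi k w : weight M chi k -> (0 < M)%N ->
  (forall j, (j < k)%N -> (len (J0 + j) <= M)%N) ->
  (forall j, (j < k)%N -> (h ^ ((b - 21) * (J0 + j)) %| M)%N) ->
  expect k (fun w => energy M (fun chi => mass M chi k w) chi k) w <=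
  H ^+ (5 * b + 11) * M%:R ^+ 2.
Proof.
move=> wc M0 lM dM; have H2 := H256; have H0 := H_gt0.
set K := H ^+ (5 * b + 11).
have K1 : 1 <= K := HX_ge1 _.
have MR : 0 < M%:R :> R by rewrite ltr0n.
rewrite /expect avg_sum.
have term j : (j < k)%N ->
    avg (Ns J0) (Ns (J0 + k) - Ns J0) (fun w => H ^+ ((b - 23) * (J0 + j)) *
      \sum_(0 <= l < (h ^ ((b - 21) * (J0 + j)))%N)
       mass M (restrict chi (M %/ h ^ ((b - 21) * (J0 + j)))%N l) k w ^+ 2) w <=
    (3 * K * M%:R ^+ 2) * H^-1 ^+ (J0 + j).
  move=> jk; have := dM j jk; set i := (J0 + j)%N; set p := (h ^ _)%N => pM.
  set s := (M %/ p)%N; have sp : (s * p = M)%N by rewrite divnK.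
  have s0 : (0 < s)%N by move: M0; rewrite -sp muln_gt0 => /andP[].
  rewrite avgZ avg_sum.
  have c1 q : (q < M)%N -> chi q <= 1 by move=> qM; have [/andP[]] := wc q qM.
  have c0 q : (q < M)%N -> 0 <= chi q by move=> qM; have [/andP[]] := wc q qM.
  pose S l := \sum_(0 <= q < M) restrict chi s l q.
  have S0 l : 0 <= S l.
    rewrite /S big_nat; apply: sumr_ge0 => q /andP[_ qM].
    by rewrite /restrict mulr_ge0 ?ler0n ?c0.
  have hl l : (l < p)%N ->
      avg (Ns J0) (Ns (J0 + k) - Ns J0) (fun w => mass M (restrict chi s l) k w ^+ 2) w <=
      (121 ^+ j * s%:R + 2 * fluctuation i * M%:R) * S l.
    move=> lp; have := mass_second_moment w (ltnW jk) (restrict_weight s l wc) lM.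
    move/le_trans; apply; rewrite -/(S l) [leRHS]mulrDl; apply: lerD; last by rewrite mulrA.
    have e121 : (11 ^+ j) ^+ 2 = 121 ^+ j :> R.
      by rewrite -exprM mulnC exprM; congr (_ ^+ _); rewrite -natrX.
    rewrite exprMn e121 [S l ^+ 2]expr2 mulrA.
    rewrite ler_wpM2r // ler_wpM2l ?exprn_ge0 //.
    exact: (restrict_le sp s0 lp c1).
  have sum : \sum_(0 <= l < p) avg (Ns J0) (Ns (J0 + k) - Ns J0)
      (fun w => mass M (restrict chi s l) k w ^+ 2) w <=
      (121 ^+ j * s%:R + 2 * fluctuation i * M%:R) * M%:R.
    apply: (@le_trans _ _ (\sum_(0 <= l < p) (121 ^+ j * s%:R + 2 * fluctuation i * M%:R) * S l)).
      by rewrite !big_nat; apply: ler_sum => l /andP[_ lp]; apply: hl.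
    rewrite -mulr_sumr restrict_sum //; apply: ler_wpM2l.
      apply: addr_ge0; first by rewrite mulr_ge0 // exprn_ge0.
      by apply: mulr_ge0 => //; apply: mulr_ge0 => //; exact: fluctuation_ge0.
    apply: (@le_trans _ _ (\sum_(0 <= q < M) 1)).
      by rewrite !big_nat; apply: ler_sum => q /andP[_]; apply: c1.
    by rewrite sumr_const_nat subn0.
  apply: (le_trans (ler_wpM2l (exprn_ge0 _ (ltW H0)) sum)).
  have pR : p%:R = H ^+ ((b - 21) * i) :> R by rewrite natrX.
  have p0 : 0 < p%:R :> R by rewrite pR exprn_gt0.
  have sR : s%:R = M%:R / p%:R :> R by rewrite -sp natrM mulfK // gt_eqF.
  rewrite fluctuationE -/K -pR sR.
  have -> : H ^+ ((b - 23) * i) = p%:R * H^-1 ^+ i * H^-1 ^+ i.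
    have -> : p%:R = H ^+ ((b - 23) * i) * (H ^+ i * H ^+ i).
      rewrite pR -!exprD; congr (_ ^+ _).
      by rewrite addnn -mul2n -mulnDl; congr (_ * _)%N; move: b22; clear; lia.
    by rewrite exprVn; field; rewrite expf_neq0 // lt0r_neq0.
  have h121 : 121 ^+ j <= H ^+ i.
    apply: (@le_trans _ _ (H ^+ j)); last by apply: HX_mono; rewrite leq_addl.
    by rewrite lerXn2r ?nnegrE ?(ltW H0) //; lra.
  have -> : p%:R * H^-1 ^+ i * H^-1 ^+ i * ((121 ^+ j * (M%:R / p%:R) + 2 * (K / p%:R) * M%:R) * M%:R)
    = (M%:R ^+ 2 * H^-1 ^+ i) * (H^-1 ^+ i * (121 ^+ j + 2 * K)).
    by field; rewrite gt_eqF.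
  have -> : 3 * K * M%:R ^+ 2 * H^-1 ^+ i = (M%:R ^+ 2 * H^-1 ^+ i) * (3 * K) by ring.
  rewrite ler_wpM2l ?mulr_ge0 ?sqr_ge0 ?exprn_ge0 ?invr_ge0 ?(ltW H0) //.
  rewrite exprVn mulrC ler_pdivrMr ?exprn_gt0 //.
  move: (H ^+ i) (HX_ge1 i) h121 => X X1 h121.
  have g1 : 0 <= (K - 1) * X by rewrite mulr_ge0 //; lra.
  have g2 : 0 <= K * (X - 1) by rewrite mulr_ge0 //; lra.
  lra.
apply: (@le_trans _ _ (\sum_(0 <= j < k) (3 * K * M%:R ^+ 2) * H^-1 ^+ (J0 + j))).
  by rewrite !big_nat; apply: ler_sum => j /andP[_ jk]; apply: term.
rewrite -mulr_sumr.
have geo : \sum_(0 <= j < k) H^-1 ^+ (J0 + j) <= 2 * H^-1 ^+ (J0 + 0).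
  have hv : 0 <= H^-1 <= 1 / 2.
    by rewrite invr_ge0 (ltW H0) /= -[leRHS]invrK lef_pV2 ?posrE ?invr_gt0 //; lra.
  apply: (@geometric_sum H^-1 (fun j => H^-1 ^+ (J0 + j))) => // j.
    by rewrite exprn_ge0 // invr_ge0 ltW.
  by rewrite addnS exprS.
have h1 : H^-1 ^+ (J0 + 0) <= 1 / 6.
  rewrite addn0; apply: (@le_trans _ _ (H^-1 ^+ 1)).
    by apply: ler_wiXn2l; rewrite ?invr_ge0 ?(ltW H0) // invf_le1 //; lra.
  by rewrite expr1 div1r lef_pV2 ?posrE //; lra.
have X0 : 0 <= K * M%:R ^+ 2 by rewrite mulr_ge0 ?sqr_ge0 //; lra.
apply: (@le_trans _ _ (3 * K * M%:R ^+ 2 * (1 / 3))); last by lra.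
by rewrite ler_wpM2l //; lra.
Qed.

(** The overruns are not part of the density, which must be smooth: the points
    where they occur are removed afterwards. *)
Definition cmass M (chi : nat -> R) k w : R :=
  \sum_(0 <= q < M) chi q * (density (grid M q) k w * (clean (grid M q) k w)%:R).

Lemma cmass_bounds M chi k w : weight M chi k -> 0 <= cmass M chi k w <= mass M chi k w.
Proof.
move=> wc; rewrite /cmass /mass !big_nat.
have hq q : (q < M)%N ->
    0 <= chi q * (density (grid M q) k w * (clean (grid M q) k w)%:R) <=
         chi q * density (grid M q) k w.
  move=> qM; have [/andP[c0 c1]] := wc q qM; case: eqVneq => [->|_ /(_ isT) gq].
    by rewrite !mul0r lexx.
  have /andP[r0 r1] := density_bounds w gq.
  by case: (clean _ _ _); rewrite ?mulr1 ?mulr0 ?lexx ?andbT mulr_ge0.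
apply/andP; split.
  by apply: sumr_ge0 => q /andP[_ qM]; have /andP[] := hq q qM.
by apply: ler_sum => q /andP[_ qM]; have /andP[] := hq q qM.
Qed.

Lemma energy_cmass M chi k w : weight M chi k ->
  energy M (fun chi => cmass M chi k w) chi k <= energy M (fun chi => mass M chi k w) chi k.
Proof.
move=> wc; apply: ler_sum => j _; rewrite ler_wpM2l ?exprn_ge0 ?(ltW H_gt0) //.
apply: ler_sum => l _; have /andP[m0 m1] := cmass_bounds w (restrict_weight
  (M %/ h ^ ((b - 21) * (J0 + j)))%N l wc).
by rewrite lerXn2r ?nnegrE ?(le_trans m0).
Qed.

Lemma expect_cmass M chi k w : weight M chi k ->
  expect k (fun w => mass M chi k w - cmass M chi k w) w <=
  66 * H ^+ b * 16^-1 ^+ J0 * \sum_(0 <= q < M) chi q.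
Proof.
move=> wc.
have -> : expect k (fun w => mass M chi k w - cmass M chi k w) w =
    expect k (fun w => \sum_(0 <= q < M) chi q * (density (grid M q) k w *
      (~~ clean (grid M q) k w)%:R)) w.
  apply: avg_eq => w' _; rewrite /mass /cmass -sumrB; apply: eq_bigr => q _.
  by case: (clean _ _ _); rewrite /= ?mulr1 ?mulr0 ?subrr ?subr0.
rewrite /expect avg_sum mulr_sumr !big_nat; apply: ler_sum => q /andP[_ qM].
rewrite avgZ; have [/andP[c0 c1]] := wc q qM.
case: eqVneq => [->|_ /(_ isT) gq]; first by rewrite mul0r mulr0.
rewrite mulrC ler_wpM2r //.
apply: (@le_trans _ _ (expect k (fun w => \sum_(0 <= j < k)
   (overrun (grid M q) (J0 + j) w)%:R * density (grid M q) k w) w)).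
  apply: expect_le => w'; have /andP[r0 _] := density_bounds w' gq.
  have s0 : 0 <= \sum_(0 <= j < k) (overrun (grid M q) (J0 + j) w')%:R * density (grid M q) k w'.
    by apply: sumr_ge0 => j _; rewrite mulr_ge0 ?ler0n.
  case: (boolP (clean _ _ _)) => cl; rewrite /= ?mulr0 // mulr1.
  move: cl => /allPn[j]; rewrite mem_iota => jk; rewrite negbK => oj.
  rewrite (bigD1_seq j) ?iota_uniq ?mem_index_iota //= oj mul1r lerDl.
  by apply: sumr_ge0 => l _; rewrite mulr_ge0 ?ler0n.
rewrite /expect avg_sum.
apply: (@le_trans _ _ (\sum_(0 <= j < k) 33 * H ^+ b * 16^-1 ^+ (J0 + j))).
  by rewrite !big_nat; apply: ler_sum => j /andP[_ jk]; apply: expect_overrun.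
have geo : \sum_(0 <= j < k) 16^-1 ^+ (J0 + j) <= 2 * 16^-1 ^+ (J0 + 0) :> R.
  apply: (@geometric_sum 16^-1 (fun j => 16^-1 ^+ (J0 + j))) => [|j|j].
  - by apply/andP; split; lra.
  - by rewrite exprn_ge0 // invr_ge0.
  - by rewrite addnS exprS.
rewrite -mulr_sumr; rewrite addn0 in geo.
have -> : 66 * H ^+ b * 16^-1 ^+ J0 = 33 * H ^+ b * (2 * 16^-1 ^+ J0) by ring.
by rewrite ler_wpM2l // mulr_ge0 // exprn_ge0 // ltW // H_gt0.
Qed.

(** A discrete form of Frostman's condition of finite energy, at the resolution of
    the grid. *)
Definition spread M (chi : nat -> R) (C : R) k w : bool :=
  ((\sum_(0 <= q < M) chi q) / 4 <= cmass M chi k w) &&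
  (energy M (fun chi => cmass M chi k w) chi k <= C * M%:R ^+ 2).

Lemma cmass_adapted M chi k : adapted (Ns J0) (Ns (J0 + k)) (cmass M chi k).
Proof.
move=> w w' hw; apply: eq_bigr => q _; rewrite (density_adapted _ hw).
congr (_ * (_ * (nat_of_bool _)%:R)); apply: eq_in_all => j; rewrite mem_iota => jk.
congr negb; apply: overrun_adapted => n /andP[n1 n2]; apply: hw.
rewrite (leq_trans _ n1) ?Ns_mono ?leq_addr //= (leq_trans n2) // -addnS.
by rewrite Ns_mono // leq_add2l.
Qed.

Lemma spread_adapted M chi C k : adapted (Ns J0) (Ns (J0 + k)) (spread M chi C k).
Proof.
move=> w w' hw; rewrite /spread (cmass_adapted M chi hw); congr (_ && (_ <= _)).
apply: eq_bigr => j _; congr (_ * _); apply: eq_bigr => l _.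
by rewrite (cmass_adapted _ _ hw).
Qed.

(** Chebyshev's inequality for the mass, and Markov's inequality for the mass
    removed by overruns and for the energy. *)
Lemma spread_prob M chi (C : R) k w : weight M chi k -> (0 < M)%N -> 0 < C ->
  M%:R / 8 <= \sum_(0 <= q < M) chi q ->
  (forall j, (j < k)%N -> (len (J0 + j) <= M)%N) ->
  (forall j, (j < k)%N -> (h ^ ((b - 21) * (J0 + j)) %| M)%N) ->
  expect k (fun w => (~~ spread M chi C k w)%:R) w <=
  64 * fluctuation J0 + 264 * H ^+ b * 16^-1 ^+ J0 + H ^+ (5 * b + 11) / C.
Proof.
move=> wc M0 C0 SM lM dM; set S := \sum_(_ <= _ < _) _ in SM *.
have MR : 0 < M%:R :> R by rewrite ltr0n.
have S0 : 0 < S by lra.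
have CM : 0 < C * M%:R ^+ 2 by rewrite mulr_gt0 // exprn_gt0.
have e2 := mass_second_moment w (leq0n k) wc lM.
have e1 := mass_mean w wc; rewrite -/S in e1.
have e3 := expect_cmass w wc.
have e4 := expect_energy w wc M0 lM dM.
rewrite expr0 mul1r addn0 -/S in e2; rewrite -/S in e3.
pose q1 w := mass M chi k w; pose q2 w := mass M chi k w - cmass M chi k w.
pose q3 w := energy M (fun chi => mass M chi k w) chi k.
apply: (@le_trans _ _ (expect k (fun w => (4 / S ^+ 2) * q1 w ^+ 2 + ((- 8 / S) * q1 w + (4 +
   ((4 / S) * q2 w + (C * M%:R ^+ 2)^-1 * q3 w)))) w)).
  apply: expect_le => w'; rewrite /spread -/S.
  have /andP[m0 m1] := cmass_bounds w' wc.
  have en := energy_cmass w' wc.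
  have en0 : 0 <= energy M (fun chi => cmass M chi k w') chi k.
    apply: sumr_ge0 => j _; rewrite mulr_ge0 ?exprn_ge0 ?(ltW H_gt0) //.
    by apply: sumr_ge0 => l _; apply: sqr_ge0.
  have -> : 4 / S ^+ 2 * q1 w' ^+ 2 + (- 8 / S * q1 w' + (4 +
     (4 / S * q2 w' + (C * M%:R ^+ 2)^-1 * q3 w'))) =
    4 * ((q1 w' - S) / S) ^+ 2 + 4 * (q2 w' / S) + q3 w' / (C * M%:R ^+ 2).
    by field; rewrite gt_eqF //= gt_eqF // gt_eqF.
  have t1 := sqr_ge0 ((q1 w' - S) / S).
  have t2 : 0 <= q2 w' / S by rewrite divr_ge0 ?(ltW S0) // subr_ge0.
  have t3 : 0 <= q3 w' / (C * M%:R ^+ 2) by rewrite divr_ge0 ?(ltW CM) // (le_trans en0).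
  case: (leP (S / 4) (cmass M chi k w')) => hc; last first.
    rewrite /=; case: (leP (S / 2) (q1 w')) => hq.
      have : 1 / 4 <= q2 w' / S by rewrite ler_pdivlMr // /q2 -/(q1 w'); lra.
      by rewrite -[true%:R]/(1 : R); lra.
    have hx : (q1 w' - S) / S <= - (1 / 2) by rewrite ler_pdivrMr //; lra.
    rewrite -[true%:R]/(1 : R).
    have : 1 / 4 <= ((q1 w' - S) / S) ^+ 2 by nra.
    lra.
  case: (leP (energy M (fun chi => cmass M chi k w') chi k) (C * M%:R ^+ 2)) => he /=; first by rewrite ?mulr0n; lra.
  have : 1 <= q3 w' / (C * M%:R ^+ 2).
    by rewrite ler_pdivlMr // mul1r; apply: le_trans en; apply: ltW.
  rewrite ?mulr1n; lra.
have lin (c1 c2 c3 c4 c5 : R) (f1 f2 f3 f4 : signs -> R) :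
    expect k (fun w => c1 * f1 w + (c2 * f2 w + (c3 + (c4 * f3 w + c5 * f4 w)))) w =
    c1 * expect k f1 w + (c2 * expect k f2 w + (c3 + (c4 * expect k f3 w +
      c5 * expect k f4 w))).
  by rewrite /expect !avgD !avgZ avg_cst.
rewrite (lin _ _ _ _ _ (fun w => q1 w ^+ 2) q1 q2 q3).
have -> : expect k q1 w = S := e1.
have f1 : 4 / S ^+ 2 * expect k (fun w => q1 w ^+ 2) w <=
    4 / S ^+ 2 * (S ^+ 2 + 2 * fluctuation J0 * (M%:R * S)).
  by rewrite ler_wpM2l ?divr_ge0 ?sqr_ge0.
have f2 : 4 / S * expect k q2 w <= 4 / S * (66 * H ^+ b * 16^-1 ^+ J0 * S).
  by rewrite ler_wpM2l ?divr_ge0 ?(ltW S0).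
have f3 : (C * M%:R ^+ 2)^-1 * expect k q3 w <=
    (C * M%:R ^+ 2)^-1 * (H ^+ (5 * b + 11) * M%:R ^+ 2).
  by rewrite ler_wpM2l ?invr_ge0 ?(ltW CM).
have g1 : 4 / S ^+ 2 * (S ^+ 2 + 2 * fluctuation J0 * (M%:R * S)) =
    4 + fluctuation J0 * (8 * (M%:R / S)) by field; rewrite gt_eqF.
have g2 : 4 / S * (66 * H ^+ b * 16^-1 ^+ J0 * S) = 264 * H ^+ b * 16^-1 ^+ J0.
  by field; rewrite gt_eqF.
have g3 : (C * M%:R ^+ 2)^-1 * (H ^+ (5 * b + 11) * M%:R ^+ 2) = H ^+ (5 * b + 11) / C.
  by field; rewrite gt_eqF //= gt_eqF.
have g4 : fluctuation J0 * (8 * (M%:R / S)) <= 64 * fluctuation J0.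
  rewrite mulrC ler_wpM2r ?fluctuation_ge0 //.
  have : M%:R / S <= 8 by rewrite ler_pdivrMr //; lra.
  lra.
have g5 : - 8 / S * S = - 8 by field; rewrite gt_eqF.
rewrite g5; rewrite g1 in f1; rewrite g2 in f2; rewrite g3 in f3.
move: f1 f2 f3 g4.
move: (expect k (fun w => q1 w ^+ 2) w) (expect k q2 w) (expect k q3 w) => x y t.
lra.
Qed.

(** On a quarter of the circle distances and differences of angles are
    comparable. *)
Definition isotropic_weight M k q : R :=
  ((4 * q < M)%N && `[< good (grid M q) k >])%:R.

Lemma isotropic_weightP M k : weight M (isotropic_weight M k) k.
Proof.
move=> q qM; rewrite /isotropic_weight ler0n lern1 leq_b1; split=> //.
by case: asboolP => //; rewrite andbF eqxx.
Qed.

(** By [sum_grid_sqr] and Markov's inequality, the anisotropic points of a stage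
    are a proportion of the grid that decreases geometrically with the stage. *)
Lemma isotropic_weight_sum M' k (M := (4 * M')%N) : (1 < J0)%N -> (2 * Ns (J0 + k) <= M)%N ->
  M%:R / 8 <= \sum_(0 <= q < M) isotropic_weight M k q.
Proof.
move=> J2 NM; have H2 := H256; have H0 := H_gt0.
have MR : 0 <= M%:R :> R by [].
pose bad i q : R := (~~ `[< isotropic i (grid M q) >])%:R.
have split q : (4 * q < M)%N%:R - \sum_(0 <= j < k) bad (J0 + j)%N q <= isotropic_weight M k q.
  rewrite /isotropic_weight; case: (_ < _)%N; rewrite /=; last first.
    by rewrite sub0r oppr_le0; apply: sumr_ge0 => j _; apply: ler0n.
  case: asboolP => [_|ng]; first by rewrite gerBl; apply: sumr_ge0 => j _; apply: ler0n.
  rewrite subr_le0.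
  have [j jk nj] : exists2 j, (j < k)%N & ~ isotropic (J0 + j) (grid M q).
    apply: contrapT => nex; apply: ng; split=> [|j jk]; first exact: sqn_expi.
    by apply: contrapT => nj; apply: nex; exists j.
  rewrite (bigD1_seq j) ?iota_uniq ?mem_index_iota //= /bad.
  by case: asboolP => // _; rewrite lerDl; apply: sumr_ge0 => l _; apply: ler0n.
have badS i : (J0 <= i < J0 + k)%N ->
    \sum_(0 <= q < M) bad i q <= M%:R * (H ^+ (b + 2) * H^-1 ^+ ((b - 4) * i)).
  move=> /andP[Ji ik]; have u0 := slack_gt0 i.
  have t0 : 0 < (slack i ^+ 2 / 40) ^+ 2 by rewrite exprn_gt0 // divr_gt0 // exprn_gt0.
  have hM : (2 * (Ns i + len i) <= M)%N.
    by rewrite Ns_len; apply: leq_trans NM; rewrite leq_mul2l Ns_mono.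
  have := sum_grid_sqr a hM; rewrite Ns_len => sE.
  have : (slack i ^+ 2 / 40) ^+ 2 * \sum_(0 <= q < M) bad i q <=
      M%:R * \sum_(Ns i <= n < Ns i.+1) sqn (a n) ^+ 2.
    rewrite -sE mulr_sumr; apply: ler_sum => q _; rewrite /bad.
    case: asboolP => /=; first by move=> _; rewrite mulr0 sqn_ge0.
    by move=> /negP; rewrite -ltNge mulr1 => /ltW.
  have : \sum_(Ns i <= n < Ns i.+1) sqn (a n) ^+ 2 <= (len i)%:R * (Ns i)%:R^-1 ^+ 2.
    apply: (@le_trans _ _ (\sum_(Ns i <= n < Ns i.+1) (Ns i)%:R^-1 ^+ 2)); last first.
      by rewrite sumr_const_nat -[leLHS]mulr_natl.
    rewrite !big_nat; apply: ler_sum => n /andP[n1 _].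
    rewrite lerXn2r ?nnegrE ?sqn_ge0 ?invr_ge0 ?ler0n //.
    by rewrite -[leRHS]mul1r ler_pdivlMr ?ltr0n ?Ns_gt0 // a_small.
  move=> h1 h2; rewrite -(ler_pM2l t0); apply: (le_trans h2).
  apply: (le_trans (ler_wpM2l MR h1)); rewrite [leRHS]mulrCA ler_wpM2l //.
  have lN : (len i)%:R <= H ^+ b * H ^+ (b * i).
    by rewrite -exprD -natrX ler_nat -[(b + _)%N]mulnS -/(Ns i.+1) leq_subr.
  apply: (@le_trans _ _ (H ^+ b * H ^+ (b * i) * (Ns i)%:R^-1 ^+ 2)).
    by rewrite ler_wpM2r ?sqr_ge0.
  have e4 : (b * i = 4 * i + (b - 4) * i)%N.
    by rewrite -mulnDl subnKC //; move: b22; clear; lia.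
  have -> : (slack i ^+ 2 / 40) ^+ 2 = (1 / 40) ^+ 2 * (H ^+ (4 * i))^-1.
    by rewrite mulnC exprM -slackV; field; rewrite gt_eqF.
  rewrite NsR e4 !(exprD H (4 * i)) (exprD H b) [H^-1 ^+ _]exprVn.
  have HH n : H ^+ n != 0 by rewrite expf_neq0 // gt_eqF.
  have -> : H ^+ b * (H ^+ (4 * i) * H ^+ ((b - 4) * i)) * (H ^+ (4 * i) * H ^+ ((b - 4) * i))^-1 ^+ 2
    = (H ^+ b * (H ^+ (4 * i))^-1 * (H ^+ ((b - 4) * i))^-1) * 1.
    by field; rewrite !HH.
  have -> : (1 / 40) ^+ 2 / H ^+ (4 * i) * (H ^+ b * H ^+ 2 / H ^+ ((b - 4) * i)) =
    (H ^+ b * (H ^+ (4 * i))^-1 * (H ^+ ((b - 4) * i))^-1) * (H / 40) ^+ 2.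
    by field; rewrite !HH.
  rewrite ler_wpM2l ?mulr_ge0 ?invr_ge0 ?exprn_ge0 ?(ltW H0) //.
  by apply: exprn_ege1; rewrite ler_pdivlMr //; lra.
have geo : \sum_(0 <= j < k) H^-1 ^+ ((b - 4) * (J0 + j)) <= 2 * H^-1 ^+ ((b - 4) * (J0 + 0)).
  have hv1 : H^-1 <= 1 / 2.
    by rewrite -[leRHS]invrK lef_pV2 ?posrE ?invr_gt0 //; lra.
  have hv0 : 0 <= H^-1 by rewrite invr_ge0 ltW.
  apply: (@geometric_sum (1 / 2) (fun j => H^-1 ^+ ((b - 4) * (J0 + j)))) => [|j|j].
  - by apply/andP; split; lra.
  - by rewrite exprn_ge0.
  - rewrite addnS mulnS exprD ler_wpM2r ?exprn_ge0 //.
    apply: (@le_trans _ _ (H^-1 ^+ 1)); last by rewrite expr1.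
    by apply: ler_wiXn2l => //; [lra|move: b22; clear; lia].
have small : H ^+ (b + 2) * (2 * H^-1 ^+ ((b - 4) * (J0 + 0))) <= 1 / 8.
  have e5 : ((b - 4) * (J0 + 0) = (b + 2) + (((b - 4) * J0 - (b + 3)) + 1))%N.
    by move: b22 J2; clear; nia.
  rewrite e5 exprVn (exprD H (b + 2)) (exprD H _ 1) expr1.
  have := HX_ge1 ((b - 4) * J0 - (b + 3)); have := HX_ge1 (b + 2).
  move: (H ^+ _) (H ^+ _) => X Y Y1 X1.
  have -> : Y * (2 / (Y * (X * H))) = 2 / (X * H).
    by field; rewrite !gt_eqF //; lra.
  have XH : H <= X * H by rewrite ler_peMl // ltW.
  by rewrite ler_pdivrMr; lra.
apply: (@le_trans _ _ (\sum_(0 <= q < M) (4 * q < M)%N%:R -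
    \sum_(0 <= j < k) \sum_(0 <= q < M) bad (J0 + j)%N q)); last first.
  by rewrite exchange_big -sumrB; apply: ler_sum => q _; apply: split.
have hsum : \sum_(0 <= j < k) \sum_(0 <= q < M) bad (J0 + j)%N q <= M%:R * (1 / 8).
  apply: (@le_trans _ _ (\sum_(0 <= j < k) M%:R * (H ^+ (b + 2) * H^-1 ^+ ((b - 4) * (J0 + j))))).
    rewrite !big_nat; apply: ler_sum => j /andP[_ jk].
    by apply: badS; rewrite leq_addr ltn_add2l.
  rewrite -mulr_sumr ler_wpM2l // -mulr_sumr; apply: le_trans small.
  by rewrite ler_wpM2l ?exprn_ge0 ?(ltW H0).
have hM' : \sum_(0 <= q < M) (4 * q < M)%N%:R = M'%:R :> R.
  rewrite (big_cat_nat (n := M')) //=; last by rewrite /M mulSn leq_addr.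
  rewrite [X in _ + X]big_nat [X in _ + X]big1 ?addr0; last first.
    by move=> q /andP[ql _]; rewrite /M ltn_mul2l /= ltnNge ql.
  rewrite (eq_big_nat _ _ (F2 := fun=> 1)).
    by rewrite sumr_const_nat subn0.
  by move=> q /andP[_ ql]; rewrite /M ltn_mul2l ql.
rewrite hM' /M natrM; rewrite /M natrM in hsum; lra.
Qed.
End Stages.

(** * The law of independent random signs *)

Section Transfer.
Context {R : realType} {d : measure_display} {T : measurableType d}.
Context (P : probability T R) (eps : nat -> {RV P >-> R}).
Context (heps : forall n, (0 < n)%N -> random_sign (eps n)).
Context (hind : mutually_independent [set n | (0 < n)%N] eps).

Definition signs_of (t : T) : signs := fun n => eps n t == 1.

(** The complement of 1 instead of the value -1: the two events of an index then
    partition the whole space, without a null set. *)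
Definition sign_event (s : signs) n : set R :=
  if s n then [set 1] else ~` [set 1].

Lemma sign_event_measurable s n : measurable (sign_event s n).
Proof. by rewrite /sign_event; case: ifP => _; [|apply: measurableC]; apply: measurable_set1. Qed.

Lemma sign_eventP s n t : (eps n @^-1` sign_event s n) t <-> signs_of t n = s n.
Proof.
rewrite /sign_event /signs_of /preimage /=; case: (s n) => /=.
  by split=> [->|/eqP //]; rewrite eqxx.
by split=> [h|/eqP h //]; apply/eqP.
Qed.

Lemma sign_event_prob s n : (0 < n)%N ->
  P (eps n @^-1` sign_event s n) = (2^-1)%:E.
Proof.
move=> n0; have [h1 _] := heps n0; rewrite /sign_event; case: (s n) => //.
rewrite -preimage_setC probability_setC; last first.
  by rewrite -[X in measurable X]setTI; apply: measurable_funP.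
by rewrite h1 -EFinB; congr (_%:E); lra.
Qed.

Definition cylinder lo m (s : signs) : set T :=
  [set t | forall n, (lo <= n < m)%N -> signs_of t n = s n].

Lemma cylinderE lo m s : cylinder lo m s =
  \bigcap_(n in [set` [fset n in index_iota lo m]%fset]) (eps n @^-1` sign_event s n).
Proof.
apply/seteqP; split=> t ht n /=.
  by rewrite !inE mem_index_iota => hn; apply/sign_eventP/ht.
by move=> hn; apply/sign_eventP/ht; rewrite /= !inE mem_index_iota.
Qed.

Lemma cylinder_measurable lo m s : measurable (cylinder lo m s).
Proof.
rewrite cylinderE; apply: fin_bigcap_measurable => // n _.
by rewrite -[X in measurable X]setTI; apply: measurable_funP => //; apply: sign_event_measurable.
Qed.

Lemma cylinder_prob lo m s : (0 < lo)%N ->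
  P (cylinder lo m s) = (2^-1 ^+ (m - lo))%:E.
Proof.
move=> lo0; rewrite cylinderE hind => [|n /=|n _]; last exact: sign_event_measurable.
  have pr (r : seq nat) : (forall n, n \in r -> (0 < n)%N) ->
      (\prod_(i <- r) P (eps i @^-1` sign_event s i))%E = (2^-1 ^+ size r)%:E.
    elim: r => [|n r IH] hr; first by rewrite big_nil.
    rewrite big_cons IH; last by move=> k kr; apply: hr; rewrite inE kr orbT.
    by rewrite sign_event_prob ?hr ?inE ?eqxx // -EFinM -exprS.
  rewrite pr => [|n]; last by rewrite !inE mem_index_iota => /andP[h _]; apply: leq_trans h.
  by rewrite card_fseq undup_id ?iota_uniq // size_iota.
by rewrite !inE mem_index_iota => /andP[h _]; apply: leq_trans h.
Qed.

Lemma cylinderS lo m s : (lo <= m)%N ->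
  cylinder lo m s = cylinder lo m.+1 (upd s m true) `|` cylinder lo m.+1 (upd s m false).
Proof.
move=> lm; apply/seteqP; split=> [t ht|t].
  have h : cylinder lo m.+1 (upd s m (signs_of t m)) t.
    move=> n /andP[n1]; rewrite ltnS leq_eqVlt /upd => /orP[/eqP ->|n2].
      by rewrite eqxx.
    by rewrite ltn_eqF // ht // n1.
  by case E : (signs_of t m) h => h; [left|right].
by move=> [] ht n /andP[n1 n2]; (rewrite ht; last by rewrite n1 ltnW); rewrite /upd ltn_eqF.
Qed.

(** Cylinders split into two cylinders of half the probability in the way [avg]
    splits into two terms; at the end of the interval [f] is constant on each
    cylinder. *)
Lemma sign_transfer lo hi (f : signs -> bool) s :
  (0 < lo)%N -> (lo <= hi)%N -> adapted lo hi f ->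
  measurable [set t | f (signs_of t)] /\
  (P [set t | f (signs_of t)] <= (avg lo (hi - lo) (fun s => (f s)%:R : R) s)%:E)%E.
Proof.
move=> lo0 lohi fA.
have key k m s' : (m + k = hi)%N -> (lo <= m)%N ->
    measurable (cylinder lo m s' `&` [set t | f (signs_of t)]) /\
    (P (cylinder lo m s' `&` [set t | f (signs_of t)]) <=
      (2^-1 ^+ (m - lo) * avg m k (fun s => (f s)%:R : R) s')%:E)%E.
  elim: k m s' => [|k IH] m s' mk lm.
    rewrite addn0 in mk; rewrite mk /=.
    have fE t : cylinder lo hi s' t -> f (signs_of t) = f s'.
      by move=> ht; apply: fA => n hn; apply: ht.
    case E : (f s'); last first.
      have -> : cylinder lo hi s' `&` [set t | f (signs_of t)] = set0.
        by apply/seteqP; split=> // t [/fE]; rewrite E /= => ->.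
      by rewrite measure0 mulr0; split.
    have -> : cylinder lo hi s' `&` [set t | f (signs_of t)] = cylinder lo hi s'.
      by apply/seteqP; split=> t; [case|move=> ht; split=> //=; rewrite fE].
    by rewrite mulr1 cylinder_prob //; split; [exact: cylinder_measurable|].
  rewrite cylinderS // setIUl.
  have mk' : (m.+1 + k = hi)%N by rewrite addSnnS.
  have [m1 p1] := IH m.+1 (upd s' m true) mk' (leqW lm).
  have [m2 p2] := IH m.+1 (upd s' m false) mk' (leqW lm).
  split; first exact: measurableU.
  apply: (le_trans (measureU2 _ m1 m2)); apply: (le_trans (leeD p1 p2)).
  rewrite -EFinD lee_fin /= /avg1 subSn // exprS.
  move: (avg _ _ _ _) (avg _ _ _ _) (_ ^+ _) => x y c; lra.
have c0 : cylinder lo lo s = setT.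
  by apply/seteqP; split=> // t _ n; lia.
have := key (hi - lo)%N lo s (subnKC lohi) (leqnn _).
by rewrite c0 setTI subnn expr0 mul1r.
Qed.

(** The intersections of the tails increase to [L], and each of them lies in one of
    the events. *)
Lemma liminf_prob (A : nat -> set T) (theta : R) :
  (forall k, measurable (A k)) -> (forall k, (P (A k) <= theta%:E)%E) ->
  let L := \bigcup_k0 \bigcap_(k in [set k | (k0 <= k)%N]) A k in
  measurable L /\ (P L <= theta%:E)%E.
Proof.
move=> mA pA L; pose F k0 := \bigcap_(k in [set k | (k0 <= k)%N]) A k.
have mF k0 : measurable (F k0) by apply: bigcap_measurable => //; exists k0 => /=.
have mL : measurable L by apply: bigcup_measurable => k _; apply: mF.
split=> //.
have cv : P (F k) @[k --> \oo] --> P L.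
  apply: nondecreasing_cvg_mu => // k l kl; apply/subsetPset => t ht n /= ln.
  by apply: ht => /=; apply: leq_trans ln.
rewrite -(cvg_lim _ cv) //; apply: lime_le; first by apply/cvg_ex; exists (P L).
apply: nearW => k; apply: le_trans (pA k); apply: le_measure; rewrite ?inE //.
by move=> t; apply; rewrite /=.
Qed.

Lemma signs_ae : {ae P, forall t n, (0 < n)%N -> eps n t = @sg R (signs_of t n)}.
Proof.
pose E n := eps n @^-1` (~` [set 1; -1]).
have mE n : measurable (E n).
  rewrite -[X in measurable X]setTI; apply: measurable_funP => //.
  by apply: measurableC; apply: measurableU; apply: measurable_set1.
have pE n : (0 < n)%N -> P (E n) = 0%E.
  move=> n0; have [h1 h2] := heps n0; rewrite /E -preimage_setC.
  rewrite probability_setC; last first.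
    rewrite -[X in measurable X]setTI; apply: measurable_funP => //.
    by apply: measurableU; apply: measurable_set1.
  rewrite preimage_setU measureU.
  - transitivity ((1 : R)%:E - ((2^-1 : R)%:E + (2^-1)%:E))%E.
      by congr (_ - (_ + _))%E; [exact: h1|exact: h2].
    by rewrite -[LHS]/((1 - (2^-1 + 2^-1) : R)%:E); congr (_%:E); lra.
  - by rewrite -[X in measurable X]setTI; apply: measurable_funP.
  - by rewrite -[X in measurable X]setTI; apply: measurable_funP.
  - apply/seteqP; split=> // t [] /= -> h; have : (1 : R) = -1 by [].
    by move=> {}h; have : (0 : R) < 1 by []; lra.
have nE n : P.-negligible (if (0 < n)%N then E n else set0).
  by case: ifP => [n0|_]; [exists (E n); split=> //; exact: pE|exact: negligible_set0].
apply: negligibleS (negligible_bigcup nE) => t /= nt; apply: contrapT => nb; apply: nt.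
move=> n n0; have : (eps n t == 1) || (eps n t == -1).
  apply: contrapT => h; apply: nb; exists n => //; rewrite n0 => -[] /= h';
  by apply: h; rewrite h' eqxx ?orbT.
by rewrite /signs_of /sg; case: eqP => //= _ /eqP.
Qed.
End Transfer.

(** * The choice of the parameters *)

Section Choices.
Context {R : realType}.
Local Open Scope complex_scope.

Definition vanishes (v : nat -> R) :=
  forall x, 0 < x -> exists i0, forall i, (i0 <= i)%N -> v i <= x.

(** The exponent is raised, by one at each stage at most, as soon as all later
    values of [v] allow it. *)
Lemma epochs_exist (v : nat -> R) : vanishes v ->
  exists e : nat -> nat, [/\ forall i j, (i <= j)%N -> (e i <= e j)%N,
    forall i, (e i <= i)%N, forall k, exists i, (k <= e i)%N &
    exists i1, forall i, (i1 <= i)%N -> v i <= (@delta R e i) ^+ 2].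
Proof.
move=> v0; pose step i k := `[< forall i', (i.+1 <= i')%N -> v i' <= (2^-1 ^+ k.+1) ^+ 2 >].
pose e := fix e i := if i is i'.+1 then (if step i' (e i') then (e i').+1 else e i') else 0%N.
have eS i : e i.+1 = if step i (e i) then (e i).+1 else e i by [].
have eS1 i : (e i <= e i.+1)%N by rewrite eS; case: ifP.
have em i j : (i <= j)%N -> (e i <= e j)%N.
  by move=> ij; rewrite -(subnKC ij); elim: (j - i)%N => [|n IH];
    rewrite ?addn0 // addnS; apply: leq_trans IH (eS1 _).
exists e; split=> //.
- elim=> // i IH; rewrite eS; case: ifP => _ //; exact: leqW.
- elim=> [|k [i ki]]; first by exists 0%N.
  have [|i2 hi2] := v0 ((2^-1 ^+ k.+1) ^+ 2); first by rewrite !exprn_gt0 ?invr_gt0.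
  pose i3 := maxn i i2; have ki3 : (k <= e i3)%N.
    by apply: leq_trans ki (em _ _ _); apply: leq_maxl.
  exists i3.+1; rewrite eS; case: (ltnP k (e i3)) => h; first by case: ifP => // _; apply: ltnW.
  have <- : k = e i3 by apply/eqP; rewrite eqn_leq ki3 h.
  rewrite ifT //; apply/asboolP => i' hi'; apply: hi2.
  by apply: leq_trans (leq_maxr i i2) _; apply: ltnW.
- have [i1 hi1] := v0 1 ltr01; exists i1 => i ii1.
  have : e i = 0%N \/ forall i', (i <= i')%N -> v i' <= (2^-1 ^+ e i) ^+ 2.
    elim: i {ii1} => [|i [IH|IH]]; first by left.
      by rewrite eS; case: ifP => [/asboolP st|_]; [right|left].
    by right; rewrite eS; case: ifP => [/asboolP st|_] // i' ii'; apply: IH; apply: ltnW.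
  case=> [e0|]; last by apply.
  by rewrite /delta e0 expr0 expr1n hi1.
Qed.

Context (a : nat -> R[i]) (h b : nat).
Context (ha : vanishes (fun n => n%:R * sqn (a n))).
Context (h256 : (255 < h)%N).
Context (b22 : (22 < b)%N).

Lemma Ns_ge i : (i <= Ns h b i)%N.
Proof.
have h2 : (1 < h)%N by apply: leq_trans h256.
apply: ltnW; apply: (@leq_trans (h ^ i)); first exact: ltn_expl.
by rewrite leq_exp2l // -[X in (X <= _)%N]mul1n leq_mul2r (leq_trans _ b22) ?orbT.
Qed.

Lemma stage_var_vanishes : vanishes (stage_var a h b).
Proof.
move=> x x0; have h0 : (0 < h)%N by apply: leq_trans h256.
have Hb : 0 < (h ^ b)%N%:R :> R by rewrite ltr0n expn_gt0 h0.
have [|n0 hn0] := ha (x := x / (h ^ b)%N%:R); first by rewrite divr_gt0.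
exists n0 => i ni.
have N0 : 0 < (Ns h b i)%:R :> R by rewrite ltr0n Ns_gt0.
apply: (@le_trans _ _ (\sum_(Ns h b i <= n < Ns h b i.+1) x / (h ^ b)%N%:R / (Ns h b i)%:R)).
  rewrite /stage_var !big_nat; apply: ler_sum => n /andP[n1 _].
  rewrite ler_pdivlMr //; apply: (@le_trans _ _ (n%:R * sqn (a n))).
    by rewrite mulrC ler_wpM2r ?sqn_ge0 // ler_nat.
  by apply: hn0; apply: leq_trans ni _; apply: leq_trans (Ns_ge i) n1.
rewrite sumr_const_nat -[leLHS]mulr_natl.
have : (Ns h b i.+1 - Ns h b i)%:R <= (h ^ b)%N%:R * (Ns h b i)%:R :> R.
  by rewrite -natrM ler_nat mulnC -NsS // leq_subr.
move: ((Ns h b i.+1 - Ns h b i)%:R : R) => L hL.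
rewrite mulrA ler_pdivrMr // mulrA ler_pdivrMr // mulrC -mulrA ler_pM2l //.
by rewrite mulrC.
Qed.

(** The first stage [J0] makes the first two terms of the bound of [spread_prob]
    small, and the constant [C] makes the third one small. *)
Lemma parameters_exist (theta : R) : 0 < theta ->
  exists J0 e C, [/\ [/\ (1 < J0)%N, forall i j, (i <= j)%N -> (e i <= e j)%N,
      forall i, (e i <= i)%N & forall k, exists i, (k <= e i)%N],
    (forall i, (J0 <= i)%N -> 272 ^+ 2 * stage_var a h b i <= delta e i ^+ 2),
    (forall i n, (J0 <= i)%N -> (Ns h b i <= n)%N -> sqn (a n) * (Ns h b i)%:R <= 1),
    0 < C &
    64 * fluctuation h b J0 + 264 * H h ^+ b * 16^-1 ^+ J0 + H h ^+ (5 * b + 11) / C <= theta].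
Proof.
move=> t0; have [n1 hn1] := ha ltr01.
have sv : vanishes (fun i => 272 ^+ 2 * stage_var a h b i).
  move=> x x0; have p : 0 < (272 : R) ^+ 2 by apply: exprn_gt0; lra.
  have [|i0 hi0] := stage_var_vanishes (x := x / 272 ^+ 2); first by rewrite divr_gt0.
  by exists i0 => i /hi0; rewrite ler_pdivlMr // mulrC.
have [e [em el eu [i1 hi1]]] := epochs_exist sv.
have H1 : 256 <= H h :> R by apply: H256.
have H0 : 0 < H h :> R by lra.
pose A : R := 64 * H h ^+ (5 * b + 11) + 264 * H h ^+ b.
have Hn n : 0 < (H h : R) ^+ n by apply: exprn_gt0.
have A0 : 0 < A by rewrite /A; have := Hn (5 * b + 11)%N; have := Hn b; lra.
pose n2 := Num.bound (2 * A / theta).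
have hn2 : 2 * A / theta <= n2%:R.
  by apply/ltW/archi_boundP; rewrite divr_ge0 ?(ltW t0) // mulr_ge0 // ltW.
pose J0 := maxn (maxn 2 n1) (maxn i1 n2).
have J2 : (1 < J0)%N by rewrite /J0 !leq_max leqnn.
have Jn1 : (n1 <= J0)%N by rewrite /J0 !leq_max leqnn orbT.
have Ji1 : (i1 <= J0)%N by rewrite /J0 !leq_max leqnn !orbT.
have Jn2 : (n2 <= J0)%N by rewrite /J0 !leq_max leqnn !orbT.
have C0 : 0 < 2 * H h ^+ (5 * b + 11) / theta by rewrite divr_gt0 // mulr_gt0 // exprn_gt0.
exists J0, e, (2 * H h ^+ (5 * b + 11) / theta); split=> //.
- by move=> i Ji; apply: hi1; apply: leq_trans Ji.
- move=> i n Ji Nn; apply: (@le_trans _ _ (n%:R * sqn (a n))).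
    by rewrite mulrC ler_wpM2r ?sqn_ge0 // ler_nat.
  apply: hn1; apply: leq_trans Jn1 _; apply: leq_trans Ji _; apply: leq_trans Nn; exact: Ns_ge.
have -> : H h ^+ (5 * b + 11) / (2 * H h ^+ (5 * b + 11) / theta) = theta / 2.
  by field; rewrite !gt_eqF //= exprn_gt0.
have f1 : fluctuation h b J0 <= H h ^+ (5 * b + 11) * 16^-1 ^+ J0 :> R.
  rewrite fluctuationE // ler_wpM2l ?exprn_ge0 ?(ltW H0) //.
  apply: (@le_trans _ _ (H h ^+ J0)^-1).
    rewrite lef_pV2 ?posrE ?exprn_gt0 //; apply: HX_mono => //.
    by rewrite -[X in (X <= _)%N]mul1n leq_mul2r; apply/orP; right; move: b22; clear; lia.
  rewrite exprVn lef_pV2 ?posrE ?exprn_gt0 // lerXn2r ?nnegrE ?(ltW H0) //; lra.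
have f2 : A * 16^-1 ^+ J0 <= theta / 2.
  rewrite exprVn ler_pdivrMr ?exprn_gt0 //.
  have nX : n2%:R <= 16 ^+ J0 :> R.
    by rewrite -natrX ler_nat; apply: leq_trans Jn2 _; apply: ltnW; exact: ltn_expl.
  have := ler_wpM2l (ltW t0) nX; move: hn2; rewrite ler_pdivrMr //; lra.
have f3 : 64 * fluctuation h b J0 <= 64 * (H h ^+ (5 * b + 11) * 16^-1 ^+ J0) :> R.
  by rewrite ler_pM2l.
rewrite /A mulrDl -!mulrA in f2; rewrite -[264 * _ * _]mulrA; lra.
Qed.
End Choices.

(** * Measures of bounded energy and covers *)

Section Covers.
Context {R : realType}.
Local Open Scope complex_scope.

Local Notation nm := (@ComplexField.Normc.normc R).

Lemma sin_mvt (x : R) : 0 < x -> exists2 c, 0 < c < x & sin x = cos c * x.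
Proof.
move=> x0.
have dsin (y : R) : y \in `]0, x[ -> is_derive y 1 sin (cos y) by move=> _; apply: is_derive_sin.
have csin : {within `[0, x], continuous (@sin R)}.
  by apply: continuous_subspaceT => y; apply: continuous_sin.
have [c] := MVT x0 dsin csin.
rewrite in_itv /= sin0 !subr0 => hc e; by exists c.
Qed.

Lemma sin_le (x : R) : `|sin x| <= `|x|.
Proof.
wlog x0 : x / 0 < x => [hw|].
  case: (ltgtP x 0) => [xn|xp|->]; last by rewrite sin0.
    by rewrite -normrN -sinN -[leRHS]normrN; apply: hw; rewrite oppr_gt0.
  exact: hw.
have [c _ ->] := sin_mvt x0; rewrite normrM ler_piMl //; exact: cos_max.
Qed.

Lemma sin_ge (x : R) : 0 <= x <= pi / 4 -> x / 2 <= sin x.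
Proof.
move=> /andP[]; rewrite le_eqVlt => /orP[/eqP <-|x0] x4; first by rewrite sin0 mul0r.
have [c /andP[c0 cx] ->] := sin_mvt x0; rewrite mulrC ler_pM2r //.
have p0 := pi_gt0 R.
have q0 : 0 < cos (pi / 4 : R).
  by apply: cos_gt0_pihalf; apply/andP; split; lra.
have q2 : cos (pi / 4 : R) ^+ 2 *+ 2 - 1 = 0.
  by rewrite -cos_mulr2n -cos_pihalf; congr cos; rewrite mulr2n; lra.
have : cos (pi / 4) <= cos c.
  apply: ltW; rewrite ltr_cos ?in_itv /=; first lra.
    by apply/andP; split; lra.
  by apply/andP; split; lra.
move: q0 q2; move: (cos (pi / 4 : R)) => q q0 q2 qc; rewrite -div1r; nra.
Qed.

Lemma nm_chord (x y : R) : nm (expi x - expi y) = `|2 * sin ((x - y) / 2)|.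
Proof. by rewrite nmE sqn_chord sqrtr_sqr. Qed.

Lemma chord_le (t u : R) : nm (circ t - circ u) <= 8 * `|t - u|.
Proof.
have p0 := pi_gt0 R; have := @pihalf_lt2 R => p2.
rewrite nm_chord normrM ger0_norm //.
have -> : (2 * pi * t - 2 * pi * u) / 2 = pi * (t - u) by field.
have := sin_le (pi * (t - u)); rewrite normrM (ger0_norm (ltW p0)).
have := normr_ge0 (t - u); move: (`|sin _|) (`|t - u|) => s d d0 hs; nra.
Qed.

Lemma chord_ge (t u : R) : 0 <= t <= 1 / 4 -> 0 <= u <= 1 / 4 ->
  `|t - u| <= nm (circ t - circ u).
Proof.
wlog ut : t u / u <= t => [hw ht hu|].
  case: (leP u t) => [ut|/ltW tu]; first exact: hw.
  by rewrite distrC -nmN opprB; apply: hw.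
move=> /andP[t0 t1] /andP[u0 u1].
have p0 := pi_gt0 R; have := @pihalf_ge1 R => p2.
rewrite nm_chord normrM !ger0_norm ?subr_ge0 //; last first.
  by apply: sin_ge0_pi; apply/andP; split; nra.
have -> : (2 * pi * t - 2 * pi * u) / 2 = pi * (t - u) by field.
have : pi * (t - u) / 2 <= sin (pi * (t - u)).
  by apply: sin_ge; apply/andP; split; nra.
nra.
Qed.

Lemma cluster_point (u : nat -> R) : (forall n, 0 <= u n <= 1 / 4) ->
  exists2 p, 0 <= p <= 1 / 4 &
    forall x N, 0 < x -> exists2 n, (N <= n)%N & `|u n - p| < x.
Proof.
move=> hu; have cpt := @segment_compact R 0 (1 / 4).
have FA : (u @ \oo) `[0, 1 / 4]%classic.
  by exists 0%N => // n _ /=; rewrite in_itv /= hu.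
have [p [/=]] := cpt (u @ \oo) _ FA.
rewrite in_itv /= => hp cl; exists p => // x N x0.
have [|y [[n /= Nn <-]]] := cl (u @` [set n | (N <= n)%N]) (ball p x) _ (nbhsx_ballx _ _ x0).
  by exists N => // n /= Nn; exists n.
by rewrite /ball /= distrC => h; exists n.
Qed.

(** Points of the [K n] that escape the first [n] intervals have a cluster point,
    which lies in all the [K k], hence in an interval. *)
Lemma finite_subcover (K : nat -> R -> Prop) (x l : nat -> R) :
  (forall k t, K k t -> 0 <= t <= 1 / 4) ->
  (forall j k t, (j <= k)%N -> K k t -> K j t) ->
  (forall k t, (forall y, 0 < y -> exists2 u, K k u & `|u - t| < y) -> K k t) ->
  (forall t, (forall k, K k t) -> exists i, `|t - x i| < l i) ->
  exists n, forall t, K n t -> exists2 i, (i < n)%N & `|t - x i| < l i.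
Proof.
move=> K01 Kdec Kcl cov; apply: contrapT => nex.
have bad n : exists t, K n t /\ forall i, (i < n)%N -> ~ (`|t - x i| < l i).
  apply: contrapT => nb; apply: nex; exists n => t Kt; apply: contrapT => ni.
  by apply: nb; exists t; split=> // i ilt h; apply: ni; exists i.
have {bad} [u hu] := choice bad.
have [p hp clp] := cluster_point (fun n => K01 _ _ (hu n).1).
have [i hi] : exists i, `|p - x i| < l i.
  apply: cov => k; apply: Kcl => y y0; have [n kn un] := clp y k y0.
  by exists (u n) => //; apply: Kdec kn (hu n).1.
have [|n Nn un] := clp (l i - `|p - x i|) i.+1; first by rewrite subr_gt0.
apply: ((hu n).2 i Nn); have := ler_normD (u n - p) (p - x i).
by rewrite subrKA; lra.
Qed.

Lemma sum_delta_le (L : nat) (m : nat) (y : R) : 0 <= y ->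
  \sum_(0 <= l < L) (m == l)%:R * y <= y.
Proof.
move=> y0; case: (ltnP m L) => mL.
  rewrite (bigD1_seq m) ?iota_uniq ?mem_index_iota //= eqxx mul1r big1 ?addr0 //.
  by move=> l lm; rewrite eq_sym (negbTE lm) mul0r.
rewrite big_nat big1 // => l /andP[_ ll]; rewrite gtn_eqF ?mul0r //.
exact: leq_trans mL.
Qed.

(** A measure of bounded energy cannot live on few short intervals: an interval
    is covered by two cells of comparable length, and the mass of a cell is
    bounded by its energy and its size, by the arithmetic-geometric inequality. *)
Lemma energy_cover (h b J0 M k n : nat) (rho x l : nat -> R) (tot E : R)
    (c := (b - 21)%N) (s := 1 - 2 / c%:R : R) :
  (1 < h)%N -> (23 < b)%N -> (0 < M)%N ->
  (forall j, (j < k)%N -> (h ^ (c * (J0 + j)) %| M)%N) ->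
  (forall q, 0 <= rho q) -> 0 < tot -> tot <= \sum_(0 <= q < M) rho q -> 0 < E ->
  \sum_(0 <= j < k) H h ^+ ((b - 23) * (J0 + j)) *
    (\sum_(0 <= l < (h ^ (c * (J0 + j)))%N)
      (\sum_(0 <= q < M) rho q * ((q %/ (M %/ h ^ (c * (J0 + j))) == l)%N)%:R) ^+ 2) <= E ->
  (forall q, (q < M)%N -> rho q != 0 -> exists2 i, (i < n)%N & `|q%:R / M%:R - x i| < l i) ->
  (forall i, (i < n)%N -> [/\ 0 < l i, 2 * l i <= (H h ^+ (c * J0))^-1 &
     (H h ^+ (c * (J0 + k)))^-1 < 2 * l i]) ->
  tot ^+ 2 / E <= 2 * H h ^+ (b - 23) * \sum_(0 <= i < n) (2 * l i) `^ s.
Proof.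
move=> h1 b23 M0 dM rho0 tot0 htot E0 hE hrho hl.
have H1 : 1 < H h :> R by rewrite /H ltr1n.
have H0 : 0 < H h :> R by lra.
have HX m : 0 < H h ^+ m :> R by rewrite exprn_gt0.
have MR : 0 < M%:R :> R by rewrite ltr0n.
have c2 : (2 < c)%N by rewrite /c; move: b23; clear; lia.
have c2E : (b - 23 = c - 2)%N by rewrite /c; move: b23; clear; lia.
(* The scale of the cells that cover the i-th interval. *)
have [jj hjj] : exists jj : nat -> nat, forall i, (i < n)%N ->
    [/\ (jj i < k)%N, 2 * l i <= (H h ^+ (c * (J0 + jj i)))^-1 &
      (H h ^+ (c * (J0 + jj i).+1))^-1 < 2 * l i].
  have : forall i, exists j, (i < n)%N -> [/\ (j < k)%N,
      2 * l i <= (H h ^+ (c * (J0 + j)))^-1 & (H h ^+ (c * (J0 + j).+1))^-1 < 2 * l i].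
    move=> i; case: (ltnP i n) => [inn|]; last by exists 0%N.
    have [l0 lJ lk] := hl i inn; elim: k lk {dM hE hl} => [|k' IH] lk.
      by move: lJ lk; rewrite addn0; lra.
    case: (ltP (H h ^+ (c * (J0 + k')))^-1 (2 * l i)) => [/IH[j hj]|h2].
      by exists j => _; have [jk a1 a2] := hj isT; split=> //; apply: ltnW.
    by exists k' => _; rewrite -addnS.
  by move=> /choice[jj hjj]; exists jj.
pose L j := (h ^ (c * (J0 + j)))%N.
pose cell j := (M %/ L j)%N.
have LR j : (L j)%:R = H h ^+ (c * (J0 + j)) :> R by rewrite natrX.
have L0 j : 0 < (L j)%:R :> R by rewrite LR.
pose nu j m := \sum_(0 <= q < M) rho q * ((q %/ cell j == m)%N)%:R.
pose first i := Num.trunc ((x i - l i) * (L (jj i))%:R).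
(* At its scale, an interval meets two consecutive cells at most. *)
pose hit j m : R := (has (fun i => (jj i == j) && ((first i == m) || ((first i).+1 == m))) (iota 0 n))%:R.
have nu0 j m : 0 <= nu j m by apply: sumr_ge0 => q _; rewrite mulr_ge0.
have hit0 j m : 0 <= hit j m by apply: ler0n.
have cover_q : \sum_(0 <= q < M) rho q <= \sum_(0 <= j < k) \sum_(0 <= m < L j) hit j m * nu j m.
  have -> : \sum_(0 <= j < k) \sum_(0 <= m < L j) hit j m * nu j m =
      \sum_(0 <= q < M) rho q * \sum_(0 <= j < k) \sum_(0 <= m < L j) hit j m * ((q %/ cell j == m)%N)%:R.
    under eq_bigr do under eq_bigr do rewrite mulr_sumr.
    under eq_bigr do rewrite exchange_big /=.
    rewrite exchange_big /=; apply: eq_bigr => q _; rewrite mulr_sumr.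
    apply: eq_bigr => j _; rewrite mulr_sumr; apply: eq_bigr => m _; ring.
  rewrite !big_nat; apply: ler_sum => q /andP[_ qM].
  have [->|rq] := eqVneq (rho q) 0; first by rewrite mul0r.
  rewrite ler_peMr ?rho0 //; have [i inn hi] := hrho q qM rq.
  have [jk l1 l2] := hjj i inn; set j := jj i in jk l1 l2.
  have pM := dM j jk; have cM : (cell j * L j = M)%N by rewrite divnK.
  have c0 : (0 < cell j)%N by move: M0; rewrite -cM muln_gt0 => /andP[].
  have cR : (cell j)%:R = M%:R / (L j)%:R :> R by rewrite -cM natrM mulfK // gt_eqF.
  have C0 : 0 < (cell j)%:R :> R by rewrite ltr0n.
  have qL : (q %/ cell j < L j)%N by rewrite ltn_divLR // mulnC cM.
  set m := (q %/ cell j)%N in qL.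
  have m1 : m%:R <= q%:R / M%:R * (L j)%:R :> R.
    rewrite mulrAC -mulrA -invf_div -cR ler_pdivlMr // -natrM ler_nat; exact: leq_trunc_div.
  have m2 : q%:R / M%:R * (L j)%:R < m.+1%:R :> R.
    rewrite mulrAC -mulrA -invf_div -cR ltr_pdivrMr // -natrM ltr_nat -ltn_divLR //.
  have lL : 2 * l i * (L j)%:R <= 1.
    by rewrite LR -ler_pdivlMr // div1r.
  have hitm : hit j m = 1.
    rewrite /hit; case: hasP => // -[]; exists i; first by rewrite mem_iota.
    rewrite eqxx /=; move: hi; rewrite ltr_norml => /andP[q1 q2].
    have y1 : (x i - l i) * (L j)%:R < q%:R / M%:R * (L j)%:R by rewrite ltr_pM2r //; lra.
    have y2 : q%:R / M%:R * (L j)%:R < (x i - l i) * (L j)%:R + 1.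
      apply: (@lt_le_trans _ _ ((x i - l i) * (L j)%:R + 2 * l i * (L j)%:R)); last by lra.
      by rewrite -mulrDl ltr_pM2r //; lra.
    rewrite /first -/j; move: y1 y2 m1 m2.
    move: ((x i - l i) * (L j)%:R) (q%:R / M%:R * (L j)%:R) => y z y1 y2 m1 m2.
    have [y0|y0] := leP 0 y; last first.
      have -> : Num.trunc y = 0%N by apply/truncn0Pn; rewrite -ltNge; lra.
      have : m%:R < (1 : R) by lra.
      by rewrite ltrn1 ltnS leqn0 => /eqP ->.
    have /andP[t1 t2] := truncn_itv y0.
    have : (Num.trunc y < m.+1)%N by rewrite -(ltr_nat R); lra.
    have : (m < (Num.trunc y).+2)%N by rewrite -(ltr_nat R) -natr1; lra.
    by clear; lia.
  rewrite (bigD1_seq j) ?iota_uniq ?mem_index_iota //=.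
  rewrite (bigD1_seq m) ?iota_uniq ?mem_index_iota //= hitm eqxx mulr1 -addrA lerDl.
  by rewrite addr_ge0 //; apply: sumr_ge0 => j' _; rewrite ?sumr_ge0 // ?mulr_ge0 // => m' _; rewrite mulr_ge0.
pose W j : R := H h ^+ ((b - 23) * (J0 + j)).
have W0 j : 0 < W j by apply: HX.
pose la := E / (2 * tot).
have la0 : 0 < la by rewrite divr_gt0 // mulr_gt0.
have amgm : \sum_(0 <= j < k) \sum_(0 <= m < L j) hit j m * nu j m <=
    la * \sum_(0 <= j < k) \sum_(0 <= m < L j) hit j m / W j + tot / 2.
  apply: (@le_trans _ _ (\sum_(0 <= j < k) \sum_(0 <= m < L j)
    (la * (hit j m / W j) + (4 * la)^-1 * (W j * nu j m ^+ 2)))).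
    apply: ler_sum => j _; apply: ler_sum => m _.
    have -> : la * (hit j m / W j) + (4 * la)^-1 * (W j * nu j m ^+ 2) =
       hit j m * nu j m + (W j / (4 * la)) * ((nu j m - 2 * la * hit j m / W j) ^+ 2
         + 4 * la ^+ 2 / W j ^+ 2 * (hit j m - hit j m ^+ 2)).
      by field; rewrite !gt_eqF.
    rewrite lerDl; apply: mulr_ge0.
      by apply: divr_ge0; [exact: ltW|rewrite mulr_ge0 // ltW].
    apply: addr_ge0; first exact: sqr_ge0.
    apply: mulr_ge0.
      by apply: divr_ge0; [rewrite mulr_ge0 // sqr_ge0|exact: sqr_ge0].
    by rewrite /hit; case: has; rewrite ?expr1n ?expr0n subrr.
  under eq_bigr do rewrite big_split -!mulr_sumr.
  rewrite big_split -!mulr_sumr /= lerD2l.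
  apply: (@le_trans _ _ ((4 * la)^-1 * E)); first apply: ler_wpM2l.
  - by rewrite invr_ge0 mulr_ge0 // ltW.
  - exact: hE.
  rewrite le_eqVlt; apply/orP; left; apply/eqP; rewrite /la; field.
  by rewrite !gt_eqF.
have hits : \sum_(0 <= j < k) \sum_(0 <= m < L j) hit j m / W j <=
    \sum_(0 <= i < n) 2 * (W (jj i))^-1.
  apply: (@le_trans _ _ (\sum_(0 <= i < n) \sum_(0 <= j < k) \sum_(0 <= m < L j)
     ((jj i == j)%:R * ((first i == m)%:R * (W (jj i))^-1 + ((first i).+1 == m)%:R * (W (jj i))^-1)))).
    rewrite exchange_big; apply: ler_sum => j _; rewrite exchange_big; apply: ler_sum => m _.
    rewrite /hit; case: hasP => [[i1]|_]; last first.
      by rewrite mul0r; apply: sumr_ge0 => i _; rewrite mulr_ge0 ?addr_ge0 ?mulr_ge0 ?invr_ge0 ?(ltW (W0 _)).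
    rewrite mem_iota => inn /andP[/eqP ij im].
    rewrite (bigD1_seq i1) ?iota_uniq ?mem_index_iota //= ij eqxx !mul1r.
    apply: (@le_trans _ _ ((first i1 == m)%:R / W j + ((first i1).+1 == m)%:R / W j)).
      rewrite -mulrDl -[leLHS]mul1r ler_pM2r ?invr_gt0 // -natrD ler1n.
      by move: im; case: eqP; case: eqP.
    rewrite lerDl; apply: sumr_ge0 => i' _.
    by rewrite mulr_ge0 ?addr_ge0 ?mulr_ge0 ?invr_ge0 ?(ltW (W0 _)).
  apply: ler_sum => i _.
  apply: (@le_trans _ _ (\sum_(0 <= j < k) (jj i == j)%:R * (2 * (W (jj i))^-1))).
    apply: ler_sum => j _; rewrite -mulr_sumr ler_wpM2l // big_split /= mulr2n mulrDl mul1r.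
    by apply: lerD; apply: sum_delta_le; rewrite invr_ge0 ltW.
  by apply: sum_delta_le; rewrite mulr_ge0 // invr_ge0 ltW.
have Wl i : (i < n)%N -> (W (jj i))^-1 <= H h ^+ (b - 23) * (2 * l i) `^ s.
  move=> inn; have [jk l1 l2] := hjj i inn.
  have l0 : 0 < 2 * l i by have [] := hl i inn; lra.
  have cR : 0 < c%:R :> R by rewrite ltr0n; apply: leq_trans c2.
  have s0 : 0 <= s.
    by rewrite /s subr_ge0 ler_pdivrMr // mul1r (ler_nat R 2) ltnW.
  apply: (@le_trans _ _ (H h ^+ (b - 23) * ((H h ^+ (c * (J0 + jj i).+1))^-1 `^ s))); last first.
    rewrite ler_pM2l //; apply: ge0_ler_powR => //; rewrite ?nnegrE ?invr_ge0 ?(ltW (HX _)) ?(ltW l0) //.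
    exact: ltW.
  have -> : (H h ^+ (c * (J0 + jj i).+1))^-1 `^ s = (H h ^+ ((b - 23) * (J0 + jj i).+1))^-1 :> R.
    rewrite -powR_inv1 ?(ltW (HX _)) // -powR_mulrn ?(ltW H0) // -!powRrM.
    rewrite -[RHS]powR_inv1 ?(ltW (HX _)) // -powR_mulrn ?(ltW H0) // -powRrM.
    congr (_ `^ _); rewrite !natrM c2E (@natrB _ c 2 (ltnW c2)) /s; field.
    by rewrite gt_eqF.
  rewrite mulnS exprD invfM mulrA mulfV ?mul1r ?gt_eqF //.
have key : tot / 2 <= la * \sum_(0 <= i < n) 2 * (W (jj i))^-1.
  have : la * \sum_(0 <= j < k) \sum_(0 <= m < L j) hit j m / W j <=
     la * \sum_(0 <= i < n) 2 * (W (jj i))^-1 by rewrite ler_pM2l.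
  lra.
have e1 : tot ^+ 2 / E = (tot / 2) / la by rewrite /la; field; rewrite !gt_eqF.
rewrite e1 ler_pdivrMr // [leRHS]mulrC; apply: (le_trans key); rewrite ler_pM2l //.
rewrite mulr_sumr !big_nat; apply: ler_sum => i /andP[_ inn].
by rewrite -mulrA ler_pM2l // Wl.
Qed.
End Covers.

(** * Hausdorff contents *)

Section Contents.
Context {R : realType}.
Local Open Scope complex_scope.

Local Notation nm := (@ComplexField.Normc.normc R).

Lemma nm_diam (U : set (Rcomplex R)) z z' : U z -> U z' -> ((nm (z - z'))%:E <= diam U)%E.
Proof. by move=> Uz Uz'; apply: ereal_sup_ubound; exists (z, z'). Qed.

Lemma diam_ge0 (U : set (Rcomplex R)) z : U z -> (0 <= diam U)%E.
Proof. by move=> Uz; apply: le_trans (nm_diam Uz Uz); rewrite lee_fin nm_ge0. Qed.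

Lemma diam_fin (U : set (Rcomplex R)) z (x : R) : U z -> (diam U <= x%:E)%E ->
  diam U = (fine (diam U))%:E /\ 0 <= fine (diam U) <= x.
Proof.
move=> Uz dx; have d0 := diam_ge0 Uz.
have df : diam U \is a fin_num.
  by rewrite fin_numElt (lt_le_trans _ d0) ?ltNy0 // (le_lt_trans dx) ?ltry.
by rewrite fineK // -!lee_fin fineK // d0 dx.
Qed.

Lemma diam_pow_ge0 s (U : set (Rcomplex R)) : (0 <= diam_pow s U)%E.
Proof. by rewrite /diam_pow; case: asboolP => // _; apply: poweR_ge0. Qed.

Lemma diam_pow_fin s (U : set (Rcomplex R)) (x : R) : s != 0 -> (diam U <= x%:E)%E ->
  (((fine (diam U)) `^ s)%:E <= diam_pow s U)%E.
Proof.
move=> s0 dx; rewrite /diam_pow; case: asboolP => [->|U0].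
  rewrite /diam setX0 image_set0 ereal_sup0 /= powR0 //.
have [z Uz] : U !=set0 by apply/set0P/eqP.
by have [dE _] := diam_fin Uz dx; rewrite [X in poweR X _]dE poweR_EFin.
Qed.

Lemma diam_pow_exponent s s' (U : set (Rcomplex R)) : 0 <= s -> s <= s' ->
  (diam U <= 1%:E)%E -> (diam_pow s' U <= diam_pow s U)%E.
Proof.
move=> s0 ss d1; rewrite /diam_pow; case: asboolP => // U0.
have [z Uz] : U !=set0 by apply/set0P/eqP.
have [dE] := diam_fin Uz d1; move: (fine _) dE => x -> /andP[d0 d1'].
rewrite !poweR_EFin lee_fin.
move: d0; rewrite le_eqVlt => /orP[/eqP <-|d0]; last first.
  by apply: ger_powR => //; rewrite d0.
rewrite /powR eqxx; case: eqP => [s'0|_]; last exact: ler0n.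
by rewrite (_ : s == 0) //; apply/eqP; lra.
Qed.

(** Completeness of the line, for the real and the imaginary parts. *)
Lemma complex_cvg (u : nat -> R[i]) :
  (forall x : R, 0 < x -> exists N, forall n, (N <= n)%N -> nm (u n - u N) <= x) ->
  cvgn (u : nat -> R[i]^o).
Proof.
move=> hu.
have part (f : R[i] -> R) : (forall z z', f (z - z') = f z - f z') ->
    (forall z, `|f z| <= nm z) -> exists l : R, forall x, 0 < x ->
      exists N, forall n, (N <= n)%N -> `|l - f (u n)| <= x.
  move=> fB fn; have : cvgn (fun n => f (u n)).
    apply: cauchy_cvg; apply: cauchy_exP => x x0.
    have [|N hN] := hu (x / 2); first by rewrite divr_gt0.
    exists (f (u N)); exists N => // n /= Nn; rewrite /ball /= distrC -fB.
    by apply: (le_lt_trans (fn _)); apply: (le_lt_trans (hN n Nn)); lra.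
  move=> /cvg_ex[l hl]; exists l => x x0.
  have /cvgrPdist_le /(_ x x0) [N _ hN] := hl.
  by exists N => n Nn; apply: hN.
have [|z|l1 h1] := part (@complex.Re R).
- by move=> [x y] [x' y'].
- by rewrite nmE -sqrtr_sqr ler_wsqrtr // /sqn lerDl sqr_ge0.
have [|z|l2 h2] := part (@complex.Im R).
- by move=> [x y] [x' y'].
- by rewrite nmE -sqrtr_sqr ler_wsqrtr // /sqn lerDr sqr_ge0.
apply/cvg_ex; exists (l1 +i* l2); apply/cvgrPdist_le => x x0.
have [x1 x1E] : exists x1 : R, x = x1%:C.
  by exists (complex.Re x); rewrite RRe_real // gtr0_real.
have x10 : 0 < x1 by move: x0; rewrite x1E ltcR.
have [|N1 hN1] := h1 (x1 / 2); first by rewrite divr_gt0.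
have [|N2 hN2] := h2 (x1 / 2); first by rewrite divr_gt0.
exists (maxn N1 N2) => // n /=; rewrite geq_max => /andP[n1 n2].
rewrite x1E normc_def lecR -nmE; apply: nm_le; first exact: ltW.
have := hN1 n n1; have := hN2 n n2; case: (u n) => y1 y2 /=.
rewrite /sqn /= !ler_norml => /andP[a1 a2] /andP[b1 b2]; nra.
Qed.

Context (a : nat -> R[i]) (h b J0 : nat) (e : nat -> nat) (C : R) (w : signs).
Context (h256 : (255 < h)%N).
Context (b23 : (23 < b)%N).
Context (J2 : (1 < J0)%N).
Context (e_mono : forall i j, (i <= j)%N -> (e i <= e j)%N).
Context (e_le : forall i, (e i <= i)%N).
Context (e_unbounded : forall k, exists i, (k <= e i)%N).
Context (var_small : forall i, (J0 <= i)%N -> 272 ^+ 2 * stage_var a h b i <= delta e i ^+ 2).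
Context (a_small : forall i n, (J0 <= i)%N -> (Ns h b i <= n)%N ->
  sqn (a n) * (Ns h b i)%:R <= 1).
Context (C0 : 0 < C).

Let J1 : (0 < J0)%N. Proof. exact: ltnW. Qed.
Let b22 : (22 < b)%N. Proof. exact: ltnW. Qed.

(** The conclusion of [confined], as a closed condition on the angle that does not
    mention the grid. *)
Definition confined_angle k (t : R) : Prop :=
  0 <= t <= 1 / 4 /\ forall j n, (j < k)%N -> (Ns h b (J0 + j) <= n <= Ns h b (J0 + k))%N ->
    nm (wsum (terms a (circ t)) w (Ns h b (J0 + j)) n) <= 6 * delta e (J0 + j).

Lemma confined_angle_dec j k t : (j <= k)%N -> confined_angle k t -> confined_angle j t.
Proof.
move=> jk [t01 ht]; split=> // i n ij /andP[n1 n2]; apply: ht; first exact: leq_trans jk.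
by rewrite n1 (leq_trans n2) // Ns_mono // leq_add2l.
Qed.

Lemma wsum_lipschitz lo n t u :
  nm (wsum (terms a (circ t)) w lo n - wsum (terms a (circ u)) w lo n) <=
  (\sum_(lo <= m < n) nm (a m) * 8 * m%:R) * `|t - u|.
Proof.
rewrite /wsum -sumrB mulr_suml; elim/big_ind2: _ => [|x1 x2 y1 y2 h1 h2|m _].
- by rewrite nm0.
- by apply: (le_trans (nmD _ _)); apply: lerD.
rewrite -mulrBr nmZ /sg (_ : `|_| = 1); last by case: (w m); rewrite ?normrN normr1.
rewrite mul1r /terms -mulrBr ComplexField.Normc.normcM -!mulrA ler_wpM2l ?nm_ge0 //.
have cX v : circ v ^+ m = circ (m%:R * v) by rewrite /circ expiX; congr expi; ring.
rewrite !cX; apply: (le_trans (chord_le _ _)).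
by rewrite -mulrBr normrM ger0_norm.
Qed.

(** The partial sums are Lipschitz functions of the angle. *)
Lemma confined_angle_closed k t :
  (forall y, 0 < y -> exists2 u, confined_angle k u & `|u - t| < y) -> confined_angle k t.
Proof.
move=> ht; split.
  apply/andP; split; apply/ler_addgt0Pr => y y0; have [u [/andP[u0 u1] _]] := ht y y0;
    rewrite ltr_norml => /andP[h1 h2]; lra.
move=> j n jk hn; apply/ler_addgt0Pr => y y0.
set L := \sum_(Ns h b (J0 + j) <= m < n) nm (a m) * 8 * m%:R.
have L0 : 0 <= L by apply: sumr_ge0 => m _; rewrite !mulr_ge0 ?nm_ge0.
have [|u [_ hu] ut] := ht (y / (L + 1)); first by rewrite divr_gt0 // ltr_wpDl.
have hl := wsum_lipschitz (Ns h b (J0 + j)) n t u.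
have {}hu := hu j n jk hn.
rewrite -[wsum _ _ _ _](subrK (wsum (terms a (circ u)) w (Ns h b (J0 + j)) n)).
apply: (le_trans (nmD _ _)); rewrite addrC; apply: lerD => //.
apply: (le_trans hl); rewrite -/L distrC.
move: ut; rewrite ltr_pdivlMr ?ltr_wpDl // => ut.
have := normr_ge0 (u - t); lra.
Qed.

Lemma delta_vanishes (x : R) : 0 < x -> exists i, delta e (J0 + i) <= x.
Proof.
move=> x0; have [i hi] := e_unbounded (Num.bound x^-1).
exists i; apply: (@le_trans _ _ (delta e i)).
  by apply: delta_mono => //; apply: leq_addl.
have xi : x^-1 < (Num.bound x^-1)%:R by apply: archi_boundP; rewrite invr_ge0 ltW.
rewrite /delta exprVn -[leRHS]invrK lef_pV2 ?posrE ?exprn_gt0 ?invr_gt0 //.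
apply: (le_trans (ltW xi)); rewrite -natrX ler_nat; apply: leq_trans hi _.
by apply: ltnW; exact: ltn_expl.
Qed.

Lemma confined_angle_cvg (c : nat -> R[i]) t :
  (forall n, (0 < n)%N -> c n = (sg (w n))%:C * a n) ->
  (forall k, confined_angle k t) -> circle_convergence_set c (circ t).
Proof.
move=> hc ht; split.
  by rewrite nmE sqn_expi sqrtr1.
have psE N : psum c (circ t) N = wsum (terms a (circ t)) w 1 N.+1.
  apply: eq_big_nat => n /andP[n0 _]; rewrite hc // /terms; ring.
apply: complex_cvg => x x0; have [|j hj] := @delta_vanishes (x / 12).
  by rewrite divr_gt0.
set N := Ns h b (J0 + j); have N0 : (0 < N)%N by apply: Ns_gt0.
have bound n : (N <= n)%N -> nm (wsum (terms a (circ t)) w N n) <= 6 * delta e (J0 + j).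
  move=> Nn; have [_ ] := ht (n + j.+1)%N; apply; first by rewrite addnS ltnS leq_addl.
  rewrite Nn /=; apply: leq_trans (@Ns_ge h b h256 b22 _).
  by rewrite addnC -addnA leq_addr.
exists N => n Nn; rewrite !psE.
rewrite (@wsum_cat _ _ _ 1 N n.+1) ?N0 ?leqW //.
rewrite (@wsum_cat _ _ _ 1 N N.+1) ?N0 ?leqW //.
set A := wsum _ _ 1 N; rewrite opprD addrACA subrr add0r.
apply: (le_trans (nmD _ _)); rewrite nmN.
have := bound n.+1 (leqW Nn); have := bound N.+1 (leqnSn _); lra.
Qed.

(** The factor 4 makes a quarter of the circle a whole number of points, and keeps
    twice the frequencies in use below the size of the grid. *)
Definition gridsize k := (4 * h ^ (b * (J0 + k)))%N.

Definition spread_angles k : bool :=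
  spread a h b J0 e (gridsize k) (isotropic_weight a h b J0 (gridsize k) k) C k w.

Lemma gridsize_gt0 k : (0 < gridsize k)%N.
Proof. by rewrite muln_gt0 expn_gt0 (leq_ltn_trans _ h256). Qed.

Lemma gridsize_dvd j k : (j < k)%N -> (h ^ ((b - 21) * (J0 + j)) %| gridsize k)%N.
Proof.
move=> jk; apply: dvdn_mull; apply: dvdn_exp2l; apply: leq_mul; first exact: leq_subr.
by rewrite leq_add2l ltnW.
Qed.

(** The confined points of the grid lie in the intervals and have a mass of at
    least a quarter of an eighth of the grid, hence [energy_cover] applies. *)
Lemma confined_intervals k n (x l : nat -> R) (c := (b - 21)%N) :
  spread_angles k ->
  (forall t, confined_angle k t -> exists2 i, (i < n)%N & `|t - x i| < l i) ->
  (forall i, (i < n)%N -> [/\ 0 < l i, 2 * l i <= (H h ^+ (c * J0))^-1 &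
     (H h ^+ (c * (J0 + k)))^-1 < 2 * l i]) ->
  1 / (32 * 32 * C) <= 2 * H h ^+ (b - 23) * \sum_(0 <= i < n) (2 * l i) `^ (1 - 2 / c%:R).
Proof.
move=> /andP[s1 s2] cov hl; set M := gridsize k in s1 s2.
set chi := isotropic_weight a h b J0 M k in s1 s2.
have M0 : (0 < M)%N := gridsize_gt0 k.
have MR : 0 < M%:R :> R by rewrite ltr0n.
have chiP := @isotropic_weightP R a h b J0 M k.
have SM : M%:R / 8 <= \sum_(0 <= q < M) chi q.
  apply: isotropic_weight_sum => //.
  by rewrite leq_mul2r orbT.
pose rho q := if (q < M)%N then chi q * (density a h b J0 e (grid M q) k w *
   (clean a h b J0 e (grid M q) k w)%:R) else 0.
have rhoE : \sum_(0 <= q < M) rho q = cmass a h b J0 e M chi k w.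
  by apply: eq_big_nat => q /andP[_ qM]; rewrite /rho qM.
have rho0 q : 0 <= rho q.
  rewrite /rho; case: ifP => // qM; have [/andP[c0 c1]] := chiP q qM; rewrite -/chi.
  case: eqVneq => [->|_ /(_ isT) gq]; first by rewrite mul0r.
  have /andP[r0 _] := density_bounds h256 b22 J1 e_le var_small w gq.
  by rewrite mulr_ge0 // mulr_ge0.
have -> : 1 / (32 * 32 * C) = (M%:R / 32) ^+ 2 / (C * M%:R ^+ 2).
  by field; rewrite !gt_eqF.
apply: (energy_cover (M := M) (k := k) (rho := rho) (x := x)) => //.
- exact: leq_trans h256.
- by move=> j; apply: gridsize_dvd.
- by rewrite divr_gt0.
- by rewrite rhoE; apply: le_trans s1; move: SM; lra.
- by rewrite mulr_gt0 // exprn_gt0.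
- apply: le_trans s2; rewrite le_eqVlt; apply/orP; left; apply/eqP.
  apply: eq_bigr => j _; congr (_ * _); apply: eq_bigr => m _; congr (_ ^+ _).
  by apply: eq_big_nat => q /andP[_ qM]; rewrite /rho qM /restrict; ring.
- move=> q qM; rewrite /rho qM mulf_eq0 negb_or => /andP[chq].
  rewrite mulf_eq0 negb_or => /andP[dq cq]; apply: cov; split.
    move: chq; rewrite /chi /isotropic_weight; case: ltnP => /= qM4; last by rewrite eqxx.
    move=> _; rewrite divr_ge0 //= ler_pdivrMr //; move: qM4.
    by rewrite -(ltr_nat R) natrM; lra.
  move=> j m jk hm; apply: (confined h256 b22 J1 e_mono e_le jk dq _ hm).
  by move: cq; rewrite pnatr_eq0 eqb0 negbK.
- exact: hl.
Qed.

(** Intervals around the traces of a cover on the quarter circle cover, by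
    compactness, the angles confined during some number of stages; they cannot be
    short, since the spread at a deeper stage, where the grid is finer than the
    intervals, would contradict [confined_intervals]. *)
Lemma content_pos (coef : nat -> R[i]) (s := 1 - 2 / (b - 21)%:R : R) :
  (forall n, (0 < n)%N -> coef n = (sg (w n))%:C * a n) ->
  (forall k0, exists2 k, (k0 <= k)%N & spread_angles k) ->
  exists2 del : R, 0 < del & (0 < hausdorff_content s del (circle_convergence_set coef))%E.
Proof.
move=> hcoef hspread; set A := circle_convergence_set coef.
have H1 : 256 <= H h :> R by apply: H256.
have H0 : 0 < H h :> R by lra.
have HX n : 0 < H h ^+ n :> R by rewrite exprn_gt0.
have cR : 2 < (b - 21)%:R :> R.
  by rewrite (ltr_nat R 2); move: b23; clear; lia.
have s0 : 0 < s by rewrite /s subr_gt0 ltr_pdivrMr ?mul1r //; lra.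
have s1 : s <= 1 by rewrite /s gerBl divr_ge0 //; lra.
pose B0 : R := (H h ^+ ((b - 21) * J0))^-1.
have B00 : 0 < B0 by rewrite invr_gt0.
pose c2 : R := 1 / (32 * 32 * C * 16 * H h ^+ (b - 23)).
have c20 : 0 < c2 by rewrite /c2 divr_gt0 // !mulr_gt0.
pose xi := Num.min c2 ((B0 / 4) `^ s).
have xi0 : 0 < xi by rewrite lt_min c20 powR_gt0 // divr_gt0.
exists (B0 / 4); first by rewrite divr_gt0.
apply: (@lt_le_trans _ _ c2%:E); first by rewrite lte_fin.
apply/ereal_infP => _ [U [cov dU] <-].
pose dd i := fine (diam (U i)).
have dd0 i : 0 <= dd i <= B0 / 4.
  have [[z Uz]|Ui] := pselect (U i !=set0); first by have [_] := diam_fin Uz (dU i).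
  have -> : dd i = 0.
    rewrite /dd (_ : U i = set0); first by rewrite /diam setX0 image_set0 ereal_sup0.
    by apply/seteqP; split=> // z Uz; apply: Ui; exists z.
  by rewrite lexx divr_ge0 // ltW.
(* The cover is enlarged to open intervals of positive length. *)
pose tau i : R := (xi / 2 ^+ i.+1) `^ s^-1.
have t2 i : 0 < xi / 2 ^+ i.+1 by rewrite divr_gt0 // exprn_gt0.
have tau0 i : 0 < tau i by rewrite powR_gt0.
have taus i : tau i `^ s = xi / 2 ^+ i.+1.
  by rewrite -powRrM mulVf ?gt_eqF // powRr1 // ltW.
have tauB i : tau i <= B0 / 4.
  have -> : B0 / 4 = ((B0 / 4) `^ s) `^ s^-1.
    by rewrite -powRrM mulfV ?gt_eqF // powRr1 // divr_ge0 // ltW.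
  apply: ge0_ler_powR; rewrite ?nnegrE ?powR_ge0 ?invr_ge0 ?(ltW s0) ?(ltW (t2 i)) //.
  apply: (@le_trans _ _ xi); last by rewrite ge_min lexx orbT.
  rewrite ler_pdivrMr ?exprn_gt0 // ler_peMr ?(ltW xi0) //.
  by apply: exprn_ege1; rewrite ler1n.
pose l i := dd i + tau i.
have [x hx] : exists x : nat -> R, forall i,
    (exists t, 0 <= t <= 1 / 4 /\ U i (circ t)) -> 0 <= x i <= 1 / 4 /\ U i (circ (x i)).
  have : forall i, exists x : R, (exists t, 0 <= t <= 1 / 4 /\ U i (circ t)) ->
      0 <= x <= 1 / 4 /\ U i (circ x).
    move=> i; have [[t ht]|nt] := pselect (exists t, 0 <= t <= 1 / 4 /\ U i (circ t)).
      by exists t.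
    by exists 0.
  by move=> /choice[x hx]; exists x.
have [n0 hn0] : exists n, forall t, confined_angle n t ->
    exists2 i, (i < n)%N & `|t - x i| < l i.
  apply: (finite_subcover (K := confined_angle)).
  - by move=> k t [].
  - by move=> j k t; apply: confined_angle_dec.
  - exact: confined_angle_closed.
  - move=> t ht; have [i _ Ui] := cov _ (confined_angle_cvg hcoef ht).
    have [t01 _] := ht 0%N.
    exists i; have [|x01 Ux] := hx i; first by exists t.
    apply: (le_lt_trans (chord_ge t01 x01)).
    apply: (@le_lt_trans _ _ (dd i)); last by rewrite /l ltrDl.
    rewrite -lee_fin; apply: (le_trans (nm_diam Ui Ux)).
    by have [<- _] := diam_fin Ui (dU i).
have [k1 hk1] : exists k1, forall k i, (k1 <= k)%N -> (i < n0)%N ->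
    (H h ^+ ((b - 21) * (J0 + k)))^-1 < 2 * l i.
  exists (Num.bound (2 * tau n0)^-1) => k i kk ilt.
  have tin : tau n0 <= tau i.
    apply: ge0_ler_powR; rewrite ?nnegrE ?invr_ge0 ?(ltW s0) ?(ltW (t2 _)) //.
    rewrite ler_pM2l // lef_pV2 ?posrE ?exprn_gt0 //.
    by apply: ler_weXn2l; rewrite ?ler1n // ltnW.
  apply: (@lt_le_trans _ _ (2 * tau n0)); last first.
    by have /andP[d0 _] := dd0 i; rewrite /l; lra.
  have tp : 0 < 2 * tau n0 by rewrite mulr_gt0.
  rewrite -[ltRHS]invrK ltf_pV2 ?posrE ?invr_gt0 //.
  have bk : (2 * tau n0)^-1 < (Num.bound (2 * tau n0)^-1)%:R.
    by apply: archi_boundP; rewrite invr_ge0 ltW.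
  apply: (lt_le_trans bk); rewrite -natrX ler_nat; apply: (leq_trans kk).
  apply: (@leq_trans (h ^ k)).
    by apply: ltnW; apply: ltn_expl; apply: leq_trans h256.
  rewrite leq_exp2l ?(leq_trans _ h256) //.
  by move: b23; clear; move=> b23; nia.
have [k kk sk] := hspread (maxn n0 k1).
have := confined_intervals (n := n0) (x := x) (l := l) sk; rewrite -/s => big.
have {}big : 1 / (32 * 32 * C) <= 2 * H h ^+ (b - 23) * \sum_(0 <= i < n0) (2 * l i) `^ s.
  apply: big => [t ht|i ilt].
    by apply: hn0; apply: confined_angle_dec ht; apply: leq_trans kk; apply: leq_maxl.
  have /andP[d0 d1] := dd0 i; have t0 := tau0 i; have tb := tauB i.
  split; [by rewrite /l; lra|by rewrite -/B0 /l; lra|].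
  by apply: hk1 => //; apply: leq_trans kk; apply: leq_maxr.
have li i : (2 * l i) `^ s <= 4 * (dd i `^ s + xi / 2 ^+ i.+1).
  have /andP[d0 _] := dd0 i; have t0 := tau0 i.
  have four y : 0 <= y -> (4 * y) `^ s <= 4 * y `^ s.
    move=> y0; rewrite powRM // ler_wpM2r ?powR_ge0 //.
    by rewrite -[leRHS]powRr1 // ler_powR // ler1n.
  rewrite -taus; case: (leP (dd i) (tau i)) => dt.
    apply: (@le_trans _ _ ((4 * tau i) `^ s)).
      apply: ge0_ler_powR; rewrite ?nnegrE ?(ltW s0) // /l; lra.
    apply: (le_trans (four _ (ltW t0))).
    by have := powR_ge0 (dd i) s; lra.
  apply: (@le_trans _ _ ((4 * dd i) `^ s)).
    apply: ge0_ler_powR; rewrite ?nnegrE ?(ltW s0) // /l; lra.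
  apply: (le_trans (four _ d0)).
  by have := powR_ge0 (tau i) s; lra.
have geo n : \sum_(0 <= i < n) xi / 2 ^+ i.+1 = xi * (1 - (2 ^+ n)^-1).
  elim: n => [|n IH]; first by rewrite big_geq // expr0; lra.
  rewrite big_nat_recr //= IH exprS; field; by rewrite expf_neq0.
have sumle : \sum_(0 <= i < n0) (2 * l i) `^ s <= 4 * (\sum_(0 <= i < n0) dd i `^ s + xi).
  apply: (@le_trans _ _ (\sum_(0 <= i < n0) 4 * (dd i `^ s + xi / 2 ^+ i.+1))).
    by apply: ler_sum => i _; apply: li.
  rewrite -mulr_sumr ler_pM2l // big_split /= lerD2l geo.
  by rewrite ler_piMr ?(ltW xi0) // gerBl invr_ge0 exprn_ge0.
have D : c2 <= \sum_(0 <= i < n0) dd i `^ s.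
  have xc : xi <= c2 by rewrite ge_min lexx.
  have Hb := HX (b - 23)%N.
  have : 1 / (32 * 32 * C) <= 8 * H h ^+ (b - 23) * (\sum_(0 <= i < n0) dd i `^ s + xi).
    apply: (le_trans big).
    have := ler_wpM2l (ltW (mulr_gt0 (ltr0Sn R 1) Hb)) sumle.
    by move/le_trans; apply; rewrite le_eqVlt; apply/orP; left; apply/eqP; ring.
  have -> : 1 / (32 * 32 * C) = 8 * H h ^+ (b - 23) * (2 * c2).
    by rewrite /c2; field; rewrite !gt_eqF.
  rewrite ler_pM2l; first lra.
  by rewrite mulr_gt0.
apply: (@le_trans _ _ (\sum_(0 <= i < n0) diam_pow s (U i))%E); last first.
  by apply: nneseries_lim_ge => i _ _; apply: diam_pow_ge0.
apply: (@le_trans _ _ (\sum_(0 <= i < n0) (dd i `^ s)%:E)%E).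
  by rewrite sumEFin lee_fin.
by apply: lee_sum => i _; apply: diam_pow_fin (dU i); rewrite gt_eqF.
Qed.
End Contents.

(** * Hausdorff dimension of subsets of the circle *)

Section Dimension.
Context {R : realType}.
Local Open Scope complex_scope.

Local Notation nm := (@ComplexField.Normc.normc R).

Lemma circ_surj (z : R[i]) : nm z = 1 -> exists2 t : R, 0 <= t <= 1 & z = circ t.
Proof.
move=> z1; have : sqn z = 1 by rewrite nm_sqn z1 expr1n.
case: z {z1} => x y; rewrite /sqn /= => xy.
have y2 := sqr_ge0 y; have x11 : -1 <= x <= 1 by apply/andP; split; nra.
have p0 := pi_gt0 R.
have a0 := acos_ge0 x11; have a1 := acos_lepi x11.
have cx : cos (acos x) = x by rewrite acosK // in_itv.
have sx : sin (acos x) = `|y|.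
  by rewrite sin_acos // (_ : 1 - x ^+ 2 = y ^+ 2) ?sqrtr_sqr //; lra.
have p2 : 0 < 2 * pi :> R by rewrite mulr_gt0.
have t01 : 0 <= acos x / (2 * pi) <= 1 / 2.
  by rewrite divr_ge0 ?(ltW p2) //= ler_pdivrMr //; lra.
have tE : 2 * pi * (acos x / (2 * pi)) = acos x by rewrite mulrC divfK // gt_eqF.
move: t01 => /andP[t0 t1]; case: (leP 0 y) => hy.
  exists (acos x / (2 * pi)); first by apply/andP; split; lra.
  by rewrite /circ tE /expi cx sx ger0_norm.
exists (1 - acos x / (2 * pi)); first by apply/andP; split; lra.
rewrite /circ mulrBr tE mulr1 /expi.
have -> : 2 * pi = pi *+ 2 :> R by rewrite mulr2n; lra.
by rewrite cosB sinB cos2pi sin2pi cx sx ltr0_norm // !mul1r !mul0r addr0 sub0r opprK.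
Qed.

Lemma sum_ltn_natr (n N : nat) : \sum_(0 <= k < n) (k < N)%N%:R <= N%:R :> R.
Proof.
have -> : \sum_(0 <= k < n) (k < N)%N%:R = (minn n N)%:R :> R.
  elim: n => [|n IH]; first by rewrite big_geq // min0n.
  rewrite big_nat_recr //= IH -natrD; congr _%:R.
  by case: (ltnP n N) => h /=; lia.
by rewrite ler_nat geq_minr.
Qed.

(** [N] equal arcs have content of the order of [N] to the power [1 - s]. *)
Lemma content_circle (A : set (Rcomplex R)) (s del : R) :
  A `<=` [set z | nm z = 1] -> 1 < s -> 0 < del -> hausdorff_content s del A = 0%E.
Proof.
move=> A1 s1 d0; apply/eqP; rewrite eq_le; apply/andP; split; last first.
  apply/ereal_infP => _ [U _ <-]; apply: nneseries_ge0 => k _ _; exact: diam_pow_ge0.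
apply/lee_addgt0Pr => xi xi0; rewrite add0e.
have s0 : 0 < s - 1 by rewrite subr_gt0.
pose y := Num.min del ((xi / 8) `^ (s - 1)^-1).
have y0 : 0 < y by rewrite lt_min d0 powR_gt0 // divr_gt0.
pose N := (Num.bound (8 / y)).+1.
have NR : 0 < N%:R :> R by rewrite ltr0n.
have N8 : 8 / N%:R <= y.
  rewrite ler_pdivrMr // mulrC -ler_pdivrMr //; apply: (@le_trans _ _ (Num.bound (8 / y))%:R).
    by apply/ltW/archi_boundP; rewrite divr_ge0 // ltW.
  by rewrite ler_nat.
have c8 : 0 <= 8 / N%:R :> R by rewrite divr_ge0.
have sum_small : N%:R * (8 / N%:R) `^ s <= xi.
  have -> : s = 1 + (s - 1) by ring.
  have c8n : 8 / N%:R != 0 :> R by rewrite gt_eqF // divr_gt0.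
  rewrite powRD ?powRr1 //; last by rewrite c8n implybT.
  rewrite mulrA mulrCA mulfV ?gt_eqF // mulr1 -ler_pdivlMl //.
  have -> : 8^-1 * xi = ((xi / 8) `^ (s - 1)^-1) `^ (s - 1).
    by rewrite -powRrM mulVf ?gt_eqF // powRr1 ?divr_ge0 ?(ltW xi0) // mulrC.
  apply: ge0_ler_powR; rewrite ?nnegrE ?powR_ge0 ?(ltW s0) //.
  by apply: (le_trans N8); rewrite ge_min lexx orbT.
pose U k : set (Rcomplex R) := if (k < N)%N then
  [set circ t | t in [set t : R | k%:R <= t * N%:R <= k.+1%:R]] else set0.
have dU k : (diam (U k) <= (8 / N%:R)%:E)%E.
  rewrite /U; case: ifP => kN; last by rewrite /diam setX0 image_set0 ereal_sup0 leNye.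
  apply: ub_ereal_sup => _ [[z z'] /= [[t ht <-] [u hu <-]] <-].
  rewrite lee_fin; apply: (le_trans (chord_le t u)); rewrite ler_pM2l //.
  rewrite -div1r ler_pdivlMr // -(ger0_norm (ltW NR)) -normrM mulrBl ler_norml.
  move: ht hu => /=; rewrite -natr1 => /andP[a1 a2] /andP[b1 b2].
  by apply/andP; split; lra.
apply: (@le_trans _ _ (\sum_(0 <= k <oo) diam_pow s (U k))%E).
  apply: ereal_inf_lbound; exists U => //; split.
    move=> z /A1 /= /circ_surj[t /andP[t0 t1] zt].
    have tN : 0 <= t * N%:R by rewrite mulr_ge0.
    have /andP[k1 k2] := truncn_itv tN; set k := Num.trunc _ in k1 k2.
    case: (ltnP k N) => kN.
      by exists k => //; rewrite /U kN zt; exists t => //=; rewrite k1 ltW.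
    have tN1 : t * N%:R = N%:R.
      apply/eqP; rewrite eq_le ler_piMl //= (le_trans _ k1) // ler_nat //.
    exists N.-1 => //; rewrite /U prednK // leqnn zt; exists t => //=.
    by rewrite tN1 lexx andbT ler_nat; exact: leq_pred.
  move=> k; apply: (le_trans (dU k)); rewrite lee_fin (le_trans N8) //.
  by rewrite ge_min lexx.
have f0 k : (0 <= diam_pow s (U k))%E by apply: diam_pow_ge0.
apply: lime_le; first by apply: is_cvg_nneseries => k _ _.
apply: nearW => n.
apply: (@le_trans _ _ (\sum_(0 <= k < n) ((k < N)%N%:R * (8 / N%:R) `^ s)%:E)%E).
  apply: lee_sum => k _; rewrite /diam_pow; case: asboolP => [_|U0].
    by rewrite lee_fin mulr_ge0 ?powR_ge0.
  have [z Uz] : U k !=set0 by apply/set0P/eqP.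
  have [dE] := diam_fin Uz (dU k); move: (fine _) dE => x -> /andP[x0 x1].
  have -> : (k < N)%N by move: Uz; rewrite /U; case: ifP.
  rewrite mul1r poweR_EFin lee_fin; apply: ge0_ler_powR; rewrite ?nnegrE //.
  by apply: ltW; apply: lt_trans s1.
rewrite sumEFin lee_fin -mulr_suml; apply: le_trans sum_small.
by rewrite ler_wpM2r ?powR_ge0 // sum_ltn_natr.
Qed.

Lemma measure_circle (A : set (Rcomplex R)) (s : R) :
  A `<=` [set z | nm z = 1] -> 1 < s -> hausdorff_measure s A = 0%E.
Proof.
move=> A1 s1; rewrite /hausdorff_measure (_ : [set _ | _ in _] = [set 0%E]) ?ereal_sup1 //.
apply/seteqP; split=> x /=.
  by move=> [del d0 <-]; apply: content_circle.
by move=> ->; exists 1 => //; apply: content_circle.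
Qed.

Lemma dim_le1 (A : set (Rcomplex R)) :
  A `<=` [set z | nm z = 1] -> (hausdorff_dim A <= 1)%E.
Proof.
move=> A1; apply/lee_addgt0Pr => x x0; apply: ereal_inf_lbound.
exists (1 + x) => //; split; first by rewrite addr_ge0 // ltW.
by apply: measure_circle => //; rewrite ltrDl.
Qed.

Lemma content_anti (A : set (Rcomplex R)) (s del del' : R) : del' <= del ->
  (hausdorff_content s del A <= hausdorff_content s del' A)%E.
Proof.
move=> dd; apply/ereal_infP => _ [U [cov dU] <-]; apply: ereal_inf_lbound.
by exists U => //; split=> // k; apply: (le_trans (dU k)); rewrite lee_fin.
Qed.

Lemma content_exponent (A : set (Rcomplex R)) (s s' del : R) : 0 <= s -> s <= s' -> del <= 1 ->
  (hausdorff_content s' del A <= hausdorff_content s del A)%E.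
Proof.
move=> s0 ss d1; apply/ereal_infP => _ [U [cov dU] <-].
apply: (@le_trans _ _ (\sum_(0 <= k <oo) diam_pow s' (U k))%E).
  by apply: ereal_inf_lbound; exists U.
apply: lee_nneseries => [k _ _|k _]; first exact: diam_pow_ge0.
apply: diam_pow_exponent => //; apply: (le_trans (dU k)); by rewrite lee_fin.
Qed.

(** Exponents below [1 - 2 / c] inherit the positive content, with diameters
    reduced to at most 1. *)
Lemma dim_ge1 (A : set (Rcomplex R)) :
  (forall c, (2 < c)%N -> exists2 del : R, 0 < del &
     (0 < hausdorff_content (1 - 2 / c%:R) del A)%E) ->
  (1 <= hausdorff_dim A)%E.
Proof.
move=> hA; apply/ereal_infP => _ [s [s0 ms] <-]; rewrite lee_fin leNgt; apply/negP => s1.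
pose c := (Num.bound (2 / (1 - s))).+3.
have s1' : 0 < 1 - s by rewrite subr_gt0.
have cR : 0 < c%:R :> R by rewrite ltr0n.
have sc : s <= 1 - 2 / c%:R.
  rewrite lerBrDr addrC -lerBrDr ler_pdivrMr // mulrC -ler_pdivrMr //.
  apply: (@le_trans _ _ (Num.bound (2 / (1 - s)))%:R).
    by apply/ltW/archi_boundP; rewrite divr_ge0 // ltW.
  by rewrite ler_nat /c; lia.
have [del d0 hpos] := hA c isT.
pose del' := Num.min del 1.
have d'0 : 0 < del' by rewrite lt_min d0 ltr01.
have h1 : (hausdorff_content s del' A <= hausdorff_measure s A)%E.
  by apply: ereal_sup_ubound; exists del'.
have h2 : (hausdorff_content (1 - 2 / c%:R) del' A <= hausdorff_content s del' A)%E.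
  by apply: content_exponent => //; rewrite ge_min lexx orbT.
have h3 : (hausdorff_content (1 - 2 / c%:R) del A <= hausdorff_content (1 - 2 / c%:R) del' A)%E.
  by apply: content_anti; rewrite ge_min lexx.
have := lt_le_trans hpos (le_trans h3 (le_trans h2 h1)).
by rewrite ms ltxx.
Qed.
End Dimension.

(** * Convergence sets of large dimension *)

Section AlmostSure.
Context {R : realType} {d : measure_display} {T : measurableType d}.
Local Open Scope complex_scope.
Context (a : nat -> R[i]) (P : probability T R) (eps : nat -> {RV P >-> R}).
Context (ha : vanishes (fun n => n%:R * sqn (a n))).
Context (heps : forall n, (0 < n)%N -> random_sign (eps n)).
Context (hind : mutually_independent [set n | (0 < n)%N] eps).

Let coef t n : R[i] := (eps n t)%:C * a n.

(** The exceptional event is that the spread fails for all large [k]. *)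
Lemma content_probability c (theta : R) : (2 < c)%N -> 0 < theta ->
  exists L : set T, [/\ measurable L, (P L <= theta%:E)%E & forall t, ~ L t ->
    (forall n, (0 < n)%N -> eps n t = sg (signs_of eps t n)) ->
    exists2 del : R, 0 < del &
     (0 < hausdorff_content (1 - 2 / c%:R) del (circle_convergence_set (coef t)))%E].
Proof.
move=> c2 t0; pose b := (c + 21)%N.
have [h h256] : exists h, (255 < h)%N by exists 256%N.
have b23 : (23 < b)%N by rewrite /b; lia.
have b22 : (22 < b)%N by apply: ltnW.
have [J0 [e [C [[J2 em el eu] vs as_ C0 prob]]]] := parameters_exist ha h256 b22 t0.
have J1 : (0 < J0)%N by apply: ltnW.
pose A k := [set t | ~~ spread_angles a h b J0 e C (signs_of eps t) k].
have hA k : measurable (A k) /\ (P (A k) <= theta%:E)%E.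
  have N1 : (0 < Ns h b J0)%N by apply: Ns_gt0.
  have N2 : (Ns h b J0 <= Ns h b (J0 + k))%N by rewrite Ns_mono // leq_addr.
  have ad : adapted (Ns h b J0) (Ns h b (J0 + k))
      (fun s => ~~ spread_angles a h b J0 e C s k).
    by move=> w w' hw; congr negb; apply: spread_adapted hw.
  have [mA pA] := sign_transfer heps hind (fun=> true) N1 N2 ad.
  split=> //; apply: (le_trans pA); rewrite lee_fin; apply: le_trans prob.
  apply: spread_prob => //.
  - exact: isotropic_weightP.
  - exact: gridsize_gt0.
  - apply: isotropic_weight_sum => //; by rewrite leq_mul2r orbT.
  - move=> j jk; apply: (@leq_trans (Ns h b (J0 + k))); last by rewrite /gridsize leq_pmull.
    by apply: (leq_trans (leq_subr _ _)); rewrite -addnS Ns_mono // leq_add2l.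
  - by move=> j jk; apply: gridsize_dvd.
have [mL pL] := liminf_prob (fun k => (hA k).1) (fun k => (hA k).2).
exists (\bigcup_k0 \bigcap_(k in [set k | (k0 <= k)%N]) A k); split=> // t nL ht.
have bc : (b - 21 = c)%N by rewrite addnK.
have := @content_pos R a h b J0 e C (signs_of eps t) h256 b23 J2 em el eu vs as_ C0 (coef t).
rewrite bc; apply.
  by move=> n n0; rewrite /coef ht.
move=> k0; apply: contrapT => nk; apply: nL; exists k0 => // k /= kk.
by apply/negP => sk; apply: nk; exists k.
Qed.

(** The convergence set depends on the signs alone, and the exceptional events have
    arbitrarily small probabilities. *)
Lemma content_ae c : (2 < c)%N -> {ae P, forall t, exists2 del : R, 0 < del &
  (0 < hausdorff_content (1 - 2 / c%:R) del (circle_convergence_set (coef t)))%E}.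
Proof.
move=> c2.
have p0 p : 0 < p.+1%:R^-1 :> R by rewrite invr_gt0.
have [L hL] := choice (fun p => content_probability c2 (p0 p)).
have mI : measurable (\bigcap_p L p).
  by apply: bigcap_measurable => [|p _]; [exists 0%N|case: (hL p)].
have PI : P (\bigcap_p L p) = 0%E.
  apply/eqP; rewrite eq_le measure_ge0 andbT; apply/lee_addgt0Pr => x x0.
  rewrite add0e; pose p := Num.bound x^-1.
  have [mp pp _] := hL p; apply: (le_trans (le_measure _ _ _ _)) (le_trans pp _).
  - by rewrite inE.
  - by rewrite inE.
  - by move=> t; apply.
  rewrite lee_fin invf_ple ?posrE //.
  apply/ltW; apply: (lt_le_trans (archi_boundP _)); first by rewrite invr_ge0 ltW.
  by rewrite ler_nat.
have nI : P.-negligible (\bigcap_p L p) by exists (\bigcap_p L p); split.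
apply: negligibleS (negligibleU nI (signs_ae heps)) => t /= nt.
apply: contrapT => /not_orP[nL ns]; apply: nt.
have /existsNP[p /not_implyP[_ np]] := nL.
have [_ _ hp] := hL p; apply: hp np _ => n n0.
by have /contrapT h := ns; apply: h.
Qed.
End AlmostSure.

(** * Dimension one *)

Lemma vanishes_sqn (R : realType) (a : nat -> R[i]) :
  Num.sqrt n%:R * ComplexField.Normc.normc (a n) @[n --> \oo] --> (0 : R) ->
  vanishes (fun n => n%:R * sqn (a n)).
Proof.
move=> ha x x0; have sx : 0 < Num.sqrt x by rewrite sqrtr_gt0.
have /cvgrPdist_le/(_ _ sx) [n0 _ hn0] := ha; exists n0 => n /hn0 /=.
rewrite sub0r normrN => h.
have -> : n%:R * sqn (a n) = `|Num.sqrt n%:R * ComplexField.Normc.normc (a n)| ^+ 2.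
  by rewrite real_normK ?num_real // exprMn sqr_sqrtr // normcE2.
by rewrite -[leRHS](sqr_sqrtr (ltW x0)) ler_sqr ?nnegrE ?sqrtr_ge0.
Qed.

Local Open Scope complex_scope.

Theorem theorem1p2 (R : realType) (a : nat -> R[i])
  (ha : Num.sqrt n%:R * ComplexField.Normc.normc (a n) @[n --> \oo] --> (0 : R))
  (d : measure_display) (T : measurableType d) (P : probability T R)
  (eps : nat -> {RV P >-> R})
  (heps : forall n, (0 < n)%N -> random_sign (eps n))
  (hind : mutually_independent [set n | (0 < n)%N] eps) :
  {ae P, forall w,
    hausdorff_dim (circle_convergence_set (fun n => (eps n w)%:C * a n)) = 1%E}.
Proof.
have va := vanishes_sqn ha.
pose A w := circle_convergence_set (fun n => (eps n w)%:C * a n).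
have nc c : P.-negligible (~` [set w | (2 < c)%N -> exists2 del : R, 0 < del &
    (0 < hausdorff_content (1 - 2 / c%:R) del (A w))%E]).
  have [c2|c2] := ltnP 2 c.
    by apply: negligibleS (content_ae va heps hind c2) => w /= nw h; apply: nw.
  by apply: negligibleS (negligible_set0 P) => w /=; apply.
apply: negligibleS (negligible_bigcup nc) => w /= nw.
apply: contrapT => nb; apply: nw; apply/eqP; rewrite eq_le; apply/andP; split.
  by apply: dim_le1 => z [].
apply: dim_ge1 => c c2; apply: contrapT => h; apply: nb.
by exists c => // /(_ c2).
Qed.
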